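(* Let $A\in\mathbb F^{n\times n}$ with $A^H=A$ be a sparse matrix whose off-diagonal nonzeros correspond to a graph with treewidth $\tau$. If $n-\operatorname{rank}(A)=O(\tau)$, then the LDL factorization of $A$ can be computed with cost $O(n\tau^{\omega-1})$.
   Context: $\mathbb F$ is an arbitrary field with a fixed involution $a\mapsto a^*$ (a field automorphism with $(a^* )^*=a$, possibly the identity); $(X^H)_{ij}=x_{ji}^*$. The exponent $\omega>2$ is such that two $n\times n$ matrices over $\mathbb F$ can be multiplied in $O(n^\omega)$ arithmetic operations. Cost counts arithmetic operations in $\mathbb F$ only (not finding a tree decomposition, reordering, or permutations). The graph of $A$ has vertex set $\{1,\dots,n\}$ and an edge $\{i,j\}$, $i\neq j$, whenever $a_{ij}\ne0$. Treewidth is the minimum over tree decompositions of the maximum bag size minus one. An LDL factorization of $A$ is $P^TAP=LDL^H$ with $P$ a permutation matrix, $L$ lower triangular with unit diagonal, and $D=D^H$ block diagonal with blocks that are $1\times1$ or $2\times2$ and anti-diagonal. When $A$ is rank deficient, the last $n-\operatorname{rank}(A)$ columns of $L$ are redundant and one may use the reduced form with $L\in\mathbb F^{n\times\operatorname{rank}(A)}$ lower trapezoidal with unit diagonal and $D\in\mathbb F^{\operatorname{rank}(A)\times\operatorname{rank}(A)}$. Computing the factorization means producing $P$, $D$ and the entries of $L$ explicitly. *)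

(* Defs.v *)
From HB Require Import structures.
From mathcomp Require Import all_boot all_order all_fingroup all_algebra.
From mathcomp Require Import reals exp.

Set Implicit Arguments.
Unset Strict Implicit.
Unset Printing Implicit Defensive.

Import Order.TTheory GRing.Theory Num.Theory.
Local Open Scope ring_scope.

(* Algebraic computation trees over F.  The inputs are indexed by I; the k-th
   value computed along a branch is referred to as [Reg k].  Field constants
   and zero tests are free, every field operation and every application of the
   involution costs 1.  Programs are first-order data, so they cannot inspect
   field elements except through [IfZero]. *)
Section ComputationTrees.
Variables F I : Type.

Inductive operand := Input of I | Reg of nat | Const of F.

Inductive instr :=
  | Add of operand & operand
  | Sub of operand & operand
  | Mul of operand & operand
  | Div of operand & operand
  | Conj of operand.

Inductive program (O : Type) :=
  | Return of O
  | Compute of instr & program O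
  | IfZero of operand & program O & program O.

End ComputationTrees.

Arguments Reg {F I}.
Arguments Const {F I}.
Arguments Input {F I}.

Section Execution.
Variables (F : fieldType) (theta : F -> F) (I : Type) (x : I -> F).

Definition operand_val (mem : seq F) (a : operand F I) : F :=
  match a with
  | Input i => x i
  | Reg k => mem`_k
  | Const c => c
  end.

Definition instr_val (mem : seq F) (c : instr F I) : F :=
  match c with
  | Add a b => operand_val mem a + operand_val mem b
  | Sub a b => operand_val mem a - operand_val mem b
  | Mul a b => operand_val mem a * operand_val mem b
  | Div a b => operand_val mem a / operand_val mem b
  | Conj a => theta (operand_val mem a)
  end.

Fixpoint exec (O : Type) (mem : seq F) (p : program F I O) : O * seq F :=
  match p with
  | Return o => (o, mem)
  | Compute c q => exec (rcons mem (instr_val mem c)) q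
  | IfZero a q r => if operand_val mem a == 0 then exec mem q else exec mem r
  end.

Fixpoint exec_cost (O : Type) (mem : seq F) (p : program F I O) : nat :=
  match p with
  | Return _ => 0%N
  | Compute c q => (exec_cost (rcons mem (instr_val mem c)) q).+1
  | IfZero a q r =>
      if operand_val mem a == 0 then exec_cost mem q else exec_cost mem r
  end.

Definition leaf (O : Type) (p : program F I O) : O := (exec [::] p).1.

Definition mx_result (O : Type) (p : program F I O) (m n : nat)
    (M : 'M[operand F I]_(m, n)) : 'M[F]_(m, n) :=
  map_mx (operand_val (exec [::] p).2) M.

Definition cost (O : Type) (p : program F I O) : nat := exec_cost [::] p.

End Execution.

Definition mm_index (n : nat) : Type := ('I_n * 'I_n + 'I_n * 'I_n)%type.

Definition mm_input (F : Type) (n : nat) (X Y : 'M[F]_n) (i : mm_index n) : F :=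
  match i with
  | inl ij => X ij.1 ij.2
  | inr ij => Y ij.1 ij.2
  end.

Definition mm_program (F : Type) (n : nat) : Type :=
  program F (mm_index n) 'M[operand F (mm_index n)]_n.

Definition matmul_exponent (F : fieldType) (theta : F -> F) (R : realType)
    (omega : R) : Prop :=
  exists (mm : forall n, mm_program F n) (C : R),
    forall (n : nat) (X Y : 'M[F]_n),
      let x := mm_input X Y in
      mx_result theta x (mm n) (leaf theta x (mm n)) = X *m Y /\
      (cost theta x (mm n))%:R <= C * n%:R `^ omega.

Section Treewidth.
Variables (V : finType) (e : rel V).

Definition is_tree (T : finType) (t : rel T) : Prop :=
  [/\ (0 < #|T|)%N, symmetric t, irreflexive t, forall a b, connect t a b
    & forall c : seq T, (2 < size c)%N -> ~~ ucycleb t c].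

Definition tree_decomposition (T : finType) (t : rel T) (B : T -> {set V}) :
    Prop :=
  [/\ is_tree t,
      forall v, exists a, v \in B a,
      forall u v, e u v -> exists a, (u \in B a) && (v \in B a)
    & forall v a b, v \in B a -> v \in B b ->
        connect [rel c d | [&& t c d, v \in B c & v \in B d]] a b].

Definition td_width (T : finType) (B : T -> {set V}) : nat :=
  (\max_(a : T) #|B a|).-1.

Definition has_treewidth (tau : nat) : Prop :=
  (exists (T : finType) (t : rel T) (B : T -> {set V}),
     tree_decomposition t B /\ td_width B = tau) /\
  (forall (T : finType) (t : rel T) (B : T -> {set V}),
     tree_decomposition t B -> (tau <= td_width B)%N).

End Treewidth.

Definition mx_graph (F : fieldType) (n : nat) (A : 'M[F]_n) : rel 'I_n :=
  [rel i j | (i != j) && ((A i j != 0) || (A j i != 0))].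

Section LDL.
Variables (F : fieldType) (theta : F -> F).

Definition conjtr (m n : nat) (M : 'M[F]_(m, n)) : 'M[F]_(n, m) :=
  map_mx theta M^T.

(* b lists the sizes of the consecutive diagonal blocks *)
Definition ldl_block_diagonal (m : nat) (D : 'M[F]_m) : Prop :=
  exists b : seq nat,
    [/\ all (mem [:: 1%N; 2%N]) b, sumn b = m,
        forall i j : 'I_m, reshape_index b i != reshape_index b j -> D i j = 0
      & forall i : 'I_m, nth 0%N b (reshape_index b i) = 2%N -> D i i = 0].

Definition unit_lower_trapezoidal (n m : nat) (L : 'M[F]_(n, m)) : Prop :=
  forall (i : 'I_n) (j : 'I_m),
    ((i < j)%N -> L i j = 0) /\ (i = j :> nat -> L i j = 1).

Definition is_LDL (n m : nat) (A : 'M[F]_n) (s : 'S_n) (L : 'M[F]_(n, m))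
    (D : 'M[F]_m) : Prop :=
  [/\ (perm_mx s)^T *m A *m perm_mx s = L *m D *m conjtr L,
      unit_lower_trapezoidal L, conjtr D = D & ldl_block_diagonal D].

(* The full form (square L and D), whose leading \rank A columns form the
   reduced one. *)
Definition is_LDL_factorization (n : nat) (A : 'M[F]_n) (s : 'S_n)
    (L D : 'M[F]_n) : Prop :=
  let lead := widen_ord (rank_leq_row A) in
  is_LDL A s L D /\ is_LDL A s (colsub lead L) (mxsub lead lead D).

Definition mx_input (n : nat) (A : 'M[F]_n) (ij : 'I_n * 'I_n) : F :=
  A ij.1 ij.2.

End LDL.

Record ldl_output (T : Type) (n : nat) : Type := LDLOutput {
  out_perm : 'S_n;
  out_L : 'M[T]_n;
  out_D : 'M[T]_n
}.

Definition ldl_program (F : Type) (n : nat) : Type :=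
  program F ('I_n * 'I_n) (ldl_output (operand F ('I_n * 'I_n)) n).

Definition computes_LDL (F : fieldType) (theta : F -> F) (n : nat)
    (p : ldl_program F n) (A : 'M[F]_n) : Prop :=
  let x := mx_input A in
  let o := leaf theta x p in
  is_LDL_factorization theta A (out_perm o)
    (mx_result theta x p (out_L o)) (mx_result theta x p (out_D o)).

(* Main.v *)
Require Import Defs.
From mathcomp Require Import all_boot all_order all_fingroup all_algebra.
From mathcomp Require Import reals exp boolp.
From mathcomp Require Import zify ring lra.
Import Order.TTheory GRing.Theory Num.Theory.
Local Open Scope ring_scope.

Set Implicit Arguments.
Unset Strict Implicit.
Unset Printing Implicit Defensive.

(** The elimination runs over a tree of separators extracted from a tree
    decomposition.  A stage collects the vertices that are already separated
    from the rest of the graph, factors their principal submatrix as far as it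
    has nonzero pivots, and updates the Schur complement; the vertices left
    over span a zero block and are delayed to the next stage.  As their rows
    live on a separator, at most O(tau) + corank(A) = O(tau) of them are left
    over, so every stage is a dense problem of size O(tau), and a new stage is
    started only when tau fresh vertices are pending or when two earlier stages
    meet, which gives O(n / tau) stages.

    A dense stage costs O(tau^omega): after eliminating the first half of the
    vertices the Schur complement vanishes on them, so the remaining pivots
    come from an LU elimination of the off-diagonal block (pairs, hence 2x2
    blocks), followed by the second half.  The order of the pivots being known,
    a second divide and conquer computes, for pivots [P], the inverse [N] of
    [M] on [P] and a triangular [Z] with [N = Z D Z^H]; then [L = M Z].

    All matrices are indexed by the full vertex set, supports being tracked
    separately, and permutations only appear at the very end.  Zero tests are
    free, so the program first reads off the graph of [A]. *)

(** * Computations in a growing memory *)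

(** Treating every bag as a dense problem of its own would cost n tau^omega; the factor tau is saved
    by batching. The obstacle is zero pivots, which delay vertices into later stages. Rank controls
    them: the rows left over by a stage are supported on at most tau + 1 columns, so all but tau + 1
    of these vertices count towards the corank. The number of stages is bounded by amortization:
    with K the cost of a stage, every vertex deposits 2 K / tau. Thus tau vertices pay for a stage
    and leave a reserve K with it, and two reserves that meet pay for the stage merging them and for
    its own reserve.

    The strict inequality omega > 2 enters as w = 2^omega > 4, in the rectangular elimination
    searching for pairs, where each level doubles both the number of calls and the ratio of columns
    to rows.

    The search is separated from the factorization because it yields inverses of off-diagonal blocks
    but no triangular factor. Treewidth 0 stands apart: no operation is allowed, and the matrix is
    diagonal and nonsingular. *)

Section Builders.
Variables F I : Type.

(* A builder receives the number of values computed so far, so that the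
   absolute register indices of [program] can be generated compositionally. *)
Definition builder (O : Type) := nat -> program F I O.

Definition cret (O : Type) (o : O) : builder O := fun _ => Return F I o.

Fixpoint pbind (O O' : Type) (p : program F I O) (k : nat)
    (f : O -> builder O') : program F I O' :=
  match p with
  | Return o => f o k
  | Compute c q => Compute c (pbind q k.+1 f)
  | IfZero a q r => IfZero a (pbind q k f) (pbind r k f)
  end.

Definition cbind (O O' : Type) (c : builder O) (f : O -> builder O') : builder O' :=
  fun k => pbind (c k) k f.

Definition cinstr (c : instr F I) : builder (operand F I) :=
  fun k => Compute c (Return F I (Reg k)).

Definition cif (O : Type) (a : operand F I) (c d : builder O) : builder O :=
  fun k => IfZero a (c k) (d k).

End Builders.

Arguments cret {F I O}.
Arguments cinstr {F I}.

Notation "'let!' x ':=' c 'in' f" := (cbind c (fun x => f))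
  (at level 200, x name, c at level 200, f at level 200).

(** * Hoare-style rules for correctness and cost *)

Section Hoare.
Variables (F : fieldType) (theta : F -> F) (I : Type) (x : I -> F).

(** Quantifying over all extensions makes the notion stable: memory only grows, so a represented
    value stays represented in every later state. *)
Definition rep (mem : seq F) (a : operand F I) (v : F) : Prop :=
  forall e, operand_val x (mem ++ e) a = v.

Lemma rep_ext mem e a v : rep mem a v -> rep (mem ++ e) a v.
Proof. by move=> h e'; rewrite -catA. Qed.

Lemma rep_val mem a v : rep mem a v -> operand_val x mem a = v.
Proof. by move/(_ [::]); rewrite cats0. Qed.

Definition runs (O : Type) (mem : seq F) (c : builder F I O)
    (Q : O -> seq F -> nat -> Prop) : Prop :=
  let p := c (size mem) in
  exists e : seq F, (exec theta x mem p).2 = mem ++ e /\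
    Q (exec theta x mem p).1 (mem ++ e) (exec_cost theta x mem p).

Lemma runs_weaken O mem (c : builder F I O) (Q Q' : O -> seq F -> nat -> Prop) :
  runs mem c Q -> (forall o e t, Q o (mem ++ e) t -> Q' o (mem ++ e) t) ->
  runs mem c Q'.
Proof. by move=> [e [h1 h2]] h; exists e; split=> //; apply: h. Qed.

Lemma runs_ret O mem (o : O) (Q : O -> seq F -> nat -> Prop) :
  Q o mem 0%N -> runs mem (cret o) Q.
Proof. by move=> h; exists [::]; rewrite cats0. Qed.

Lemma runs_instr mem c (Q : operand F I -> seq F -> nat -> Prop) :
  Q (Reg (size mem)) (rcons mem (instr_val theta x mem c)) 1%N ->
  runs mem (cinstr c) Q.
Proof.
move=> h; exists [:: instr_val theta x mem c].
by rewrite /= cats1; split.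
Qed.

Lemma runs_if O mem a v (c d : builder F I O) Q :
  rep mem a v -> (v = 0 -> runs mem c Q) -> (v != 0 -> runs mem d Q) ->
  runs mem (cif a c d) Q.
Proof.
move=> /rep_val; rewrite /runs /= => -> h1 h2.
by case: eqVneq => [/h1|/h2].
Qed.

Lemma exec_pbind O O' (p : program F I O) (f : O -> builder F I O') mem :
  let r := exec theta x mem p in
  exec theta x mem (pbind p (size mem) f) = exec theta x r.2 (f r.1 (size r.2))
  /\ exec_cost theta x mem (pbind p (size mem) f) =
     (exec_cost theta x mem p + exec_cost theta x r.2 (f r.1 (size r.2)))%N.
Proof.
elim: p mem => [o|c q IH|a q IHq r IHr] mem //=.
  have := IH (rcons mem (instr_val theta x mem c)).
  by rewrite size_rcons /= => -[-> ->].
by case: ifP => _.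
Qed.

Lemma runs_bind O O' mem (c : builder F I O) (f : O -> builder F I O') Q1 Q2 :
  runs mem c Q1 ->
  (forall o e t, Q1 o (mem ++ e) t ->
     runs (mem ++ e) (f o) (fun o' m' t' => Q2 o' m' (t + t')%N)) ->
  runs mem (cbind c f) Q2.
Proof.
move=> [e [h1 h2]] h; have [e' [h3 h4]] := h _ _ _ h2.
have [E1 E2] := exec_pbind (c (size mem)) f mem.
exists (e ++ e'); rewrite /cbind E1 E2 h1 catA; split; first exact: h3.
exact: h4.
Qed.

Variable R : realType.

Definition runsb (O : Type) (mem : seq F) (c : builder F I O) (b : R)
    (Q : O -> seq F -> Prop) : Prop :=
  runs mem c (fun o m t => t%:R <= b /\ Q o m).

Lemma runsb_weaken O mem (c : builder F I O) b b' (Q Q' : O -> seq F -> Prop) :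
  runsb mem c b Q -> b <= b' -> (forall o e, Q o (mem ++ e) -> Q' o (mem ++ e)) ->
  runsb mem c b' Q'.
Proof.
move=> h hb hQ; apply: runs_weaken h _ => o e t [ht q].
by split; [apply: le_trans hb|apply: hQ].
Qed.

Lemma runsb_ret O mem (o : O) b (Q : O -> seq F -> Prop) :
  0 <= b -> Q o mem -> runsb mem (cret o) b Q.
Proof. by move=> hb h; apply: runs_ret. Qed.

Lemma runsb_instr mem c v b (Q : operand F I -> seq F -> Prop) :
  instr_val theta x mem c = v -> 1 <= b ->
  (forall o e, rep (mem ++ e) o v -> Q o (mem ++ e)) ->
  runsb mem (cinstr c) b Q.
Proof.
move=> hv hb hQ; apply: runs_instr; split=> //.
rewrite -cats1; apply: hQ; rewrite hv => e /=.
by rewrite -catA nth_cat ltnn subnn.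
Qed.

Lemma runsb_if O mem a v (c d : builder F I O) b Q :
  rep mem a v -> (v = 0 -> runsb mem c b Q) -> (v != 0 -> runsb mem d b Q) ->
  runsb mem (cif a c d) b Q.
Proof. exact: runs_if. Qed.

Lemma runsb_bind O O' mem (c : builder F I O) (f : O -> builder F I O') b1 b2 b Q1 Q2 :
  runsb mem c b1 Q1 ->
  (forall o e, Q1 o (mem ++ e) -> runsb (mem ++ e) (f o) b2 Q2) ->
  b1 + b2 <= b ->
  runsb mem (cbind c f) b Q2.
Proof.
move=> h1 h2 hb; apply: (runs_bind h1) => o e t [ht q].
apply: runs_weaken (h2 _ _ q) _ => o' e' t' [ht' q'].
by split=> //; rewrite natrD; apply: le_trans hb; apply: lerD.
Qed.

End Hoare.

(** * Embedding a program into a running computation *)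

Section Relocation.
Variables (F I J : Type) (base : nat) (f : J -> operand F I).

(** An unwritten register reads as 0. Later computations would fill the shifted register, so such a
    reference becomes the constant [zero]. *)
Definition reloc_op (zero : operand F I) (cnt : nat) (a : operand F J) :
    operand F I :=
  match a with
  | Input j => f j
  | Reg r => if (r < cnt)%N then Reg (base + r) else zero
  | Const c => Const c
  end.

Definition reloc_instr (zero : operand F I) (cnt : nat) (c : instr F J) :
    instr F I :=
  match c with
  | Add a b => Add (reloc_op zero cnt a) (reloc_op zero cnt b)
  | Defs.Sub a b => Defs.Sub (reloc_op zero cnt a) (reloc_op zero cnt b)
  | Mul a b => Mul (reloc_op zero cnt a) (reloc_op zero cnt b)
  | Div a b => Div (reloc_op zero cnt a) (reloc_op zero cnt b)
  | Conj a => Conj (reloc_op zero cnt a)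
  end.

Fixpoint reloc (zero : operand F I) (m1 m2 cnt : nat)
    (p : program F J 'M[operand F J]_(m1, m2)) :
    program F I 'M[operand F I]_(m1, m2) :=
  match p with
  | Return o => Return F I (map_mx (reloc_op zero cnt) o)
  | Compute c q => Compute (reloc_instr zero cnt c) (reloc zero cnt.+1 q)
  | IfZero a q r =>
      IfZero (reloc_op zero cnt a) (reloc zero cnt q) (reloc zero cnt r)
  end.

End Relocation.

Section RelocationSpec.
Variables (F : fieldType) (theta : F -> F) (I J : Type) (x : I -> F).
Variables (f : J -> operand F I) (y : J -> F) (mem : seq F).
Hypothesis fy : forall j, rep x mem (f j) (y j).

Let zero : operand F I := Const 0.

Lemma rep_reloc_op m a :
  rep x (mem ++ m) (reloc_op (size mem) f zero (size m) a) (operand_val y m a).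
Proof.
move=> e; case: a => [j|r|c] //=; first by rewrite -catA fy.
case: ltnP => h /=; last by rewrite nth_default.
by rewrite -catA nth_cat ltnNge leq_addr /= addKn nth_cat h.
Qed.

Lemma exec_reloc (m1 m2 : nat) (p : program F J 'M[operand F J]_(m1, m2)) m :
  let r := exec theta y m p in
  exec theta x (mem ++ m) (reloc (size mem) f zero (size m) p) =
    (map_mx (reloc_op (size mem) f zero (size r.2)) r.1, mem ++ r.2) /\
  exec_cost theta x (mem ++ m) (reloc (size mem) f zero (size m) p) =
    exec_cost theta y m p.
Proof.
have V m' a := rep_val (rep_reloc_op m' a).
elim: p m => [o|c q IH|a q IHq r IHr] m //=; last first.
  by rewrite V; case: ifP.
have -> : instr_val theta x (mem ++ m) (reloc_instr (size mem) f zero (size m) c)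
          = instr_val theta y m c by case: c => * /=; rewrite !V.
rewrite rcons_cat; have := IH (rcons m (instr_val theta y m c)).
by rewrite size_rcons => -[-> ->].
Qed.

End RelocationSpec.

(** * Inverses of submatrices and Schur complements *)

Section Projectors.
Variables (F : fieldType) (n : nat).
Implicit Types (s t : seq 'I_n) (X : 'M[F]_n).

(** Coordinate projectors stand in for submatrices: [dg s *m X *m dg t] is the block of rows [s] and
    columns [t], with the matrix type unchanged. *)
Definition dg s : 'M[F]_n := \matrix_(i, j) ((i == j) && (i \in s))%:R.

Lemma mul_dgE s X i j : (dg s *m X) i j = if i \in s then X i j else 0.
Proof.
rewrite mxE (bigD1 i) //= big1 => [|k ki]; rewrite !mxE ?eqxx /=.
  by rewrite addr0; case: (i \in s); rewrite ?mul1r ?mul0r.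
by rewrite eq_sym (negbTE ki) mul0r.
Qed.

Lemma mul_rdgE s X i j : (X *m dg s) i j = if j \in s then X i j else 0.
Proof.
rewrite mxE (bigD1 j) //= big1 => [|k kj]; rewrite !mxE ?eqxx /=.
  by rewrite addr0; case: (j \in s); rewrite ?mulr1 ?mulr0.
by rewrite (negbTE kj) mulr0.
Qed.

Lemma tr_dg s : (dg s)^T = dg s.
Proof. by apply/matrixP=> i j; rewrite !mxE eq_sym; case: eqVneq => // ->. Qed.

Lemma eq_dg s t : s =i t -> dg s = dg t.
Proof. by move=> h; apply/matrixP=> i j; rewrite !mxE h. Qed.

Lemma dg_nil : dg [::] = 0.
Proof. by apply/matrixP=> i j; rewrite !mxE andbF. Qed.

Lemma dg_subl s t : {subset s <= t} -> dg s *m dg t = dg s.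
Proof.
move=> h; apply/matrixP=> i j; rewrite mul_dgE !mxE.
by case: (boolP (i \in s)) => [/h ->|]; rewrite ?andbF.
Qed.

Lemma dg_subr s t : {subset s <= t} -> dg t *m dg s = dg s.
Proof. by move=> h; rewrite -[LHS]trmxK trmx_mul !tr_dg dg_subl ?tr_dg. Qed.

Lemma dgK s : dg s *m dg s = dg s.
Proof. exact: dg_subl. Qed.

Lemma dg_disj s t : {in s, forall i, i \notin t} -> dg s *m dg t = 0.
Proof.
move=> h; apply/matrixP=> i j; rewrite mul_dgE !mxE.
by case: (boolP (i \in s)) => [/h /negbTE ->|]; rewrite ?andbF.
Qed.

Lemma dg_disjC s t : {in s, forall i, i \notin t} -> dg t *m dg s = 0.
Proof. by move=> h; rewrite -[LHS]trmxK trmx_mul !tr_dg dg_disj ?trmx0. Qed.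

Lemma dg_cat s t : {in s, forall i, i \notin t} -> dg (s ++ t) = dg s + dg t.
Proof.
move=> h; apply/matrixP=> i j; rewrite !mxE mem_cat; case: eqVneq => //= _; last first.
  by rewrite addr0.
by case: (boolP (i \in s)) => [/h /negbTE ->|]; rewrite ?addr0 ?add0r.
Qed.

Lemma mxrank_dg s : (\rank (dg s) <= size s)%N.
Proof.
elim: s => [|v s IH]; first by rewrite dg_nil mxrank0.
case: (boolP (v \in s)) => vs.
  rewrite (@eq_dg _ s) ?(leq_trans IH) //= => i.
  by rewrite inE; case: eqVneq => // ->.
rewrite -cat1s dg_cat; last by move=> i; rewrite inE => /eqP ->.
apply: leq_trans (mxrank_add _ _) _; rewrite /= -add1n leq_add //.
rewrite (_ : dg [:: v] = delta_mx v v) ?mxrank_delta //.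
apply/matrixP=> i j; rewrite !mxE inE.
by case: (eqVneq i v) => [->|]; rewrite ?andbT ?andbF // eq_sym.
Qed.

Lemma mul_dg_catl s t X :
  dg s *m X = 0 -> dg t *m X = 0 -> dg (s ++ t) *m X = 0.
Proof.
move=> /matrixP h1 /matrixP h2; apply/matrixP => i j.
move: (h1 i j) (h2 i j); rewrite !mul_dgE mem_cat !mxE.
by case: (i \in s); case: (i \in t).
Qed.

Lemma dg_row_eq s X Y i j : dg s *m X = dg s *m Y -> i \in s -> X i j = Y i j.
Proof. by move=> /matrixP/(_ i j); rewrite !mul_dgE => h si; move: h; rewrite si. Qed.

Lemma dg_row0 s X i j : dg s *m X = 0 -> i \in s -> X i j = 0.
Proof. by move=> /matrixP/(_ i j); rewrite !mul_dgE mxE => h si; move: h; rewrite si. Qed.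

End Projectors.

Section Inverses.
Variables (F : fieldType) (n : nat).
Implicit Types (I J : seq 'I_n) (B H : 'M[F]_n).
Local Notation dg := (@dg F n).

(* [H] is the inverse of the square submatrix of [B] with rows [I] and
   columns [J], extended by zero. *)
Definition inv_on I J B H :=
  [/\ dg I *m B *m H = dg I, H *m B *m dg J = dg J & dg J *m H *m dg I = H].

(** For [H] the inverse on a pivot block, this is the Schur complement padded with zeros: pivot rows
    and columns vanish instead of being removed. *)
Definition schur B H := B - B *m H *m B.

(** This is H1 + (1 - H1 B) H2 (1 - B H1), the block inversion formula in terms of the inverse [H1]
    of the first block and the inverse [H2] of its Schur complement. *)
Definition comp_inv B H1 H2 :=
  let A := H2 - H1 *m B *m H2 in H1 + A - A *m B *m H1.

Lemma inv_onl I J B H : inv_on I J B H -> dg J *m H = H.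
Proof. by case=> _ _ <-; rewrite !mulmxA dgK. Qed.

Lemma inv_onr I J B H : inv_on I J B H -> H *m dg I = H.
Proof. by case=> _ _ <-; rewrite -!mulmxA dgK. Qed.

Lemma inv_on_tr I J B H : inv_on I J B H -> inv_on J I B^T H^T.
Proof.
by case=> h1 h2 h3; split; apply: trmx_inj; rewrite !trmx_mul ?trmxK !tr_dg ?mulmxA.
Qed.

Lemma inv_on_eq I I' J J' B H :
  I =i I' -> J =i J' -> inv_on I J B H -> inv_on I' J' B H.
Proof. by move=> h1 h2; rewrite /inv_on (eq_dg _ h1) (eq_dg _ h2). Qed.

Lemma inv_on_congr I J B B' H :
  dg I *m B *m dg J = dg I *m B' *m dg J -> inv_on I J B H -> inv_on I J B' H.
Proof.
move=> e h; have hl := inv_onl h; have hr := inv_onr h.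
case: h => h1 h2 h3; split=> //.
  by rewrite -hl mulmxA -e -mulmxA hl.
by rewrite -hr -!mulmxA (mulmxA (dg I)) -e !mulmxA hr.
Qed.

Lemma inv_on_nil B : inv_on [::] [::] B 0.
Proof. by split; rewrite !(dg_nil, mul0mx, mulmx0). Qed.

Lemma inv_on_uniq I J B H H' : inv_on I J B H -> inv_on I J B H' -> H = H'.
Proof.
move=> h h'; have hl := inv_onl h; have hr := inv_onr h'.
have E : H = H' *m B *m H.
  by rewrite -{1}hl -(let: And3 _ e _ := h' in e) -!mulmxA hl.
by rewrite E -hr -!mulmxA (mulmxA (dg I)) (let: And3 e _ _ := h in e).
Qed.

Lemma schur_row0 I J B H : inv_on I J B H -> dg I *m schur B H = 0.
Proof. by case=> h1 _ _; rewrite /schur mulmxBr !mulmxA h1 subrr. Qed.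

Lemma schur_col0 I J B H : inv_on I J B H -> schur B H *m dg J = 0.
Proof.
by case=> _ h2 _; rewrite /schur mulmxBl -!mulmxA (mulmxA H) h2 subrr.
Qed.

(** A zero row cannot belong to a nonsingular submatrix. Applied to a Schur complement, this makes
    later pivots automatically disjoint from earlier ones. *)
Lemma inv_on_rows I1 I2 J2 S H :
  dg I1 *m S = 0 -> inv_on I2 J2 S H -> {in I1, forall i, i \notin I2}.
Proof.
move=> h0 [h1 _ _] i i1; apply/negP => i2.
have /matrixP/(_ i i) := h1; rewrite -mulmxA mul_dgE i2 !mxE eqxx i2 /=.
rewrite big1 => [/eqP|k _]; first by rewrite eq_sym oner_eq0.
by rewrite (dg_row0 k h0 i1) mul0r.
Qed.

Lemma inv_on_cols J1 I2 J2 S H :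
  S *m dg J1 = 0 -> inv_on I2 J2 S H -> {in J1, forall i, i \notin J2}.
Proof.
move=> h0 /inv_on_tr; apply: inv_on_rows.
by apply: trmx_inj; rewrite trmx_mul trmxK tr_dg trmx0.
Qed.

Lemma schur_tr B H : (schur B H)^T = schur B^T H^T.
Proof. by rewrite /schur linearD linearN /= !trmx_mul mulmxA. Qed.

Lemma comp_inv_tr B H1 H2 : (comp_inv B H1 H2)^T = comp_inv B^T H1^T H2^T.
Proof.
rewrite /comp_inv !(linearD, linearN) /= !trmx_mul !(linearD, linearN) /= !trmx_mul.
rewrite !mulmxBl !mulmxA opprB opprK -!addrA; congr (_ + (_ + _)).
by rewrite addrC -addrA.
Qed.

(** Only the right-inverse identity is computed; [inv_comp] obtains the left one by transposing
    everything. *)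
Lemma inv_comp_half I1 I2 J1 J2 B H1 H2 :
  inv_on I1 J1 B H1 -> inv_on I2 J2 (schur B H1) H2 ->
  dg (I1 ++ I2) *m B *m comp_inv B H1 H2 = dg (I1 ++ I2).
Proof.
move=> h1 h2; rewrite dg_cat; last exact: inv_on_rows (schur_row0 h1) h2.
have E D : D *m B *m comp_inv B H1 H2 = D *m B *m H1 +
    D *m schur B H1 *m H2 - D *m schur B H1 *m H2 *m B *m H1.
  have EA : B *m (H2 - H1 *m B *m H2) = schur B H1 *m H2.
    by rewrite /schur mulmxBr mulmxBl !mulmxA.
  by rewrite -(mulmxA D (schur _ _)) -EA /comp_inv mulmxBr mulmxDr !mulmxA.
rewrite !mulmxDl !E (schur_row0 h1) !mul0mx addr0 subr0.
have [-> _ _] := h1; have [-> _ _] := h2.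
by rewrite (addrC _ (dg I2)) addrK.
Qed.

Lemma inv_comp I1 I2 J1 J2 B H1 H2 :
  inv_on I1 J1 B H1 -> inv_on I2 J2 (schur B H1) H2 ->
  inv_on (I1 ++ I2) (J1 ++ J2) B (comp_inv B H1 H2).
Proof.
move=> h1 h2; split; first exact: (inv_comp_half h1 h2).
  have h1' := inv_on_tr h1.
  have h2' : inv_on J2 I2 (schur B^T H1^T) H2^T.
    by rewrite -schur_tr; apply: inv_on_tr.
  apply: trmx_inj; rewrite !trmx_mul comp_inv_tr tr_dg mulmxA.
  exact: inv_comp_half h1' h2'.
have sub1 s t : {subset s <= s ++ t} by move=> i hi; rewrite mem_cat hi.
have sub2 s t : {subset t <= s ++ t} by move=> i hi; rewrite mem_cat hi orbT.
have L1 : dg (J1 ++ J2) *m H1 = H1 by rewrite -(inv_onl h1) mulmxA dg_subr.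
have L2 : dg (J1 ++ J2) *m H2 = H2 by rewrite -(inv_onl h2) mulmxA dg_subr.
have R1 : H1 *m dg (I1 ++ I2) = H1 by rewrite -(inv_onr h1) -mulmxA dg_subl.
have R2 : H2 *m dg (I1 ++ I2) = H2 by rewrite -(inv_onr h2) -mulmxA dg_subl.
rewrite /comp_inv !(mulmxBl, mulmxBr, mulmxDl, mulmxDr) !mulmxA !(L1, L2).
by rewrite !(mulmxN, mulNmx) !mulmxA !(L1, L2) -!mulmxA !(R1, R2).
Qed.

(** Everything follows from [B *m A = schur B H1 *m H2] for the matrix [A] inside [comp_inv]. This
    is the quotient property of Schur complements. *)
Lemma schur_comp B H1 H2 :
  schur B (comp_inv B H1 H2) = schur (schur B H1) H2.
Proof.
have EA : B *m (H2 - H1 *m B *m H2) = schur B H1 *m H2.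
  by rewrite /schur mulmxBr mulmxBl !mulmxA.
have -> : schur (schur B H1) H2 = schur B H1 - schur B H1 *m H2 *m schur B H1.
  by [].
rewrite -EA /comp_inv /schur; move: (H2 - _) => A.
rewrite !(mulmxBl, mulmxBr, mulmxDl, mulmxDr) !mulmxA.
by rewrite !(opprD, opprB, opprK) !addrA addrAC.
Qed.

(** Half of the classical fact that the trailing block of an inverse inverts the Schur complement;
    [inv_restrict] gets the other half by transposition. *)
Lemma inv_restrict_half I1 I2 J1 J2 B X H1 :
  inv_on (I1 ++ I2) (J1 ++ J2) B X -> inv_on I1 J1 B H1 ->
  {in I1, forall i, i \notin I2} -> {in J1, forall i, i \notin J2} ->
  dg I2 *m schur B H1 *m (dg J2 *m X *m dg I2) = dg I2.
Proof.
move=> hx h1 dI dJ.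
(* The Schur complement vanishes on the columns [J1], so the mask can be enlarged to the full column
   set, where [X] is an inverse. *)
have e : schur B H1 *m dg J2 = schur B H1 *m dg (J1 ++ J2).
  by rewrite dg_cat // mulmxDr (schur_col0 h1) add0r.
have xl := inv_onl hx; have r1 := inv_onr h1.
case: hx => x1 _ _.
have b1 : dg I1 *m (B *m X) = dg I1.
  rewrite -(@dg_subl F n I1 (I1 ++ I2)); last by move=> i hi; rewrite mem_cat hi.
  by rewrite -mulmxA (mulmxA (dg (I1 ++ I2))) x1.
have b2 : dg I2 *m (B *m X) = dg I2.
  rewrite -(@dg_subl F n I2 (I1 ++ I2)); last by move=> i hi; rewrite mem_cat hi orbT.
  by rewrite -mulmxA (mulmxA (dg (I1 ++ I2))) x1.
have -> : dg I2 *m schur B H1 *m (dg J2 *m X *m dg I2) =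
          dg I2 *m ((schur B H1 *m dg J2) *m X) *m dg I2 by rewrite !mulmxA.
rewrite e.
have b3 : H1 *m (B *m X) = H1 by rewrite -{1}r1 -mulmxA b1 r1.
have -> : schur B H1 *m dg (J1 ++ J2) *m X = B *m X - B *m H1.
  by rewrite -mulmxA xl /schur mulmxBl -!mulmxA b3.
rewrite mulmxBr b2 mulmxBl dgK -{1}r1 -!mulmxA dg_disj // !mulmx0.
by rewrite subr0.
Qed.

Lemma inv_restrict I1 I2 J1 J2 B X H1 :
  inv_on (I1 ++ I2) (J1 ++ J2) B X -> inv_on I1 J1 B H1 ->
  {in I1, forall i, i \notin I2} -> {in J1, forall i, i \notin J2} ->
  inv_on I2 J2 (schur B H1) (dg J2 *m X *m dg I2).
Proof.
move=> hx h1 dI dJ; split; first exact: (inv_restrict_half hx h1 dI dJ).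
  have := inv_restrict_half (inv_on_tr hx) (inv_on_tr h1) dJ dI.
  rewrite -schur_tr => e; apply: trmx_inj.
  by rewrite !trmx_mul !tr_dg -[RHS]e !mulmxA.
by rewrite !mulmxA dgK -!mulmxA dgK.
Qed.

Lemma rank_schur I J B H : inv_on I J B H -> (\rank B <= size I + \rank (schur B H))%N.
Proof.
move=> h; have {1}-> : B = B *m H *m B + schur B H.
  by rewrite /schur addrC subrK.
apply: leq_trans (mxrank_add _ _) _; rewrite leq_add2r.
rewrite -(inv_onr h) -!mulmxA (leq_trans (mxrankM_maxr _ _)) //.
rewrite (leq_trans (mxrankM_maxr _ _)) // (leq_trans (mxrankM_maxl _ _)) //.
exact: mxrank_dg.
Qed.

(** The rank of [dg I] is bounded below through its complement: the two projectors sum to the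
    identity, and the second has rank at most its number of indices. *)
Lemma rank_inv I J B H : inv_on I J B H -> uniq I -> (size I <= \rank B)%N.
Proof.
move=> [h _ _] uI; apply: leq_trans (_ : \rank (dg I) <= _)%N; last first.
  by rewrite -h (leq_trans (mxrankM_maxl _ _)) // mxrankM_maxr.
have : (n <= \rank (dg I) + \rank (dg [seq i <- enum 'I_n | i \notin I]))%N.
  rewrite -{1}(mxrank1 F n) (leq_trans _ (mxrank_add _ _)) //.
  rewrite -dg_cat; last by move=> i hi; rewrite mem_filter hi.
  rewrite (_ : dg _ = 1%:M) //; apply/matrixP => i j.
  by rewrite !mxE mem_cat mem_filter mem_enum inE andbT orbN andbT.
move=> hn; have := mxrank_dg F [seq i <- enum 'I_n | i \notin I].
rewrite size_filter => h2.
have h3 : (count [pred i | i \notin I] (enum 'I_n) + size I = n)%N.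
  have := count_predC [in I] (enum 'I_n); rewrite size_enum_ord addnC => h3.
  rewrite -[RHS]h3; congr (_ + _)%N.
  rewrite -size_filter; apply/perm_size/uniq_perm => //.
    by rewrite filter_uniq // enum_uniq.
  by move=> i; rewrite mem_filter mem_enum andbT.
rewrite -(leq_add2l (count [pred i | i \notin I] (enum 'I_n))) h3.
by rewrite (leq_trans hn) // addnC leq_add2r.
Qed.

End Inverses.

(** * Pivot orders with nonsingular leading blocks *)

Section Regular.
Variables (F : fieldType) (n : nat).
Implicit Types (r c : seq (seq 'I_n)) (B H : 'M[F]_n).

(** The block form of nonsingular leading minors, under which elimination can follow a prescribed
    order. Rows and columns are listed separately because the search for pairs works in an
    off-diagonal block. *)
Definition reg B r c :=
  forall k, exists H, inv_on (flatten (take k r)) (flatten (take k c)) B H.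

Lemma reg_inv B r c : size r = size c -> reg B r c ->
  exists H, inv_on (flatten r) (flatten c) B H.
Proof. by move=> e /(_ (size r)); rewrite take_size e take_size. Qed.

Lemma reg_nil B : reg B [::] [::].
Proof. by move=> k; exists 0; apply: inv_on_nil. Qed.

Lemma reg_one B (b c : seq 'I_n) H : inv_on b c B H -> reg B [:: b] [:: c].
Proof.
move=> h [|k] /=; first by exists 0; apply: inv_on_nil.
by exists H; rewrite !cats0.
Qed.

Lemma reg_catl B r1 r2 c1 c2 : size r1 = size c1 ->
  reg B (r1 ++ r2) (c1 ++ c2) -> reg B r1 c1.
Proof.
move=> e h k; case: (leqP k (size r1)) => hk.
  by have := h k; rewrite !takel_cat // -e.
have := h (size r1); rewrite take_size_cat // {1}e take_size_cat // => -[H hH].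
by exists H; rewrite !take_oversize // -?e ltnW.
Qed.

Lemma reg_cat B r1 r2 c1 c2 H1 : size r1 = size c1 ->
  reg B r1 c1 -> inv_on (flatten r1) (flatten c1) B H1 ->
  reg (schur B H1) r2 c2 -> reg B (r1 ++ r2) (c1 ++ c2).
Proof.
move=> e h1 i1 h2 k; rewrite !take_cat -e; case: ltnP => hk; first exact: h1.
have [H2 i2] := h2 (k - size r1)%N.
by exists (comp_inv B H1 H2); rewrite !flatten_cat; apply: inv_comp.
Qed.

(** A prefix of the remaining blocks, together with the eliminated ones, is a prefix of the whole
    list; [inv_restrict] turns its inverse into one for the Schur complement. *)
Lemma reg_catr B r1 r2 c1 c2 H1 : size r1 = size c1 ->
  uniq (flatten (r1 ++ r2)) -> uniq (flatten (c1 ++ c2)) ->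
  reg B (r1 ++ r2) (c1 ++ c2) -> inv_on (flatten r1) (flatten c1) B H1 ->
  reg (schur B H1) r2 c2.
Proof.
move=> e ur uc h i1 k; have [X] := h (size r1 + k)%N.
rewrite !take_cat -e ltnNge leq_addr /= addKn !flatten_cat => hX.
have D (a b : seq (seq 'I_n)) : uniq (flatten (a ++ b)) ->
    {in flatten a, forall i, i \notin flatten (take k b)}.
  rewrite flatten_cat cat_uniq => /and3P [_ /hasPn h3 _] i ia.
  apply/negP => ib; have /h3 : i \in flatten b.
    by rewrite -(cat_take_drop k b) flatten_cat mem_cat ib.
  by rewrite /= ia.
by eexists; apply: inv_restrict hX i1 (D _ _ ur) (D _ _ uc).
Qed.

Lemma reg_congr B B' r c (s t : seq 'I_n) :
  {subset flatten r <= s} -> {subset flatten c <= t} ->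
  dg F s *m B *m dg F t = dg F s *m B' *m dg F t -> reg B r c -> reg B' r c.
Proof.
move=> hr hc e h k; have [H hH] := h k; exists H; apply: inv_on_congr hH.
have sub (g : seq (seq 'I_n)) (u : seq 'I_n) : {subset flatten g <= u} ->
    {subset flatten (take k g) <= u}.
  by move=> hg i hi; apply: hg; rewrite -(cat_take_drop k g) flatten_cat mem_cat hi.
rewrite -(dg_subl F (sub _ _ hr)) -(dg_subr F (sub _ _ hc)) !mulmxA.
by rewrite -!(mulmxA (dg F (flatten _))) e.
Qed.

End Regular.

(** * Partial LDL factorizations *)

Section ConjTranspose.
Variables (F : fieldType) (theta : {rmorphism F -> F}).
Hypothesis thetaK : involutive theta.
Local Notation conjtr := (conjtr theta).

Lemma conjtrM m n p (X : 'M[F]_(m, n)) (Y : 'M_(n, p)) :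
  conjtr (X *m Y) = conjtr Y *m conjtr X.
Proof. by rewrite /conjtr trmx_mul map_mxM. Qed.

Lemma conjtrD m n (X Y : 'M[F]_(m, n)) : conjtr (X + Y) = conjtr X + conjtr Y.
Proof. by rewrite /conjtr linearD map_mxD. Qed.

Lemma conjtrB m n (X Y : 'M[F]_(m, n)) : conjtr (X - Y) = conjtr X - conjtr Y.
Proof. by rewrite /conjtr linearB map_mxB. Qed.

Lemma conjtrK m n (X : 'M[F]_(m, n)) : conjtr (conjtr X) = X.
Proof. by apply/matrixP=> i j; rewrite !mxE thetaK. Qed.

Lemma conjtr0 m n : conjtr (0 : 'M[F]_(m, n)) = 0.
Proof. by rewrite /conjtr trmx0 map_mx0. Qed.

Lemma conjtr_dg n (s : seq 'I_n) : conjtr (dg F s) = dg F s.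
Proof. by apply/matrixP=> i j; rewrite /conjtr tr_dg !mxE rmorph_nat. Qed.

Lemma herm_entry n (M : 'M[F]_n) i j : conjtr M = M -> theta (M j i) = M i j.
Proof. by move/matrixP/(_ i j); rewrite !mxE. Qed.

Lemma inv_on_conj n (I J : seq 'I_n) B H :
  inv_on I J B H -> inv_on J I (conjtr B) (conjtr H).
Proof.
case=> h1 h2 h3.
by split; apply: (can_inj (@conjtrK _ _)); rewrite !conjtrM !conjtrK !conjtr_dg ?mulmxA.
Qed.

Lemma inv_herm n (P : seq 'I_n) M N :
  conjtr M = M -> inv_on P P M N -> conjtr N = N.
Proof. by move=> h i; apply/esym/(inv_on_uniq i); rewrite -h; apply: inv_on_conj. Qed.

Lemma schur_herm n (M N : 'M[F]_n) :
  conjtr M = M -> conjtr N = N -> conjtr (schur M N) = schur M N.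
Proof. by move=> h1 h2; rewrite /schur conjtrB !conjtrM h1 h2 mulmxA. Qed.

Lemma conjtr_dg0 n (s t : seq 'I_n) (M : 'M[F]_n) : conjtr M = M ->
  dg F s *m M *m dg F t = 0 -> dg F t *m M *m dg F s = 0.
Proof.
move=> h e; apply: (can_inj (@conjtrK _ _)).
by rewrite !conjtrM !conjtr_dg h conjtr0 mulmxA.
Qed.

End ConjTranspose.

Section Factorization.
Variables (F : fieldType) (theta : {rmorphism F -> F}).
Hypothesis thetaK : involutive theta.
Variable n : nat.
Local Notation conjtr := (conjtr theta).
Local Notation dg := (@dg F n).
Implicit Types (s : seq (seq 'I_n)) (M Z D N : 'M[F]_n).

(* Partial factorization of [M] along the consecutive pivot blocks [s]: the
   columns [L = M Z] and the block diagonal [D] satisfy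
   [L D L^H = M N M], so that [schur M N = M - L D L^H].  All of this depends
   only on the entries of [M] in the pivot rows and columns. *)
Record fact M s Z D N : Prop := Fact {
  fact_uniq : uniq (flatten s);
  fact_size : all (fun b => size b \in [:: 1; 2]%N) s;
  fact_inv : inv_on (flatten s) (flatten s) M N;
  fact_Z : dg (flatten s) *m Z *m dg (flatten s) = Z;
  fact_D : forall u v, D u v != 0 ->
    exists b, [/\ b \in s, u \in b, v \in b & size b = 2%N -> u != v];
  fact_Dh : conjtr D = D;
  fact_N : N = Z *m D *m conjtr Z;
  fact_L : forall u v, u \in flatten s -> v \in flatten s ->
    (index u (flatten s) <= index v (flatten s))%N ->
    (M *m Z) u v = (u == v)%:R
}.

Lemma fact_D0l M s Z D N : fact M s Z D N -> dg (flatten s) *m D = D.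
Proof.
move=> h; apply/matrixP=> u v; rewrite mul_dgE; case: ifP => // /negbT hu.
apply/esym/eqP; apply: contraNT hu => /(fact_D h) [b [bs ub _ _]].
by apply/flattenP; exists b.
Qed.

Lemma fact_Zl M s Z D N : fact M s Z D N -> dg (flatten s) *m Z = Z.
Proof. by move/fact_Z=> <-; rewrite !mulmxA dgK. Qed.

Lemma fact_Zr M s Z D N : fact M s Z D N -> Z *m dg (flatten s) = Z.
Proof. by move/fact_Z=> <-; rewrite -!mulmxA dgK. Qed.

Lemma fact_nil M : fact M [::] 0 0 0.
Proof.
split=> //=; rewrite ?mulmx0 ?mul0mx //; first exact: inv_on_nil.
  by move=> u v; rewrite mxE eqxx.
exact: conjtr0.
Qed.

Lemma fact_congr M M' s Z D N :
  dg (flatten s) *m M *m dg (flatten s) = dg (flatten s) *m M' *m dg (flatten s) ->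
  fact M s Z D N -> fact M' s Z D N.
Proof.
move=> e h; have zl := fact_Zl h; case: h => h1 h2 h3 h4 h5 h6 h7 h8.
split=> //; first exact: inv_on_congr h3.
move=> u v us vs huv; rewrite -(h8 u v us vs huv).
apply: (dg_row_eq (s := flatten s)) => //.
by rewrite -zl !mulmxA e.
Qed.

(** The correction - N1 M Z2 is chosen so that [M] times the new columns is the Schur complement
    times [Z2]. The columns of L for the second part are therefore those of the Schur complement,
    and the two D parts just add up. *)
Lemma fact_comp M s1 s2 Z1 Z2 D1 D2 N1 N2 : conjtr M = M ->
  fact M s1 Z1 D1 N1 -> fact (schur M N1) s2 Z2 D2 N2 ->
  fact M (s1 ++ s2) (Z1 + (Z2 - N1 *m M *m Z2)) (D1 + D2) (comp_inv M N1 N2).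
Proof.
move=> hM f1 f2; have i1 := fact_inv f1; have i2 := fact_inv f2.
have dj := inv_on_rows (schur_row0 i1) i2.
have sl : {subset flatten s1 <= flatten s1 ++ flatten s2}.
  by move=> i hi; rewrite mem_cat hi.
have sr : {subset flatten s2 <= flatten s1 ++ flatten s2}.
  by move=> i hi; rewrite mem_cat hi orbT.
have z1l := fact_Zl f1; have z1r := fact_Zr f1.
have z2l := fact_Zl f2; have z2r := fact_Zr f2.
have n1h : conjtr N1 = N1 by exact: (inv_herm thetaK hM i1).
have LE : M *m (Z1 + (Z2 - N1 *m M *m Z2)) = M *m Z1 + schur M N1 *m Z2.
  by rewrite mulmxDr mulmxBr /schur mulmxBl !mulmxA.
split.
- rewrite flatten_cat cat_uniq (fact_uniq f1) (fact_uniq f2) andbT.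
  by apply/hasPn => i hi; apply/negP => /dj; rewrite hi.
- by rewrite all_cat (fact_size f1) (fact_size f2).
- by rewrite flatten_cat; apply: inv_comp.
- rewrite flatten_cat.
  have L1 : dg (flatten s1 ++ flatten s2) *m Z1 = Z1.
    by rewrite -z1l mulmxA dg_subr.
  have L2 : dg (flatten s1 ++ flatten s2) *m Z2 = Z2.
    by rewrite -z2l mulmxA dg_subr.
  have L3 : dg (flatten s1 ++ flatten s2) *m N1 = N1.
    by rewrite -(inv_onl i1) mulmxA dg_subr.
  have R1 : Z1 *m dg (flatten s1 ++ flatten s2) = Z1.
    by rewrite -z1r -mulmxA dg_subl.
  have R2 : Z2 *m dg (flatten s1 ++ flatten s2) = Z2.
    by rewrite -z2r -mulmxA dg_subl.
  rewrite mulmxDr mulmxBr !mulmxA L1 L2 L3 mulmxDl mulmxBl R1 R2.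
  by rewrite -!mulmxA R2.
- move=> u v; rewrite mxE; have [->|d1 _] := eqVneq (D1 u v) 0.
    rewrite add0r => /(fact_D f2) [b [bs ub vb hb]]; exists b.
    by rewrite mem_cat bs orbT.
  have [b [bs ub vb hb]] := fact_D f1 d1; exists b.
  by rewrite mem_cat bs.
- by rewrite conjtrD (fact_Dh f1) (fact_Dh f2).
(* The cross terms vanish because [D1] and [D2] live on disjoint pivot sets; what remains is [N1]
   plus the correction term of [comp_inv]. *)
- rewrite conjtrD conjtrB !conjtrM hM n1h mulmxA.
  have c12 : Z1 *m D2 = 0.
    by rewrite -z1r -(fact_D0l f2) -mulmxA (mulmxA (dg _)) (dg_disj _ dj) mul0mx mulmx0.
  have c21 : D2 *m conjtr Z1 = 0.
    rewrite -[LHS](conjtrK thetaK) conjtrM (conjtrK thetaK) (fact_Dh f2).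
    by rewrite c12 conjtr0.
  have d12 : Z2 *m D1 = 0.
    by rewrite -z2r -(fact_D0l f1) -mulmxA (mulmxA (dg _)) (dg_disjC _ dj) mul0mx mulmx0.
  have d21 : D1 *m conjtr Z2 = 0.
    rewrite -[LHS](conjtrK thetaK) conjtrM (conjtrK thetaK) (fact_Dh f1).
    by rewrite d12 conjtr0.
  have A1 : (Z1 + (Z2 - N1 *m M *m Z2)) *m D1 = Z1 *m D1.
    by rewrite mulmxDl mulmxBl -!mulmxA d12 !mulmx0 subr0 addr0.
  have A2 : (Z1 + (Z2 - N1 *m M *m Z2)) *m D2 = (Z2 - N1 *m M *m Z2) *m D2.
    by rewrite mulmxDl c12 add0r.
  rewrite (mulmxDr _ D1 D2) A1 A2 mulmxDl !(mulmxDr _ (conjtr Z1)).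
  have -> : Z1 *m D1 *m (conjtr Z2 - conjtr Z2 *m M *m N1) = 0.
    by rewrite mulmxBr !mulmxA -(mulmxA Z1) d21 !(mulmx0, mul0mx) subr0.
  have -> : (Z2 - N1 *m M *m Z2) *m D2 *m conjtr Z1 = 0.
    by rewrite -mulmxA c21 mulmx0.
  rewrite -(fact_N f1) addr0 add0r /comp_inv -addrA; congr (_ + _).
  have EA : N2 - N1 *m M *m N2 = (Z2 - N1 *m M *m Z2) *m D2 *m conjtr Z2.
    by rewrite {1 2}(fact_N f2) !mulmxBl !mulmxA.
  by rewrite mulmxBr !mulmxA -EA.
- move=> u v; rewrite flatten_cat !mem_cat LE mxE => hu hv.
  have Lz (w : 'I_n) (s : seq (seq 'I_n)) Z : Z *m dg (flatten s) = Z -> v \notin flatten s ->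
      forall X : 'M[F]_n, (X *m Z) w v = 0.
    by move=> hz hv' X; rewrite -hz mulmxA mul_rdgE (negbTE hv').
  rewrite !index_cat; case: (boolP (v \in flatten s1)) hv => v1 /= hv.
    rewrite (Lz u s2 Z2) // ?addr0; last exact: dj.
    case: ifP => u1; first exact: (fact_L f1 u1 v1).
    move=> hle; have := leq_trans hle (ltnW _); rewrite -index_mem in v1.
    by have := leq_ltn_trans hle v1; rewrite ltnNge leq_addr.
  rewrite (Lz u s1 Z1) // add0r; case: ifP => u1.
    move=> _.
    have -> : (schur M N1 *m Z2) u v = 0.
      by rewrite (@dg_row0 F n (flatten s1)) // mulmxA (schur_row0 i1) mul0mx.
    by case: eqVneq => // e; rewrite -e u1 in v1.
  by rewrite u1 leq_add2l /= in hu *; apply: (fact_L f2).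
Qed.

End Factorization.

(** * Block matrix products *)

Section GemmProgram.
Variables (F : fieldType) (I : Type) (n : nat) (mm : forall q, mm_program F q).

Definition opmx := 'I_n -> 'I_n -> operand F I.

Definition op0 : opmx := fun _ _ => Const 0.

(** Short lists are padded with zeros, so that a square product of size [q] covers every smaller
    rectangular one. *)
Definition mm_args (q : nat) (X Y : opmx) (rs ks cs : seq 'I_n)
    (ix : mm_index q) : operand F I :=
  match ix with
  | inl (a, b) =>
      if (onth rs a, onth ks b) is (Some i, Some k) then X i k else Const 0
  | inr (a, b) =>
      if (onth ks a, onth cs b) is (Some k, Some j) then Y k j else Const 0
  end.

Definition mm_call (q : nat) (X Y : opmx) (rs ks cs : seq 'I_n) :
    builder F I 'M[operand F I]_q :=
  fun base => reloc base (mm_args X Y rs ks cs) (Const 0) 0 (mm q).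

Fixpoint fill (ps : seq ('I_n * 'I_n)) (f : 'I_n -> 'I_n -> instr F I)
    (W : opmx) : builder F I opmx :=
  match ps with
  | [::] => cret W
  | p :: ps =>
      let! a := cinstr (f p.1 p.2) in
      fill ps f (fun i j => if (i, j) == p then a else W i j)
  end.

Definition sub_entry (q : nat) (P : 'M[operand F I]_q) (rs cs : seq 'I_n) : opmx :=
  fun i j =>
    if (insub (index i rs), insub (index j cs)) is (Some a, Some b)
    then P a b else Const 0.

Definition gemm_sq (q : nat) (neg : bool) (W X Y : opmx) (rs ks cs : seq 'I_n) :
    builder F I opmx :=
  let! P := mm_call q X Y rs ks cs in
  fill (allpairs pair rs cs)
    (fun i j => if neg then Defs.Sub (W i j) (sub_entry P rs cs i j)
                else Add (W i j) (sub_entry P rs cs i j)) W.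

(* [W + X Y] or [W - X Y] on the rows [rs] and columns [cs], the inner index
   ranging over [ks]; [rs] and [ks] have at most [2 ^ j] elements and [cs] at
   most [2 ^ (j + d)]. *)
Fixpoint gemm (j d : nat) (neg : bool) (W X Y : opmx) (rs ks cs : seq 'I_n) :
    builder F I opmx :=
  match d with
  | 0 => gemm_sq (2 ^ j) neg W X Y rs ks cs
  | d'.+1 =>
      let! W' := gemm j d' neg W X Y rs ks (take (2 ^ (j + d')) cs) in
      gemm j d' neg W' X Y rs ks (drop (2 ^ (j + d')) cs)
  end.

End GemmProgram.

Arguments op0 {F I n}.

Section GemmSpec.
Variables (F : fieldType) (theta : F -> F) (I : Type) (x : I -> F) (n : nat).
Variables (mm : forall q, mm_program F q) (R : realType) (w cmm : R).
Hypothesis mmP : forall q (X Y : 'M[F]_q),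
  mx_result theta (mm_input X Y) (mm q) (leaf theta (mm_input X Y) (mm q)) = X *m Y.
Hypothesis mm_cost : forall j (X Y : 'M[F]_(2 ^ j)),
  (cost theta (mm_input X Y) (mm (2 ^ j)))%:R <= cmm * w ^+ j.
Hypothesis w_ge4 : 4 <= w.

Local Notation opmx := (opmx F I n).
Local Notation rep := (rep x).
Local Notation dg := (@dg F n).
Local Notation runsb := (runsb theta x (R := R)).

Definition repM (mem : seq F) (A : opmx) (V : 'M[F]_n) :=
  forall i j, rep mem (A i j) (V i j).

Lemma repM_ext mem e A V : repM mem A V -> repM (mem ++ e) A V.
Proof. by move=> h i j; apply: rep_ext. Qed.

Lemma repM0 mem : repM mem op0 0.
Proof. by move=> i j; rewrite mxE. Qed.

Lemma mm_cost_ge0 : 0 <= cmm.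
Proof. by have := mm_cost (j := 0) 0 0; rewrite expr0 mulr1; apply: le_trans. Qed.

Lemma fillP mem ps f W (V Wv : 'M[F]_n) :
  (forall i j, (i, j) \in ps -> forall e, instr_val theta x (mem ++ e) (f i j) = V i j) ->
  repM mem W Wv ->
  runsb mem (fill ps f W) (size ps)%:R (fun W' mem' =>
    repM mem' W' (\matrix_(i, j) if (i, j) \in ps then V i j else Wv i j)).
Proof.
elim: ps mem W Wv => [|[a b] ps IH] mem W Wv hf hW.
  by apply: runsb_ret => // i j; rewrite mxE.
apply: (runsb_bind (b1 := 1) (b2 := (size ps)%:R) (Q1 := fun o m =>
    rep m o (V a b) /\ repM m W Wv /\ (forall i j, (i, j) \in ps ->
    forall e, instr_val theta x (m ++ e) (f i j) = V i j))); last 1 first.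
- by rewrite /= -(natrD _ 1).
- apply: (runsb_instr (v := V a b)); [|exact: lexx|].
    by rewrite -(hf a b (mem_head _ _) [::]) cats0.
  move=> o e ho; split=> //; split; first exact: repM_ext.
  by move=> i j hij e'; rewrite -catA hf // inE hij orbT.
move=> o e [ho [hW' hf']].
apply: runsb_weaken (IH _ _ (\matrix_(i, j) if (i, j) == (a, b) then V a b else Wv i j) hf' _) (lexx _) _.
  by move=> i j; rewrite mxE; case: ifP.
move=> W' e' h i j; have := h i j; rewrite !mxE inE.
by case: eqP => [[-> ->]|] //=; case: ifP.
Qed.

Lemma sum_onth (T : Type) (q : nat) (s : seq T) (f : T -> F) : (size s <= q)%N ->
  \sum_(b < q) oapp f 0 (onth s b) = \sum_(k <- s) f k.
Proof.
elim: s q => [|a s IH] q.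
  by move=> _; rewrite big_nil big1 // => -[[|b] hb] _.
case: q => // q /IH h; rewrite big_ord_recl big_cons /= -h.
by congr (_ + _); apply: eq_bigr.
Qed.

Lemma mm_callP j mem X Y (Xv Yv : 'M[F]_n) rs ks cs :
  (size ks <= 2 ^ j)%N -> uniq ks -> repM mem X Xv -> repM mem Y Yv ->
  runsb mem (mm_call mm (2 ^ j) X Y rs ks cs) (cmm * w ^+ j) (fun P mem' =>
    forall a b i k, onth rs (val a) = Some i -> onth cs (val b) = Some k ->
      rep mem' (P a b) ((Xv *m dg ks *m Yv) i k)).
Proof.
move=> hk uk hX hY; set q := (2 ^ j)%N.
pose Xm : 'M[F]_q := \matrix_(a, b)
  if (onth rs a, onth ks b) is (Some i, Some k) then Xv i k else 0.
pose Ym : 'M[F]_q := \matrix_(a, b)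
  if (onth ks a, onth cs b) is (Some i, Some k) then Yv i k else 0.
have hargs ix : rep mem (mm_args X Y rs ks cs ix) (mm_input Xm Ym ix).
  case: ix => -[a b] /=; rewrite mxE; case: (onth _ a) => [u|] //;
    case: (onth _ b) => [v|] //.
have := exec_reloc theta hargs (mm q) [::]; rewrite /= cats0.
have hval := rep_reloc_op hargs.
set r := exec theta (mm_input Xm Ym) _ _ => -[E1 E2].
exists r.2; rewrite /runs /mm_call E1 E2 /=; split=> //; split; first exact: mm_cost.
move=> a b i k ha hb; rewrite mxE.
have := mmP Xm Ym; rewrite /mx_result /leaf -/r => /matrixP/(_ a b).
rewrite !mxE => e.
suff <- : operand_val (mm_input Xm Ym) r.2 (r.1 a b) = \sum_j0 (Xv *m dg ks) i j0 * Yv j0 k.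
  exact: hval.
rewrite e; transitivity (\sum_(b < q) oapp (fun k0 => Xv i k0 * Yv k0 k) 0 (onth ks b)).
  by apply: eq_bigr => c _; rewrite !mxE ha hb; case: (onth ks c) => [u|]; rewrite /= ?mul0r.
rewrite sum_onth // big_uniq //= big_mkcond /=.
by apply: eq_bigr => c _; rewrite mul_rdgE; case: ifP => // _; rewrite mul0r.
Qed.

Lemma onth_index (s : seq 'I_n) i : i \in s -> onth s (index i s) = Some i.
Proof.
elim: s => //= a s IH; rewrite inE eq_sym.
by case: eqVneq => [->|] //= _ /IH.
Qed.

Definition gemm_val (neg : bool) (W X Y : 'M[F]_n) (rs ks cs : seq 'I_n) :=
  let P := dg rs *m X *m dg ks *m Y *m dg cs in if neg then W - P else W + P.

Lemma gemm_sqP j mem neg W X Y (Wv Xv Yv : 'M[F]_n) rs ks cs :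
  (size rs <= 2 ^ j)%N -> (size ks <= 2 ^ j)%N -> (size cs <= 2 ^ j)%N -> uniq ks ->
  repM mem W Wv -> repM mem X Xv -> repM mem Y Yv ->
  runsb mem (gemm_sq mm (2 ^ j) neg W X Y rs ks cs) ((cmm + 1) * w ^+ j)
    (fun Z mem' => repM mem' Z (gemm_val neg Wv Xv Yv rs ks cs)).
Proof.
move=> hr hk hc uk hW hX hY.
apply: runsb_bind (mm_callP rs cs hk uk hX hY) _ _; last first.
  by rewrite mulrDl mul1r lerD2l.
move=> P e; have [T TE] : {T | T = Xv *m dg ks *m Yv} by exists (Xv *m dg ks *m Yv).
rewrite -TE => hP.
apply: runsb_weaken (fillP (V := \matrix_(i, k) if neg then Wv i k - T i k else Wv i k + T i k) _ (repM_ext e hW)) _ _.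
- move=> i k /allpairsP [[a b] /= [ha hb [-> ->]]] e'; rewrite mxE.
  have ha' : (index a rs < 2 ^ j)%N by rewrite (leq_trans _ hr) ?index_mem.
  have hb' : (index b cs < 2 ^ j)%N by rewrite (leq_trans _ hc) ?index_mem.
  have hs : rep (mem ++ e) (sub_entry P rs cs a b) (T a b).
    rewrite /sub_entry !insubT; apply: hP => /=; exact: onth_index.
  have hw := repM_ext e hW a b.
  by case: neg => /=; rewrite hs hw.
(* There are at most [4 ^ j] entrywise operations, absorbed into [w ^+ j] because [w] is at least 4.
   They account for the 1 in [cmm + 1]. *)
- rewrite size_allpairs natrM.
  have h2 (s : seq 'I_n) : (size s <= 2 ^ j)%N -> ((size s)%:R : R) <= 2 ^+ j.
    by move=> h; rewrite -natrX ler_nat.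
  apply: le_trans (_ : 2 ^+ j * 2 ^+ j <= _).
    by apply: ler_pM => //; apply: h2.
  rewrite -exprMn; apply: lerXn2r; rewrite ?nnegrE ?mulr_ge0 //.
    by apply: le_trans w_ge4.
  by rewrite -natrM.
move=> Z e' h i k; have := h i k; rewrite !mxE.
have E : (dg rs *m Xv *m dg ks *m Yv *m dg cs) i k =
    if (i, k) \in allpairs pair rs cs then T i k else 0.
  rewrite mul_rdgE -!mulmxA mul_dgE mulmxA -TE; case: ifP => hk1; case: ifP => hi1.
  - by rewrite allpairs_f.
  - by case: ifP => // /allpairsP [[a b] /= [h1 h2 [h3 h4]]]; rewrite h3 h1 in hi1.
  - have /allpairsP [[a b] /= [h1 h2 [h3 h4]]] := hi1.
    by rewrite h4 h2 in hk1.
  - by [].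
rewrite /gemm_val; move: (dg rs *m _ *m _ *m _ *m _) E => P0 E.
by case: neg {h}; rewrite !mxE E; case: ifP; rewrite ?oppr0 ?addr0.
Qed.

Lemma gemmP j d mem neg W X Y (Wv Xv Yv : 'M[F]_n) rs ks cs :
  (size rs <= 2 ^ j)%N -> (size ks <= 2 ^ j)%N -> (size cs <= 2 ^ (j + d))%N ->
  uniq ks -> uniq cs ->
  repM mem W Wv -> repM mem X Xv -> repM mem Y Yv ->
  runsb mem (gemm mm j d neg W X Y rs ks cs) ((cmm + 1) * 2 ^+ d * w ^+ j)
    (fun Z mem' => repM mem' Z (gemm_val neg Wv Xv Yv rs ks cs)).
Proof.
move=> hr hk; elim: d mem W Wv cs => [|d IH] mem W Wv cs hc uk uc hW hX hY.
  by rewrite expr0 mulr1 /=; apply: gemm_sqP; rewrite // -(addn0 j).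
have h1 : (size (take (2 ^ (j + d)) cs) <= 2 ^ (j + d))%N.
  by rewrite size_take_min geq_minl.
have h2 : (size (drop (2 ^ (j + d)) cs) <= 2 ^ (j + d))%N.
  by rewrite size_drop leq_subLR addnn -mul2n -expnS -addnS.
apply: (runsb_bind (b2 := (cmm + 1) * 2 ^+ d * w ^+ j) (Q1 := fun Z m =>
  repM m Z (gemm_val neg Wv Xv Yv rs ks (take (2 ^ (j + d)) cs)) /\ repM m X Xv /\ repM m Y Yv)).
- apply: runsb_weaken (IH mem W Wv _ h1 uk (take_uniq _ uc) hW hX hY) (lexx _) _.
  by move=> o e h; split=> //; split; apply: repM_ext.
- move=> W' e [hW' [hX' hY']].
  apply: runsb_weaken (IH _ W' _ _ h2 uk (drop_uniq _ uc) hW' hX' hY') (lexx _) _.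
  move=> Z e'; congr (repM _ _ _); rewrite /gemm_val.
  have -> : dg cs = dg (take (2 ^ (j + d)) cs) + dg (drop (2 ^ (j + d)) cs).
    rewrite -dg_cat ?cat_take_drop // => i hi; apply/negP => hi'; move: uc.
    rewrite -(cat_take_drop (2 ^ (j + d)) cs) cat_uniq => /and3P [_ /hasPn h _].
    by have := h _ hi'; rewrite /= hi.
  by case: (neg); rewrite mulmxDr ?opprD addrA.
by rewrite -mulrDl -mulrDr exprS mulr_natl mulr2n.
Qed.

End GemmSpec.

(** * Factorization along prescribed pivot blocks *)

Section NoPivProgram.
Variables (F : fieldType) (I : Type) (n : nat) (mm : forall q, mm_program F q).
Local Notation opmx := (opmx F I n).
Local Notation gemm := (gemm mm).

(** Adds two matrices with disjoint column supports at no arithmetic cost, by selecting operands. *)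
Definition bycol (c : seq 'I_n) (X Y : opmx) : opmx :=
  fun i j => if j \in c then X i j else Y i j.

(** Only rows [rs] and columns [cs] are updated. Elsewhere the entries of [B] remain, so the result
    is compared with [schur] under a mask. *)
Definition schurc (lv d : nat) (H B : opmx) (rI rJ rs cs : seq 'I_n) :
    builder F I opmx :=
  let! T := gemm lv d true op0 H B rJ rI cs in
  gemm lv d false B B T rs rJ cs.

Definition invmerge (lv : nat) (B H1 H2 : opmx) (I1 J1 I2 J2 : seq 'I_n) :
    builder F I opmx :=
  let! T := gemm lv 0 true op0 H1 B J1 I1 J2 in
  let! A := gemm lv 0 false H2 T H2 J1 J2 I2 in
  let! T' := gemm lv 0 true op0 B H1 I2 J1 I1 in
  gemm lv 0 false (bycol I1 H1 A) A T' (J1 ++ J2) I2 I1.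

Definition zmerge (lv : nat) (M N1 Z1 Z2 : opmx) (P1 P2 : seq 'I_n) :
    builder F I opmx :=
  let! T := gemm lv 0 true op0 N1 M P1 P1 P2 in
  gemm lv 0 false (bycol P1 Z1 Z2) T Z2 P1 P2 P2.

Record pdata := PData {
  pd_s : seq (seq 'I_n);
  pd_Z : opmx;
  pd_D : opmx;
  pd_N : opmx
}.

Definition andthen (lv : nat) (M : opmx) (c1 : builder F I pdata)
    (c2 : opmx -> builder F I pdata) (Q : seq 'I_n) : builder F I pdata :=
  let! d1 := c1 in
  let P1 := flatten (pd_s d1) in
  let! M1 := schurc lv 0 (pd_N d1) M P1 P1 Q Q in
  let! d2 := c2 M1 in
  let P2 := flatten (pd_s d2) in
  let! Z := zmerge lv M (pd_N d1) (pd_Z d1) (pd_Z d2) P1 P2 in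
  let! N := invmerge lv M (pd_N d1) (pd_N d2) P1 P1 P2 P2 in
  cret (PData (pd_s d1 ++ pd_s d2) Z (bycol P1 (pd_D d1) (pd_D d2)) N).

Definition op1 (i j : 'I_n) (a : operand F I) : opmx :=
  fun u v => if (u == i) && (v == j) then a else Const 0.

Definition single (M : opmx) (v : 'I_n) : builder F I pdata :=
  let! a := cinstr (Div (Const 1) (M v v)) in
  cret (PData [:: [:: v]] (op1 v v a) (op1 v v (M v v)) (op1 v v a)).

Definition op2 (i j : 'I_n) (a b : operand F I) : opmx :=
  fun u v => if (u == i) && (v == j) then a else op1 j i b u v.

Definition antidiag (M : opmx) (i j : 'I_n) : builder F I pdata :=
  let! a := cinstr (Div (Const 1) (M j i)) in
  let! b := cinstr (Div (Const 1) (M i j)) in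
  cret (PData [:: [:: i; j]] (op2 i j a b) (op2 i j (M i j) (M j i)) (op2 i j a b)).

(** A 2 by 2 block must be antidiagonal. When a diagonal entry is nonzero it serves as a 1 by 1
    pivot and the other vertex follows, so a pair may end up as two blocks, possibly in the opposite
    order. The resulting pivots hence agree with the prescribed ones only up to permutation. *)
Definition pivot_block (M : opmx) (b : seq 'I_n) : builder F I pdata :=
  match b with
  | [:: v] => single M v
  | [:: i; j] =>
      cif (M i i)
        (cif (M j j) (antidiag M i j)
           (andthen 1 M (single M j) (fun M' => single M' i) [:: i]))
        (andthen 1 M (single M i) (fun M' => single M' j) [:: j])
  | _ => cret (PData [::] op0 op0 op0)
  end.

(** The level is [k.+2] because [2 ^ k.+1] blocks contain up to [2 ^ k.+2] vertices. *)
Fixpoint nopiv (k : nat) (g : seq (seq 'I_n)) (M : opmx) : builder F I pdata :=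
  match k with
  | 0 => if g is b :: _ then pivot_block M b else cret (PData [::] op0 op0 op0)
  | k.+1 =>
      andthen k.+2 M (nopiv k (take (2 ^ k) g) M)
        (fun M' => nopiv k (drop (2 ^ k) g) M') (flatten (drop (2 ^ k) g))
  end.

End NoPivProgram.

Section NoPivSpec.
Variables (F : fieldType) (theta : {rmorphism F -> F}).
Hypothesis thetaK : involutive theta.
Variables (I : Type) (x : I -> F) (n : nat).
Variables (mm : forall q, mm_program F q) (R : realType) (w cmm : R).
Hypothesis mmP : forall q (X Y : 'M[F]_q),
  mx_result theta (mm_input X Y) (mm q) (leaf theta (mm_input X Y) (mm q)) = X *m Y.
Hypothesis mm_cost : forall j (X Y : 'M[F]_(2 ^ j)),
  (cost theta (mm_input X Y) (mm (2 ^ j)))%:R <= cmm * w ^+ j.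
Hypothesis w_ge4 : 4 <= w.

Local Notation opmx := (opmx F I n).
Local Notation rep := (rep x).
Local Notation repM := (repM x).
Local Notation dg := (@dg F n).
Local Notation runsb := (runsb theta x (R := R)).
Local Notation conjtr := (conjtr theta).
Local Notation fact := (fact theta).

Definition gcost (j d : nat) : R := (cmm + 1) * 2 ^+ d * w ^+ j.

Lemma gcost_ge0 j d : 0 <= gcost j d.
Proof.
have c0 : 0 <= cmm by apply: (mm_cost_ge0 (theta := theta) (mm := mm) (w := w)).
have w0 : 0 <= w by apply: le_trans w_ge4.
by rewrite !mulr_ge0 ?exprn_ge0 // addr_ge0.
Qed.

Lemma repM_bycol mem c (X Y : opmx) Xv Yv :
  Xv *m dg c = Xv -> Yv *m dg c = 0 -> repM mem X Xv -> repM mem Y Yv ->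
  repM mem (bycol c X Y) (Xv + Yv).
Proof.
move=> hx hy hX hY i j; rewrite /bycol mxE; case: ifP => hj.
  have -> : Yv i j = 0 by have /matrixP/(_ i j) := hy; rewrite mul_rdgE hj mxE.
  by rewrite addr0; apply: hX.
by rewrite -hx mul_rdgE hj add0r; apply: hY.
Qed.

Lemma schurcP lv d mem H B (Hv Bv : 'M[F]_n) rI rJ rs cs :
  (size rI <= 2 ^ lv)%N -> (size rJ <= 2 ^ lv)%N -> (size rs <= 2 ^ lv)%N ->
  (size cs <= 2 ^ (lv + d))%N -> uniq rI -> uniq rJ -> uniq cs ->
  repM mem H Hv -> repM mem B Bv -> inv_on rI rJ Bv Hv ->
  runsb mem (schurc mm lv d H B rI rJ rs cs) (2 * gcost lv d)
    (fun B' mem' => repM mem' B' (Bv - dg rs *m (Bv *m Hv *m Bv) *m dg cs)).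
Proof.
move=> sI sJ sr sc uI uJ uc hH hB hi.
apply: (runsb_bind (b2 := gcost lv d) (gemmP mmP mm_cost w_ge4 true sJ sI sc uI uc (repM0 _ _) hH hB));
  last by rewrite mulr_natl mulr2n.
move=> T e hT; have hB' := repM_ext e hB.
apply: runsb_weaken (gemmP mmP mm_cost w_ge4 false sr sJ sc uJ uc hB' hB' hT) (lexx _) _.
move=> B' e' hB1; congr (repM _ _ _): hB1; rewrite /gemm_val.
rewrite (let: And3 _ _ e3 := hi in e3) add0r mulmxN mulNmx !mulmxA.
by rewrite -(mulmxA (_ *m Bv) (dg rJ)) (inv_onl hi) -!mulmxA dgK.
Qed.

Lemma invmergeP lv mem B H1 H2 (Bv H1v H2v : 'M[F]_n) I1 J1 I2 J2 :
  (size (I1 ++ I2) <= 2 ^ lv)%N -> (size (J1 ++ J2) <= 2 ^ lv)%N ->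
  uniq I1 -> uniq J1 -> uniq I2 -> uniq J2 ->
  repM mem B Bv -> repM mem H1 H1v -> repM mem H2 H2v ->
  inv_on I1 J1 Bv H1v -> inv_on I2 J2 (schur Bv H1v) H2v ->
  runsb mem (invmerge mm lv B H1 H2 I1 J1 I2 J2) (4 * gcost lv 0)
    (fun H mem' => repM mem' H (comp_inv Bv H1v H2v)).
Proof.
rewrite !size_cat => sI sJ uI1 uJ1 uI2 uJ2 hB hH1 hH2 i1 i2.
have sI1 : (size I1 <= 2 ^ lv)%N := leq_trans (leq_addr _ _) sI.
have sI2 : (size I2 <= 2 ^ lv)%N := leq_trans (leq_addl _ _) sI.
have sJ1 : (size J1 <= 2 ^ lv)%N := leq_trans (leq_addr _ _) sJ.
have sJ2 : (size J2 <= 2 ^ lv)%N := leq_trans (leq_addl _ _) sJ.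
have [sI1' sI2' sJ2'] : [/\ size I1 <= 2 ^ (lv + 0), size I2 <= 2 ^ (lv + 0)
  & size J2 <= 2 ^ (lv + 0)]%N by rewrite addn0.
have dI := inv_on_rows (schur_row0 i1) i2.
have [l1 r1 l2 r2] : [/\ dg J1 *m H1v = H1v, H1v *m dg I1 = H1v, dg J2 *m H2v = H2v
  & H2v *m dg I2 = H2v].
  by rewrite (inv_onl i1) (inv_onr i1) (inv_onl i2) (inv_onr i2).
pose g := gcost lv 0.
apply: (runsb_bind (b2 := 3 * g) (gemmP mmP mm_cost w_ge4 true sJ1 sI1 sJ2' uI1 uJ2 (repM0 _ _) hH1 hB));
  last first.
  by suff: g + 3 * g <= 4 * g by []; lra.
move=> T e hT; have {}hB := repM_ext e hB; have {}hH1 := repM_ext e hH1.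
have {}hH2 := repM_ext e hH2.
apply: (runsb_bind (b2 := 2 * g) (gemmP mmP mm_cost w_ge4 false sJ1 sJ2 sI2' uJ2 uI2 hH2 hT hH2));
  last first.
  by suff: g + 2 * g <= 3 * g by []; lra.
move=> A e1 hA; have {}hB := repM_ext e1 hB; have {}hH1 := repM_ext e1 hH1.
apply: (runsb_bind (b2 := g) (gemmP mmP mm_cost w_ge4 true sI2 sJ1 sI1' uJ1 uI1 (repM0 _ _) hB hH1));
  last first.
  by suff: g + g <= 2 * g by []; lra.
move=> T' e2 hT'; have {}hA := repM_ext e2 hA; have {}hH1 := repM_ext e2 hH1.
have {}hA : repM (((mem ++ e) ++ e1) ++ e2) A (H2v - H1v *m Bv *m H2v).
  congr (repM _ _ _): hA; rewrite /gemm_val add0r mulmxN !mulNmx; congr (_ - _).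
  rewrite (let: And3 _ _ e3 := i1 in e3) !mulmxA l1 -!mulmxA.
  by rewrite !(mulmxA (dg J2)) dgK r2 l2.
have rA : (H2v - H1v *m Bv *m H2v) *m dg I2 = H2v - H1v *m Bv *m H2v.
  by rewrite mulmxBl -!mulmxA r2.
have rA0 : (H2v - H1v *m Bv *m H2v) *m dg I1 = 0.
  by rewrite -rA -mulmxA (dg_disjC _ dI) mulmx0.
have hW := repM_bycol r1 rA0 hH1 hA.
have sJ12 : (size (J1 ++ J2) <= 2 ^ lv)%N by rewrite size_cat.
apply: runsb_weaken (gemmP mmP mm_cost w_ge4 false sJ12 sI2 sI1' uI2 uI1 hW hA hT') (lexx _) _.
move=> H e3; congr (repM _ _ _).
rewrite /gemm_val /comp_inv add0r mulmxN mulNmx; congr (_ - _).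
have lA : dg (J1 ++ J2) *m (H2v - H1v *m Bv *m H2v) = H2v - H1v *m Bv *m H2v.
  rewrite -l2 -{1}l1 mulmxBr !mulmxA dg_subr; last by move=> i hi; rewrite mem_cat hi orbT.
  by rewrite dg_subr ?l1 // => i hi; rewrite mem_cat hi.
rewrite lA rA !mulmxA rA -(mulmxA (_ *m _) (dg J1)) l1.
by rewrite -(mulmxA _ H1v) r1 -(mulmxA _ H1v) r1.
Qed.

Lemma zmergeP lv mem M N1 Z1 Z2 (Mv N1v Z1v Z2v : 'M[F]_n) P1 P2 :
  (size P1 <= 2 ^ lv)%N -> (size P2 <= 2 ^ lv)%N -> uniq P1 -> uniq P2 ->
  {in P1, forall i, i \notin P2} ->
  repM mem M Mv -> repM mem N1 N1v -> repM mem Z1 Z1v -> repM mem Z2 Z2v ->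
  inv_on P1 P1 Mv N1v -> dg P1 *m Z1v *m dg P1 = Z1v -> dg P2 *m Z2v *m dg P2 = Z2v ->
  runsb mem (zmerge mm lv M N1 Z1 Z2 P1 P2) (2 * gcost lv 0)
    (fun Z mem' => repM mem' Z (Z1v + (Z2v - N1v *m Mv *m Z2v))).
Proof.
move=> s1 s2 u1 u2 dj hM hN1 hZ1 hZ2 i1 z1 z2; pose g := gcost lv 0.
have s2' : (size P2 <= 2 ^ (lv + 0))%N by rewrite addn0.
apply: (runsb_bind (b2 := g) (gemmP mmP mm_cost w_ge4 true s1 s1 s2' u1 u2 (repM0 _ _) hN1 hM)); last first.
  by suff: g + g <= 2 * g by []; lra.
move=> T e hT.
have r1 : Z1v *m dg P1 = Z1v by rewrite -z1 -!mulmxA dgK.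
have r2 : Z2v *m dg P2 = Z2v by rewrite -z2 -!mulmxA dgK.
have l2 : dg P2 *m Z2v = Z2v by rewrite -z2 !mulmxA dgK.
have r0 : Z2v *m dg P1 = 0 by rewrite -r2 -mulmxA (dg_disjC _ dj) mulmx0.
have hW := repM_bycol r1 r0 (repM_ext e hZ1) (repM_ext e hZ2).
apply: runsb_weaken (gemmP mmP mm_cost w_ge4 false s1 s2 s2' u2 u2 hW hT (repM_ext e hZ2)) (lexx _) _.
move=> Z e' h; congr (repM _ _ _): h.
rewrite /gemm_val add0r mulmxN !mulNmx addrA; congr (_ - _).
rewrite (let: And3 _ _ e3 := i1 in e3) !mulmxA (inv_onl i1).
by rewrite -!mulmxA (mulmxA (dg P2)) dgK r2 l2.
Qed.

Definition repP mem (d : pdata F I n) (Mv : 'M[F]_n) :=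
  exists Z D N, [/\ repM mem (pd_Z d) Z, repM mem (pd_D d) D, repM mem (pd_N d) N
    & fact Mv (pd_s d) Z D N].

(** The eight products are two for the Schur complement, two for Z and four for the inverse. The
    second factorization sees a matrix that agrees with the Schur complement on [Q] only;
    [fact_congr] transfers it. *)
Lemma andthenP lv mem M (Mv : 'M[F]_n) c1 c2 P Q b1 b2 :
  conjtr Mv = Mv -> repM mem M Mv -> uniq Q -> (size (P ++ Q) <= 2 ^ lv)%N ->
  runsb mem c1 b1 (fun d m => repP m d Mv /\ perm_eq (flatten (pd_s d)) P) ->
  (forall e M1 (M1v : 'M[F]_n) s1 Z1 D1 N1, repM (mem ++ e) M1 M1v ->
     conjtr M1v = M1v -> fact Mv s1 Z1 D1 N1 -> perm_eq (flatten s1) P ->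
     dg Q *m M1v *m dg Q = dg Q *m schur Mv N1 *m dg Q ->
     runsb (mem ++ e) (c2 M1) b2
       (fun d m => repP m d M1v /\ perm_eq (flatten (pd_s d)) Q)) ->
  runsb mem (andthen mm lv M c1 c2 Q) (b1 + b2 + 8 * gcost lv 0)
    (fun d m => repP m d Mv /\ perm_eq (flatten (pd_s d)) (P ++ Q)).
Proof.
rewrite size_cat => hMh hM uQ sPQ h1 h2; set g := gcost lv 0.
have sP : (size P <= 2 ^ lv)%N := leq_trans (leq_addr _ _) sPQ.
have sQ : (size Q <= 2 ^ lv)%N := leq_trans (leq_addl _ _) sPQ.
apply: (runsb_bind (b2 := b2 + 8 * g) h1); last by rewrite addrA.
move=> d1 e1 [[Z1 [D1 [N1 [hZ1 hD1 hN1 f1]]]] p1].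
have {}hM := repM_ext e1 hM.
have i1 := fact_inv f1; have uP := fact_uniq f1.
have s1 : (size (flatten (pd_s d1)) <= 2 ^ lv)%N by rewrite (perm_size p1).
have sQ' : (size Q <= 2 ^ (lv + 0))%N by rewrite addn0.
have N1h : conjtr N1 = N1 by apply: inv_herm i1.
apply: (runsb_bind (b2 := b2 + 6 * g) (schurcP s1 s1 sQ sQ' uP uP uQ hN1 hM i1)); last first.
  by suff: 2 * g + (b2 + 6 * g) <= b2 + 8 * g by []; lra.
move=> M1 e2 hM1; have {}hM := repM_ext e2 hM; have {}hN1 := repM_ext e2 hN1.
have {}hZ1 := repM_ext e2 hZ1; have {}hD1 := repM_ext e2 hD1.
move: hM1; set M1v := Mv - _ => hM1.
have M1E : dg Q *m M1v *m dg Q = dg Q *m schur Mv N1 *m dg Q.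
  rewrite /M1v /schur !mulmxBr !mulmxBl; congr (_ - _).
  by rewrite !mulmxA dgK -!mulmxA dgK.
have M1h : conjtr M1v = M1v.
  by rewrite /M1v conjtrB !conjtrM !(conjtr_dg, hMh, N1h) !mulmxA.
rewrite -catA in hM1.
have {}h2 := h2 _ _ _ _ _ _ _ hM1 M1h f1 p1 M1E; rewrite catA in h2.
apply: (runsb_bind (b2 := 6 * g) h2); last by [].
move=> d2 e3 [[Z2 [D2 [N2 [hZ2 hD2 hN2 f2]]]] p2].
have {}hM := repM_ext e3 hM; have {}hN1 := repM_ext e3 hN1.
have {}hZ1 := repM_ext e3 hZ1; have {}hD1 := repM_ext e3 hD1.
have s2 : (size (flatten (pd_s d2)) <= 2 ^ lv)%N by rewrite (perm_size p2).
have {}f2 : fact (schur Mv N1) (pd_s d2) Z2 D2 N2.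
  by apply: fact_congr f2; rewrite (eq_dg _ (perm_mem p2)).
have i2 := fact_inv f2; have uP2 := fact_uniq f2.
have dj := inv_on_rows (schur_row0 i1) i2.
apply: (runsb_bind (b2 := 4 * g) (zmergeP s1 s2 uP uP2 dj hM hN1 hZ1 hZ2 i1 (fact_Z f1) (fact_Z f2)));
  last first.
  by suff: 2 * g + 4 * g <= 6 * g by []; lra.
move=> Z e4 hZ; have {}hM := repM_ext e4 hM; have {}hN1 := repM_ext e4 hN1.
have {}hD1 := repM_ext e4 hD1; have {}hD2 := repM_ext e4 hD2.
have {}hN2 := repM_ext e4 hN2.
have s12 : (size (flatten (pd_s d1) ++ flatten (pd_s d2)) <= 2 ^ lv)%N.
  by rewrite size_cat (perm_size p1) (perm_size p2).
apply: (runsb_bind (b2 := 0) (invmergeP s12 s12 uP uP uP2 uP2 hM hN1 hN2 i1 i2)); last first.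
  by rewrite addr0.
move=> N e5 hN; apply: runsb_ret => //; split; last first.
  by rewrite flatten_cat perm_cat.
exists (Z1 + (Z2 - N1 *m Mv *m Z2)), (D1 + D2), (comp_inv Mv N1 N2); split=> //=.
- exact: repM_ext.
- apply: repM_bycol (repM_ext e5 hD1) (repM_ext e5 hD2).
    apply: (can_inj (@conjtrK _ _ thetaK n n)).
    by rewrite conjtrM conjtr_dg (fact_Dh f1) (fact_D0l f1).
  apply: (can_inj (@conjtrK _ _ thetaK n n)).
  rewrite conjtrM conjtr_dg (fact_Dh f2) conjtr0 -(fact_D0l f2) mulmxA.
  by rewrite (dg_disj _ dj) mul0mx.
- exact: fact_comp.
Qed.

End NoPivSpec.

(** * Single pivot blocks and the recursion over a block list *)

Section NoPiv.
Variables (F : fieldType) (theta : {rmorphism F -> F}).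
Hypothesis thetaK : involutive theta.
Variables (I : Type) (x : I -> F) (n : nat).
Variables (mm : forall q, mm_program F q) (R : realType) (w cmm : R).
Hypothesis mmP : forall q (X Y : 'M[F]_q),
  mx_result theta (mm_input X Y) (mm q) (leaf theta (mm_input X Y) (mm q)) = X *m Y.
Hypothesis mm_cost : forall j (X Y : 'M[F]_(2 ^ j)),
  (cost theta (mm_input X Y) (mm (2 ^ j)))%:R <= cmm * w ^+ j.
Hypothesis w_ge4 : 4 <= w.
Local Notation opmx := (opmx F I n).
Local Notation rep := (rep x).
Local Notation repM := (repM x).
Local Notation repP := (repP theta x).
Local Notation dg := (@dg F n).
Local Notation runsb := (runsb theta x (R := R)).
Local Notation conjtr := (conjtr theta).
Local Notation fact := (fact theta).
Local Notation gcost := (gcost w cmm).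

Lemma dg1_mul (M : 'M[F]_n) v : dg [:: v] *m M *m dg [:: v] = M v v *: dg [:: v].
Proof.
apply/matrixP=> i j; rewrite mul_rdgE mul_dgE !mxE !inE.
have [->|vj] := eqVneq j v; last first.
  by have [->|_] := eqVneq i v; rewrite ?andbF ?mulr0 // eq_sym (negbTE vj) mulr0.
by have [->|_] := eqVneq i v; rewrite ?eqxx ?mulr1 ?mulr0.
Qed.

Lemma inv_on1_neq0 (M X : 'M[F]_n) v : inv_on [:: v] [:: v] M X -> M v v != 0.
Proof.
move=> h; have [e _ _] := h; apply/eqP => m0.
move: e; rewrite -(inv_onl h) mulmxA dg1_mul m0 scale0r mul0mx.
move=> /matrixP/(_ v v); rewrite !mxE inE eqxx => /eqP.
by rewrite eq_sym oner_eq0.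
Qed.

Lemma inv_on1 (M : 'M[F]_n) v : M v v != 0 ->
  inv_on [:: v] [:: v] M ((M v v)^-1 *: dg [:: v]).
Proof.
move=> m0; have e : (M v v)^-1 *: (dg [:: v] *m M *m dg [:: v]) = dg [:: v].
  by rewrite dg1_mul scalerA mulVf // scale1r.
split; first by rewrite -scalemxAr.
  by rewrite -!scalemxAl.
by rewrite -!scalemxAr -!scalemxAl !dgK.
Qed.

Lemma repM_op1 mem v a c : rep mem a c -> repM mem (op1 v v a) (c *: dg [:: v]).
Proof.
move=> h i j; rewrite /op1 !mxE inE.
case: (eqVneq i v) => [->|_] /=; last by rewrite andbF mulr0.
by rewrite eq_sym; case: (eqVneq v j) => /= _; rewrite ?mulr1 ?mulr0.
Qed.

Lemma singleP mem M (Mv : 'M[F]_n) v :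
  conjtr Mv = Mv -> repM mem M Mv -> Mv v v != 0 ->
  runsb mem (single M v) 1
    (fun d m => repP m d Mv /\ perm_eq (flatten (pd_s d)) [:: v]).
Proof.
move=> hMh hM m0; apply: (runsb_bind (b1 := 1) (b2 := 0)
  (Q1 := fun a m => rep m a (Mv v v)^-1 /\ repM m M Mv)); last by rewrite addr0.
  apply: (runsb_instr (v := (Mv v v)^-1)) => //.
    by rewrite /= (rep_val (hM v v)) mul1r.
  by move=> o e ho; split=> //; apply: repM_ext.
move=> a e [ha {}hM]; apply: runsb_ret => //; split=> //=.
exists ((Mv v v)^-1 *: dg [:: v]), (Mv v v *: dg [:: v]), ((Mv v v)^-1 *: dg [:: v]).
have mh : theta (Mv v v) = Mv v v by apply: herm_entry.
have cE c : conjtr (c *: dg [:: v]) = theta c *: dg [:: v].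
  by rewrite -[in RHS](conjtr_dg theta); apply/matrixP=> i j; rewrite !mxE rmorphM.
have hZ := repM_op1 v ha; have hD := repM_op1 v (hM v v).
split=> //.
split=> //=.
- exact: inv_on1.
- by rewrite -!scalemxAr -!scalemxAl !dgK.
- move=> i j; rewrite !mxE inE; case: (eqVneq i j) => [->|]; last by rewrite mulr0 eqxx.
  case: (eqVneq j v) => [->|]; last by rewrite mulr0 eqxx.
  by move=> _; exists [:: v]; split; rewrite ?inE.
- by rewrite cE mh.
- rewrite cE fmorphV mh -!scalemxAr -!scalemxAl !dgK !scalerA.
  by rewrite mulVf // mul1r.
move=> i j; rewrite !inE => /eqP -> /eqP -> _; rewrite eqxx.
by rewrite -scalemxAr mxE mul_rdgE inE eqxx mulVf.
Qed.

Lemma mul_dg2 (M : 'M[F]_n) i j : M i i = 0 -> M j j = 0 -> i != j ->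
  dg [:: i; j] *m M *m dg [:: i; j] = M i j *: delta_mx i j + M j i *: delta_mx j i.
Proof.
move=> hi hj ij; apply/matrixP=> a b; rewrite mul_rdgE mul_dgE !mxE !inE.
have ji : j == i = false by rewrite eq_sym; apply: negbTE.
have [->|ai] /= := eqVneq a i.
  rewrite (negbTE ij) /= mulr0 addr0.
  have [->|bi] /= := eqVneq b i; first by rewrite hi (negbTE ij) mulr0.
  by have [->|] := eqVneq b j; rewrite ?mulr1 ?mulr0.
rewrite mulr0 add0r; have [->|aj] /= := eqVneq a j; last by rewrite mulr0; case: ifP.
have [->|bi] /= := eqVneq b i; first by rewrite mulr1.
by have [->|] := eqVneq b j; rewrite ?hj mulr0.
Qed.

Lemma repM_op2 mem (i j : 'I_n) a b c d : i != j -> rep mem a c -> rep mem b d ->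
  repM mem (op2 i j a b) (c *: delta_mx i j + d *: delta_mx j i).
Proof.
move=> ij ha hb u v; rewrite /op2 /op1 !mxE.
have [->|ui] /= := eqVneq u i; last first.
  by rewrite mulr0 add0r; case: ifP => _; rewrite ?mulr1 ?mulr0.
rewrite (negbTE ij) /= mulr0 addr0.
by case: eqVneq => _; rewrite ?mulr1 ?mulr0.
Qed.

Lemma mul_delta2 (i j : 'I_n) (a b c d : F) : i != j -> a * d = 1 -> b * c = 1 ->
  (a *: delta_mx i j + b *: delta_mx j i) *m
  (c *: delta_mx i j + d *: delta_mx j i) = dg [:: i; j].
Proof.
move=> ij h1 h2; have ji : j == i = false by rewrite eq_sym; apply: negbTE.
rewrite mulmxDl !mulmxDr -!scalemxAr -!scalemxAl !mul_delta_mx_cond ji (negbTE ij) !eqxx.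
rewrite !mulr0n !mulr1n !scaler0 add0r addr0 !scalerA (mulrC d) (mulrC c) h1 h2 !scale1r.
apply/matrixP=> u v; rewrite !mxE !inE.
have [->|ui] /= := eqVneq u i; first by rewrite (negbTE ij) andbT addr0 eq_sym.
rewrite add0r; have [->|uj] /= := eqVneq u j; first by rewrite andbT eq_sym.
by rewrite andbF.
Qed.

Lemma antidiagP mem M (Mv : 'M[F]_n) i j :
  conjtr Mv = Mv -> repM mem M Mv -> i != j -> Mv i i = 0 -> Mv j j = 0 ->
  Mv i j != 0 ->
  runsb mem (antidiag M i j) 2
    (fun d m => repP m d Mv /\ perm_eq (flatten (pd_s d)) [:: i; j]).
Proof.
move=> hMh hM ij hi hj m0.
apply: (runsb_bind (b1 := 1) (b2 := 1)
  (Q1 := fun a m => rep m a (Mv j i)^-1 /\ repM m M Mv)); last by lra.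
  apply: (runsb_instr (v := (Mv j i)^-1)) => //.
    by rewrite /= (rep_val (hM j i)) mul1r.
  by move=> o e ho; split=> //; apply: repM_ext.
move=> a e [ha {}hM].
apply: (runsb_bind (b1 := 1) (b2 := 0)
  (Q1 := fun b m => [/\ rep m a (Mv j i)^-1, rep m b (Mv i j)^-1 & repM m M Mv]));
  last by rewrite addr0.
  apply: (runsb_instr (v := (Mv i j)^-1)) => //.
    by rewrite /= (rep_val (hM i j)) mul1r.
  by move=> o e' ho; split=> //; [apply: rep_ext|apply: repM_ext].
move=> b e' [{}ha hb {}hM]; apply: runsb_ret => //; split=> //=.
have th k l : theta (Mv k l) = Mv l k by apply: herm_entry.
have m0' : Mv j i != 0 by rewrite -th fmorph_eq0.
(* This is the inverse of the antidiagonal block [D]. It serves both as [Z] and as [N], and the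
   block of L it gives is the identity. *)
set Z := (Mv j i)^-1 *: delta_mx i j + (Mv i j)^-1 *: delta_mx j i.
set D := Mv i j *: delta_mx i j + Mv j i *: delta_mx j i.
have DZ : D *m Z = dg [:: i; j] by apply: mul_delta2; rewrite ?mulfV.
have ZD : Z *m D = dg [:: i; j] by apply: mul_delta2; rewrite ?mulVf.
have DE : dg [:: i; j] *m Mv *m dg [:: i; j] = D by apply: mul_dg2.
have cd k l : conjtr (delta_mx k l : 'M[F]_n) = delta_mx l k.
  by apply/matrixP=> u v; rewrite !mxE rmorph_nat andbC.
have cs (c : F) (X : 'M[F]_n) : conjtr (c *: X) = theta c *: conjtr X.
  by apply/matrixP=> u v; rewrite !mxE rmorphM.
have ZP : Z = dg [:: i; j] *m Z.
  rewrite /Z; apply/matrixP=> u v; rewrite mul_dgE !mxE !inE.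
  by case: (eqVneq u i); case: (eqVneq u j) => //=; rewrite !mulr0 addr0.
have Zh : conjtr Z = Z by rewrite conjtrD !cs !cd !fmorphV !th addrC.
have ZPr : Z *m dg [:: i; j] = Z.
  by have := congr1 (@Defs.conjtr F theta n n) ZP; rewrite conjtrM conjtr_dg Zh => <-.
have MZ : dg [:: i; j] *m Mv *m Z = dg [:: i; j] by rewrite ZP mulmxA DE.
have hZ := repM_op2 ij ha hb; have hD := repM_op2 ij (hM i j) (hM j i).
exists Z, D, Z; split=> //.
split=> //=; rewrite ?cats0.
- by rewrite inE ij.
- split=> //; last by rewrite -ZP ZPr.
  by rewrite -ZPr -!mulmxA (mulmxA (dg _)) DE.
- by rewrite -ZP ZPr.
- move=> u v; rewrite !mxE => h; exists [:: i; j]; rewrite !inE.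
  have [/andP [/eqP -> /eqP ->]|h1] := boolP ((u == i) && (v == j)).
    by rewrite !eqxx orbT.
  have [/andP [/eqP -> /eqP ->]|h2] := boolP ((u == j) && (v == i)).
    by rewrite !eqxx orbT; split=> //; rewrite eq_sym.
  by rewrite (negbTE h1) (negbTE h2) !mulr0 addr0 eqxx in h.
- by rewrite conjtrD !cs !cd !th addrC.
- by rewrite ZD Zh -ZP.
move=> u v hu hv _.
have : (dg [:: i; j] *m Mv *m Z) u v = (u == v)%:R by rewrite MZ mxE hu andbT.
by rewrite -mulmxA mul_dgE hu.
Qed.

Lemma pivot_blockP mem M (Mv : 'M[F]_n) b X :
  conjtr Mv = Mv -> repM mem M Mv -> inv_on b b Mv X -> uniq b ->
  size b \in [:: 1; 2]%N ->
  runsb mem (pivot_block mm M b) (2 + 8 * gcost 1 0)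
    (fun d m => repP m d Mv /\ perm_eq (flatten (pd_s d)) b).
Proof.
move=> hMh hM hX ub sb.
have g0 : 0 <= gcost 1 0 by apply: (gcost_ge0 mm_cost).
case: b sb hX ub => [|i [|j []]] //= _ hX.
  move=> _; apply: runsb_weaken (singleP hMh hM (inv_on1_neq0 hX)) _ _ => //.
  by lra.
rewrite inE andbT => ij.
have two k l : k != l -> [:: k; l] =i [:: i; j] -> Mv k k != 0 ->
    runsb mem (andthen mm 1 M (single M k) (fun M' => single M' l) [:: l])
      (2 + 8 * gcost 1 0)
      (fun d m => repP m d Mv /\ perm_eq (flatten (pd_s d)) [:: k; l]).
  move=> kl hkl mk.
  apply: runsb_weaken (andthenP thetaK mmP mm_cost w_ge4 (P := [:: k])
    (b1 := 1) (b2 := 1) hMh hM _ _ (singleP hMh hM mk) _) _ _ => //.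
  move=> e M1 M1v s1 Z1 D1 N1 hM1 hM1h f1 p1 e1; apply: singleP => //.
  have iN : inv_on [:: k] [:: k] Mv N1.
    by apply: inv_on_eq (fact_inv f1); apply: perm_mem.
  have iX : inv_on ([:: k] ++ [:: l]) ([:: k] ++ [:: l]) Mv X.
    by apply: inv_on_eq hX => u; rewrite hkl.
  have dj : {in [:: k], forall u, u \notin [:: l]}.
    by move=> u; rewrite !inE => /eqP ->.
  (* The pair is nonsingular and so is its entry at [k], hence the Schur complement at [l] is
     nonzero. *)
  apply: inv_on1_neq0 (inv_on_congr (esym e1) (inv_restrict iX iN dj dj)).
apply: (runsb_if (hM i i)) => hi; last exact: two.
apply: (runsb_if (hM j j)) => hj.
  apply: runsb_weaken (antidiagP hMh hM ij hi hj _) _ _ => //; last by lra.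
  have [e _ _] := hX; apply/eqP => m0.
  move: e; rewrite -(inv_onl hX) mulmxA mul_dg2 // m0 scale0r add0r.
  have -> : Mv j i = 0 by rewrite -(herm_entry j i hMh) m0 rmorph0.
  rewrite scale0r mul0mx => /matrixP/(_ i i); rewrite !mxE !inE eqxx => /eqP.
  by rewrite eq_sym oner_eq0.
apply: runsb_weaken (two j i _ _ hj) (lexx _) _; first by rewrite eq_sym.
  by move=> u; rewrite !inE orbC.
move=> d e [h1 h2]; split=> //; apply: perm_trans h2 _.
by rewrite (perm_catC [:: j] [:: i]).
Qed.

(** The recurrence T(k+1) = 2 T(k) + 8 (cmm + 1) w^(k+2) requires c (w - 2) to be at least 8 (cmm +
    1) w^2, which holds for c = 24 (cmm + 1) w as w is at least 4. The 2 pays the divisions in a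
    base block. *)
Definition cnopiv : R := 24 * (cmm + 1) * w + 2.

Lemma size_flatten_le (g : seq (seq 'I_n)) :
  all (fun b => size b \in [:: 1; 2]%N) g -> (size (flatten g) <= 2 * size g)%N.
Proof.
elim: g => //= b g IH /andP [hb /IH h]; rewrite size_cat mulnS leq_add //.
by move: hb; rewrite !inE => /orP [] /eqP ->.
Qed.

Lemma nopivP k g mem M (Mv : 'M[F]_n) :
  conjtr Mv = Mv -> repM mem M Mv -> reg Mv g g -> uniq (flatten g) ->
  all (fun b => size b \in [:: 1; 2]%N) g -> (size g <= 2 ^ k)%N ->
  runsb mem (nopiv mm k g M) (cnopiv * w ^+ k)
    (fun d m => repP m d Mv /\ perm_eq (flatten (pd_s d)) (flatten g)).
Proof.
have c0 : 0 <= cmm by apply: (mm_cost_ge0 (theta := theta) (mm := mm) (w := w)).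
have w0 : 0 <= w by apply: le_trans w_ge4.
have cw0 : 0 <= cmm * w by apply: mulr_ge0.
elim: k g mem M Mv => [|k IH] g mem M Mv hMh hM hr ug ag sg.
  have nilP : runsb mem (cret (PData [::] op0 op0 op0)) (cnopiv * w ^+ 0)
      (fun d m => repP m d Mv /\ perm_eq (flatten (pd_s d)) [::]).
    apply: runsb_ret; first by rewrite expr0 /cnopiv; lra.
    split=> //; exists 0, 0, 0; split; try exact: repM0.
    exact: fact_nil.
  case: g sg hr ug ag => [|b [|? ?]] //= _ hr ub /andP [sb _].
  rewrite !cats0 in ub *; have [X] := hr 1%N; rewrite /= cats0 => hX.
  apply: runsb_weaken (pivot_blockP hMh hM hX ub sb) _ _ => //.
  by rewrite /gcost !expr0 expr1 /cnopiv; lra.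
rewrite -{2}(cat_take_drop (2 ^ k) g) flatten_cat /=.
have hg := cat_take_drop (2 ^ k) g.
move: hr ug ag sg; rewrite -hg; set g1 := take _ g; set g2 := drop _ g.
move=> hr ug ag sg.
have s1 : (size g1 <= 2 ^ k)%N by rewrite size_take_min geq_minl.
have s2 : (size g2 <= 2 ^ k)%N.
  by rewrite size_drop leq_subLR addnn -mul2n -expnS -hg.
have r1 := reg_catl (erefl (size g1)) hr.
move: (ag) (ug); rewrite all_cat flatten_cat cat_uniq => /andP [ag1 ag2] /and3P [ug1 _ ug2].
rewrite hg.
apply: runsb_weaken (andthenP thetaK mmP mm_cost w_ge4 hMh hM ug2 _ (IH _ _ _ _ hMh hM r1 ug1 ag1 s1)
   (b2 := cnopiv * w ^+ k) _) _ _ => //.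
- rewrite -flatten_cat (leq_trans (size_flatten_le ag)) //.
  by rewrite (expnS 2 k.+1) leq_mul2l.
- move=> e M1 M1v t1 Z1 D1 N1 hM1 hM1h f1 p1 e1; apply: IH => //.
  apply: reg_congr (esym e1) _ => //.
  apply: (reg_catr (erefl (size g1)) ug ug hr).
  by apply: inv_on_eq (fact_inv f1); apply: perm_mem.
rewrite /gcost expr0 mulr1 !exprS.
have wk : 0 <= w ^+ k by apply: exprn_ge0.
rewrite -mulrDl !mulrA -mulrDl ler_wpM2r // /cnopiv.
have w4 : 0 <= w - 4 by rewrite subr_ge0.
have c1 : 0 <= cmm + 1 by rewrite addr_ge0.
have := mulr_ge0 (mulr_ge0 c1 w0) w4.
nra.
Qed.

End NoPiv.

(** * Pivot pairs in an off-diagonal block *)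

Section PairProgram.
Variables (F : fieldType) (I : Type) (n : nat) (mm : forall q, mm_program F q).
Local Notation opmx := (opmx F I n).

Record ludata := LUData { lu_I : seq 'I_n; lu_J : seq 'I_n; lu_H : opmx }.

Fixpoint pick_col (r : 'I_n) (C : seq 'I_n) (B : opmx) : builder F I ludata :=
  match C with
  | [::] => cret (LUData [::] [::] op0)
  | c :: C' =>
      cif (B r c) (pick_col r C' B)
        (let! a := cinstr (Div (Const 1) (B r c)) in
         cret (LUData [:: r] [:: c] (op1 c r a)))
  end.

(** Only the rows are halved and the whole column list is kept, so [d] grows as [j] shrinks. Columns
    already chosen vanish in the Schur complement and cannot be picked again. *)
Fixpoint pair_lu (j d : nat) (R C : seq 'I_n) (B : opmx) : builder F I ludata :=
  match j with
  | 0 => if R is r :: _ then pick_col r C B else cret (LUData [::] [::] op0)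
  | j.+1 =>
      let! u := pair_lu j d.+1 (take (2 ^ j) R) C B in
      let! B1 := schurc mm j d.+1 (lu_H u) B (lu_I u) (lu_J u) (drop (2 ^ j) R) C in
      let! v := pair_lu j d.+1 (drop (2 ^ j) R) C B1 in
      let! H := invmerge mm j.+1 B (lu_H u) (lu_H v)
                  (lu_I u) (lu_J u) (lu_I v) (lu_J v) in
      cret (LUData (lu_I u ++ lu_I v) (lu_J u ++ lu_J v) H)
  end.

End PairProgram.

Section PairSpec.
Variables (F : fieldType) (theta : {rmorphism F -> F}).
Hypothesis thetaK : involutive theta.
Variables (I : Type) (x : I -> F) (n : nat).
Variables (mm : forall q, mm_program F q) (R : realType) (w cmm : R).
Hypothesis mmP : forall q (X Y : 'M[F]_q),
  mx_result theta (mm_input X Y) (mm q) (leaf theta (mm_input X Y) (mm q)) = X *m Y.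
Hypothesis mm_cost : forall j (X Y : 'M[F]_(2 ^ j)),
  (cost theta (mm_input X Y) (mm (2 ^ j)))%:R <= cmm * w ^+ j.
Hypothesis w_gt4 : 4 < w.
Local Notation opmx := (opmx F I n).
Local Notation rep := (rep x).
Local Notation repM := (repM x).
Local Notation repP := (repP theta x).
Local Notation dg := (@dg F n).
Local Notation runsb := (runsb theta x (R := R)).
Local Notation conjtr := (conjtr theta).
Local Notation fact := (fact theta).
Local Notation gcost := (gcost w cmm).

Let w_ge4 : 4 <= w := ltW w_gt4.

Lemma schur_congr (B B' H : 'M[F]_n) (rs cs rI rJ : seq 'I_n) :
  {subset rI <= rs} -> {subset rJ <= cs} -> dg rJ *m H *m dg rI = H ->
  dg rs *m B *m dg cs = dg rs *m B' *m dg cs ->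
  dg rs *m schur B H *m dg cs = dg rs *m schur B' H *m dg cs.
Proof.
move=> sI sJ hH e.
have hl : dg cs *m H = H by rewrite -hH !mulmxA dg_subr.
have hr : H *m dg rs = H by rewrite -hH -!mulmxA dg_subl.
have E X : dg rs *m (X *m H *m X) *m dg cs =
    (dg rs *m X *m dg cs) *m H *m (dg rs *m X *m dg cs).
  by rewrite -{1}hl -{1}hr !mulmxA.
by rewrite /schur !mulmxBr !mulmxBl !E e.
Qed.

Lemma inv_on_op (B : 'M[F]_n) (r c : 'I_n) : B r c != 0 ->
  inv_on [:: r] [:: c] B ((B r c)^-1 *: delta_mx c r).
Proof.
move=> b0; have dd (a b : 'I_n) : dg [:: a] *m delta_mx a b = delta_mx a b :> 'M[F]_n.
  apply/matrixP=> i j; rewrite mul_dgE !mxE inE.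
  by case: (i == a); rewrite ?andbF.
have dr (a b : 'I_n) : delta_mx a b *m dg [:: b] = delta_mx a b :> 'M[F]_n.
  apply/matrixP=> i j; rewrite mul_rdgE !mxE inE.
  by case: (j == b); rewrite ?andbF.
have e : dg [:: r] *m B *m dg [:: c] = B r c *: delta_mx r c.
  apply/matrixP=> i j; rewrite mul_rdgE mul_dgE !mxE !inE.
  have [->|_] := eqVneq i r; last by rewrite mulr0; case: ifP.
  by have [->|_] := eqVneq j c; rewrite ?mulr1 ?mulr0.
have d1 (a : 'I_n) : delta_mx a a = dg [:: a].
  apply/matrixP=> i j; rewrite !mxE inE.
  have [->|_] := eqVneq i a; last by rewrite andbF.
  by rewrite andbT eq_sym.
split.
- rewrite -(dd c r) scalemxAr mulmxA e -scalemxAl -scalemxAr scalerA mulfV //.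
  by rewrite scale1r mul_delta_mx d1.
- rewrite -(dr c r) scalemxAl -!mulmxA (mulmxA (dg [:: r])) e -scalemxAl.
  by rewrite -scalemxAr scalerA mulVf // scale1r mul_delta_mx d1.
by rewrite -scalemxAr -scalemxAl dd dr.
Qed.

(** Besides the final inverse, the nonsingularity of every prefix is recorded; it becomes the
    regularity of the list of pairs. *)
Definition repL mem (u : ludata F I n) (B : 'M[F]_n) (rs cs : seq 'I_n) :=
  exists H, [/\ repM mem (lu_H u) H, inv_on (lu_I u) (lu_J u) B H,
    reg B (map (fun i => [:: i]) (lu_I u)) (map (fun i => [:: i]) (lu_J u)),
    dg rs *m schur B H *m dg cs = 0 &
    [/\ uniq (lu_I u), uniq (lu_J u), size (lu_I u) = size (lu_J u),
      {subset lu_I u <= rs} & {subset lu_J u <= cs}]].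

Lemma repL_nil mem B rs cs : dg rs *m B *m dg cs = 0 ->
  repL mem (LUData [::] [::] op0) B rs cs.
Proof.
move=> h; exists 0; split=> //; first exact: repM0.
- exact: inv_on_nil.
- exact: reg_nil.
by rewrite /schur mulmx0 mul0mx subr0.
Qed.

Lemma pick_colP mem B (Bv : 'M[F]_n) r cs :
  repM mem B Bv -> runsb mem (pick_col r cs B) 1 (fun u m => repL m u Bv [:: r] cs).
Proof.
move=> hB.
(* Generalized to the columns still to be tested, the earlier ones having shown zero entries. *)
suff: forall cs2, {subset cs2 <= cs} -> (forall c, c \in cs -> c \notin cs2 -> Bv r c = 0) ->
    runsb mem (pick_col r cs2 B) 1 (fun u m => repL m u Bv [:: r] cs).
  by apply=> // c ->.
elim=> [|c cs2 IH] hs h0 /=.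
  apply: runsb_ret => //; apply: repL_nil; apply/matrixP=> i j.
  rewrite mul_rdgE mul_dgE mxE inE; case: ifP => // hj.
  by case: eqP => // ->; apply: h0.
apply: (runsb_if (hB r c)) => hc.
  apply: IH => [u hu|u hu nu]; first by apply: hs; rewrite inE hu orbT.
  have [->//|uc] := eqVneq u c.
  by apply: h0; rewrite // inE negb_or uc.
apply: (runsb_bind (b1 := 1) (b2 := 0)
  (Q1 := fun a m => rep m a (Bv r c)^-1)); last by rewrite addr0.
  apply: (runsb_instr (v := (Bv r c)^-1)) => //.
  by rewrite /= (rep_val (hB r c)) mul1r.
move=> a e ha; apply: runsb_ret => //.
have hi := inv_on_op hc.
exists ((Bv r c)^-1 *: delta_mx c r); split=> //=.
- move=> i j; rewrite /op1 !mxE; case: ifP => _; first by rewrite mulr1.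
  by rewrite mulr0.
- exact: (reg_one hi).
- by rewrite (schur_row0 hi) mul0mx.
by split=> //= u; rewrite inE => /eqP ->; apply: hs; rewrite mem_head.
Qed.

(** Two calls with a doubled column ratio give a factor 4 per level, against [w]: the geometric sum
    is bounded through the denominator [w - 4]. The numerator collects the Schur complement and the
    merging of inverses; the final 1 pays the division in a base row. *)
Definition cpair : R := (4 * (cmm + 1) + 4 * (cmm + 1) * w) / (w - 4) + 1.

Lemma cmm_ge0 : 0 <= cmm.
Proof. by apply: (mm_cost_ge0 (theta := theta) (mm := mm) (w := w)). Qed.

Lemma pair_luP j d mem B (Bv : 'M[F]_n) rs cs :
  (size rs <= 2 ^ j)%N -> (size cs <= 2 ^ (j + d))%N -> uniq rs -> uniq cs ->
  repM mem B Bv ->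
  runsb mem (pair_lu mm j d rs cs B) (cpair * 2 ^+ d * w ^+ j)
    (fun u m => repL m u Bv rs cs).
Proof.
have c0 := cmm_ge0; have w0 : 0 <= w by apply: le_trans w_ge4.
have w4 : 0 < w - 4 by rewrite subr_gt0.
have cp1 : 1 <= cpair.
  rewrite /cpair lerDr divr_ge0 ?(ltW w4) // addr_ge0 ?mulr_ge0 ?addr_ge0 //.
elim: j d mem B Bv rs => [|j IH] d mem B Bv rs hr hc ur uc hB.
  have h1 : 1 <= cpair * 2 ^+ d * w ^+ 0.
    rewrite expr0 mulr1 -[leLHS]mulr1 ler_pM //.
    by rewrite -natrX ler1n expn_gt0.
  case: rs hr ur => [|r [|? ?]] //= _ _.
    apply: runsb_ret; first by apply: le_trans h1.
    by apply: repL_nil; rewrite dg_nil !mul0mx.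
  by apply: runsb_weaken (pick_colP r cs hB) h1 _.
have rE := cat_take_drop (2 ^ j) rs; set r1 := take _ rs in rE; set r2 := drop _ rs in rE.
have s1 : (size r1 <= 2 ^ j)%N by rewrite size_take_min geq_minl.
have s2 : (size r2 <= 2 ^ j)%N by rewrite size_drop leq_subLR addnn -mul2n -expnS.
have hc' : (size cs <= 2 ^ (j + d.+1))%N by rewrite addnS -addSn.
have u1 : uniq r1 by apply: take_uniq.
have u2 : uniq r2 by apply: drop_uniq.
rewrite /= -/r1 -/r2.
pose T := cpair * 2 ^+ d.+1 * w ^+ j; pose g := gcost j d.+1; pose g' := gcost j.+1 0.
apply: (runsb_bind (b2 := 2 * g + (T + 4 * g')) (IH _ _ _ _ _ s1 hc' u1 uc hB)); last first.
  suff: T + (2 * g + (T + 4 * g')) <= cpair * 2 ^+ d * w ^+ j.+1 by [].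
  have -> : T + (2 * g + (T + 4 * g')) = (cpair * 4 + (cmm + 1) * 4) * (2 ^+ d * w ^+ j)
      + (cmm + 1) * 4 * w * w ^+ j.
    by rewrite /T /g /g' /gcost !exprS expr0; ring.
  have -> : cpair * 2 ^+ d * w ^+ j.+1 = (cpair * w) * (2 ^+ d * w ^+ j).
    by rewrite exprS; ring.
  have d1 : w ^+ j <= 2 ^+ d * w ^+ j.
    rewrite ler_peMl ?exprn_ge0 // -natrX ler1n expn_gt0 //.
  have e1 : (cmm + 1) * 4 * w * w ^+ j <= (cmm + 1) * 4 * w * (2 ^+ d * w ^+ j).
    by rewrite ler_wpM2l // !mulr_ge0 // addr_ge0.
  apply: le_trans (lerD (lexx _) e1) _; rewrite -mulrDl ler_wpM2r //.
    by rewrite mulr_ge0 ?exprn_ge0.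
  have -> : cpair * w = cpair * (w - 4) + cpair * 4 by ring.
  have -> : cpair * (w - 4) = 4 * (cmm + 1) + 4 * (cmm + 1) * w + (w - 4).
    by rewrite /cpair mulrDl divfK ?mul1r // gt_eqF.
  by move: w4; lra.
move=> u e [H1 [hH1 i1 g1 z1 [uI1 uJ1 szu sub1 sub1']]]; have {}hB := repM_ext e hB.
have sI1 : (size (lu_I u) <= 2 ^ j)%N by rewrite (leq_trans _ s1) ?uniq_leq_size.
have sJ1 : (size (lu_J u) <= 2 ^ j)%N by rewrite -szu.
apply: (runsb_bind (b2 := T + 4 * g') (schurcP mmP mm_cost w_ge4 sI1 sJ1 s2 hc' uI1 uJ1 uc hH1 hB i1)) => //.
move=> B1 e1 hB1; have {}hB := repM_ext e1 hB; have {}hH1 := repM_ext e1 hH1.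
set B1v := Bv - _ in hB1.
apply: (runsb_bind (b2 := 4 * g') (IH _ _ _ _ _ s2 hc' u2 uc hB1)) => //.
move=> v e2 [H2 [hH2 i2 g2 z2 [uI2 uJ2 szv sub2 sub2']]].
have {}hB := repM_ext e2 hB; have {}hH1 := repM_ext e2 hH1.
have B1E : dg r2 *m B1v *m dg cs = dg r2 *m schur Bv H1 *m dg cs.
  rewrite /B1v /schur !mulmxBr !mulmxBl; congr (_ - _).
  by rewrite !mulmxA dgK -!mulmxA dgK.
have H2s : dg (lu_J v) *m H2 *m dg (lu_I v) = H2 by case: i2.
have z2' : dg r2 *m schur (schur Bv H1) H2 *m dg cs = 0.
  by rewrite -(schur_congr sub2 sub2' H2s B1E).
have {}i2 : inv_on (lu_I v) (lu_J v) (schur Bv H1) H2.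
  apply: inv_on_congr i2.
  rewrite -(dg_subl _ sub2) -(dg_subr _ sub2') !mulmxA.
  by rewrite -!(mulmxA (dg (lu_I v))) B1E.
have {}g2 : reg (schur Bv H1) (map (fun i => [:: i]) (lu_I v)) (map (fun i => [:: i]) (lu_J v)).
  by apply: reg_congr B1E g2; rewrite flatten_seq1.
have sI2 : (size (lu_I v) <= 2 ^ j)%N by rewrite (leq_trans _ s2) ?uniq_leq_size.
have sI : (size (lu_I u ++ lu_I v) <= 2 ^ j.+1)%N.
  by rewrite size_cat expnS mul2n -addnn leq_add.
have sJ : (size (lu_J u ++ lu_J v) <= 2 ^ j.+1)%N.
  by rewrite size_cat -szu -szv -size_cat.
apply: (runsb_bind (b2 := 0) (invmergeP mmP mm_cost w_ge4 sI sJ uI1 uJ1 uI2 uJ2 hB hH1 hH2 i1 i2));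
  last by rewrite addr0.
move=> H e3 hH; apply: runsb_ret => //.
have djI := inv_on_rows (schur_row0 i1) i2.
have djJ := inv_on_cols (schur_col0 i1) i2.
exists (comp_inv Bv H1 H2); split=> //=.
- exact: inv_comp.
- by rewrite !map_cat; apply: reg_cat g2; rewrite ?size_map ?flatten_seq1.
(* Rows [r1] are already zero on [cs] in the first Schur complement, and the second elimination
   keeps them zero. *)
- rewrite schur_comp -rE -mulmxA; apply: mul_dg_catl; last by rewrite mulmxA.
  rewrite mulmxA /schur mulmxBr mulmxBl -/(schur Bv H1) z1 sub0r.
  rewrite -(inv_onl i2) -(dg_subr _ sub2') !mulmxA -/(schur Bv H1).
  by rewrite z1 !mul0mx oppr0.
split.
- rewrite cat_uniq uI1 uI2 andbT; apply/hasPn => i hi; apply/negP => /djI.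
  by rewrite hi.
- rewrite cat_uniq uJ1 uJ2 andbT; apply/hasPn => i hi; apply/negP => /djJ.
  by rewrite hi.
- by rewrite !size_cat szu szv.
- move=> i; rewrite -rE !mem_cat => /orP [/sub1 ->//|/sub2 ->].
  by rewrite orbT.
by move=> i; rewrite mem_cat => /orP [/sub1'|/sub2'].
Qed.

End PairSpec.

(** * Dense partial factorization *)

Section FrontProgram.
Variables (F : fieldType) (I : Type) (n : nat) (mm : forall q, mm_program F q).
Local Notation opmx := (opmx F I n).

Definition pair_blocks (rI rJ : seq 'I_n) : seq (seq 'I_n) :=
  [seq [:: p.1; p.2] | p <- zip rI rJ].

(** Only block lists are passed on, and inverses are recomputed from [M] when needed. A lone vertex
    with zero diagonal gives no pivot here, but an enclosing call may pair it across its two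
    halves. *)
Fixpoint find_pivots (k : nat) (E : seq 'I_n) (M : opmx) :
    builder F I (seq (seq 'I_n)) :=
  match k with
  | 0 =>
      if E is v :: _ then cif (M v v) (cret [::]) (cret [:: [:: v]])
      else cret [::]
  | k.+1 =>
      let E1 := take (2 ^ k) E in
      let E2 := drop (2 ^ k) E in
      let! g1 := find_pivots k E1 M in
      let! d1 := nopiv mm k g1 M in
      let! M1 := schurc mm k.+1 0 (pd_N d1) M
                   (flatten (pd_s d1)) (flatten (pd_s d1)) E E in
      let! u := pair_lu mm k 0 E1 E2 M1 in
      let g2 := pair_blocks (lu_I u) (lu_J u) in
      let! d2 := nopiv mm k.+1 (g1 ++ g2) M in
      let! M2 := schurc mm k.+1 0 (pd_N d2) M
                   (flatten (pd_s d2)) (flatten (pd_s d2)) E E in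
      let! g3 := find_pivots k E2 M2 in
      cret ((g1 ++ g2) ++ g3)
  end.

Record front_data := FrontData {
  fr_s : seq (seq 'I_n);
  fr_L : opmx;
  fr_D : opmx;
  fr_M : opmx
}.

Definition front (k : nat) (E V : seq 'I_n) (M : opmx) : builder F I front_data :=
  let! g := find_pivots k E M in
  let! d := nopiv mm k g M in
  let P := flatten (pd_s d) in
  let! L := gemm mm k 0 false op0 M (pd_Z d) V P P in
  let! M' := schurc mm k 0 (pd_N d) M P P V V in
  cret (FrontData (pd_s d) L (pd_D d) M').

End FrontProgram.

Section FrontSpec.
Variables (F : fieldType) (theta : {rmorphism F -> F}).
Hypothesis thetaK : involutive theta.
Variables (I : Type) (x : I -> F) (n : nat).
Variables (mm : forall q, mm_program F q) (R : realType) (w cmm : R).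
Hypothesis mmP : forall q (X Y : 'M[F]_q),
  mx_result theta (mm_input X Y) (mm q) (leaf theta (mm_input X Y) (mm q)) = X *m Y.
Hypothesis mm_cost : forall j (X Y : 'M[F]_(2 ^ j)),
  (cost theta (mm_input X Y) (mm (2 ^ j)))%:R <= cmm * w ^+ j.
Hypothesis w_gt4 : 4 < w.
Local Notation opmx := (opmx F I n).
Local Notation rep := (rep x).
Local Notation repM := (repM x).
Local Notation repP := (repP theta x).
Local Notation dg := (@dg F n).
Local Notation runsb := (runsb theta x (R := R)).
Local Notation conjtr := (conjtr theta).
Local Notation fact := (fact theta).
Local Notation gcost := (gcost w cmm).

Let w_ge4 : 4 <= w := ltW w_gt4.

Lemma mask_sub (A B : 'M[F]_n) (E E' s t : seq 'I_n) :
  {subset s <= E} -> {subset t <= E'} ->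
  dg E *m A *m dg E' = dg E *m B *m dg E' -> dg s *m A *m dg t = dg s *m B *m dg t.
Proof.
move=> hs ht e; have h X : dg s *m X *m dg t = dg s *m (dg E *m X *m dg E') *m dg t.
  by rewrite -{1}(dg_subl F hs) -{1}(dg_subr F ht) !mulmxA.
by rewrite h e -h.
Qed.

(** In the order [I1], [J1] the principal block is [[0, B], [B^H, C]], with inverse
    [[- B^-H C B^-1, B^-H], [B^-1, 0]]; this is [X], with [H] in the role of B^-1. On rows [rs] the
    product of [M] and the conjugate transpose of [H] vanishes, so there the symmetric elimination
    leaves the same rows as the unsymmetric one. *)
Lemma lu_sym (M H : 'M[F]_n) (rs I1 J1 : seq 'I_n) :
  conjtr M = M -> dg rs *m M *m dg rs = 0 -> {subset I1 <= rs} ->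
  {in I1, forall i, i \notin J1} -> inv_on I1 J1 M H ->
  let X := H + (conjtr H - conjtr H *m M *m H) in
  inv_on (I1 ++ J1) (I1 ++ J1) M X /\
  (forall cs, dg rs *m schur M H *m dg cs = 0 -> {in rs, forall i, i \notin cs} ->
    dg rs *m schur M X *m dg (rs ++ cs) = 0).
Proof.
move=> hM z sI dj hi X.
have [e1 e2 e3] := hi; have [] := inv_on_conj thetaK hi; rewrite hM => f1 f2 f3.
have hl := inv_onl hi; have hr := inv_onr hi.
have gl : dg I1 *m conjtr H = conjtr H by rewrite -f3 !mulmxA dgK.
have gr : conjtr H *m dg J1 = conjtr H by rewrite -f3 -!mulmxA dgK.
have zI : dg rs *m M *m conjtr H = 0.
  by rewrite -gl -(dg_subr _ sI) !mulmxA z !mul0mx.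
have zI1 : dg I1 *m M *m conjtr H = 0.
  by rewrite -(dg_subl F sI) -!mulmxA (mulmxA (dg rs)) zI mulmx0.
have Iz : dg I1 *m M *m dg rs = 0.
  by rewrite -(dg_subl F sI) -!mulmxA (mulmxA (dg rs)) z mulmx0.
have Xh : conjtr X = X.
  rewrite /X conjtrD conjtrB !conjtrM (conjtrK thetaK) hM addrCA mulmxA.
  by congr (_ + (_ - _)).
have half : dg (I1 ++ J1) *m M *m X = dg (I1 ++ J1).
  rewrite dg_cat // !mulmxDl; congr (_ + _).
    by rewrite /X mulmxDr e1 mulmxBr !mulmxA zI1 !mul0mx subr0 addr0.
  by rewrite /X mulmxDr mulmxBr !mulmxA f1 addrCA subrr addr0.
split.
  split=> //.
    have := congr1 (@Defs.conjtr F theta n n) half.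
    by rewrite !conjtrM Xh hM conjtr_dg mulmxA.
  have s1 : {subset I1 <= I1 ++ J1} by move=> i hi'; rewrite mem_cat hi'.
  have s2 : {subset J1 <= I1 ++ J1} by move=> i hi'; rewrite mem_cat hi' orbT.
  have L1 : dg (I1 ++ J1) *m H = H by rewrite -hl mulmxA dg_subr.
  have L2 : dg (I1 ++ J1) *m conjtr H = conjtr H by rewrite -gl mulmxA dg_subr.
  have R1 : H *m dg (I1 ++ J1) = H by rewrite -hr -mulmxA dg_subl.
  have R2 : conjtr H *m dg (I1 ++ J1) = conjtr H by rewrite -gr -mulmxA dg_subl.
  by rewrite /X mulmxDr mulmxBr !mulmxA L1 L2 mulmxDl mulmxBl R1 R2 -!mulmxA R1.
move=> cs zc djc.
have E : dg rs *m schur M X = dg rs *m schur M H.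
  rewrite /schur !mulmxBr; congr (_ - _); rewrite !mulmxA; congr (_ *m _).
  by rewrite /X mulmxDr mulmxBr !mulmxA zI !mul0mx subr0 addr0.
rewrite E dg_cat // mulmxDr zc addr0 /schur mulmxBr mulmxBl z.
have -> : dg rs *m (M *m H *m M) *m dg rs = dg rs *m M *m H *m (dg I1 *m M *m dg rs).
  by rewrite -{1}hr !mulmxA.
by rewrite Iz !mulmx0 subrr.
Qed.

Lemma pair_blocksP k (rI rJ : seq 'I_n) : size rI = size rJ ->
  flatten (take k (pair_blocks rI rJ)) =i take k rI ++ take k rJ.
Proof.
elim: rI rJ k => [|i rI IH] [|j rJ] [|k] //= [e] v.
by rewrite !inE (IH rJ k e) !mem_cat !inE; do 4!case: (_ \in _) || case: (_ == _).
Qed.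

Lemma flatten_pair_blocks (rI rJ : seq 'I_n) : size rI = size rJ ->
  perm_eq (flatten (pair_blocks rI rJ)) (rI ++ rJ).
Proof.
elim: rI rJ => [|i rI IH] [|j rJ] //= [e].
by rewrite perm_cons perm_sym -cat1s perm_catCA cat1s perm_cons perm_sym IH.
Qed.

(** [lu_sym] is applied to every prefix: leading minors of the off-diagonal block control leading
    sets of pairs. *)
Lemma reg_pair_blocks (M : 'M[F]_n) (rs rI rJ : seq 'I_n) :
  conjtr M = M -> dg rs *m M *m dg rs = 0 -> {subset rI <= rs} ->
  {in rI, forall i, i \notin rJ} -> size rI = size rJ ->
  reg M (map (fun i => [:: i]) rI) (map (fun i => [:: i]) rJ) ->
  reg M (pair_blocks rI rJ) (pair_blocks rI rJ).
Proof.
move=> hM z sI dj sz h k; have [H hH] := h k.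
rewrite -!map_take !flatten_seq1 in hH.
have sI' : {subset take k rI <= rs} by move=> i /mem_take /sI.
have dj' : {in take k rI, forall i, i \notin take k rJ}.
  by move=> i /mem_take /dj; apply: contra => /mem_take.
have [hX _] := lu_sym hM z sI' dj' hH.
have e v := esym (pair_blocksP k sz v).
by eexists; apply: (inv_on_eq e e hX).
Qed.

(** The search returns blocks without an inverse, so the zero condition refers to any inverse on
    them; inverses are unique by [inv_on_uniq]. *)
Record find_post (M : 'M[F]_n) (E : seq 'I_n) (g : seq (seq 'I_n)) : Prop := FindPost {
  find_uniq : uniq (flatten g);
  find_size : all (fun b => size b \in [:: 1; 2]%N) g;
  find_reg : reg M g g;
  find_sub : {subset flatten g <= E};
  find_zero : forall N, inv_on (flatten g) (flatten g) M N ->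
    dg E *m schur M N *m dg E = 0
}.

Lemma size_le_flatten (g : seq (seq 'I_n)) :
  all (fun b => size b \in [:: 1; 2]%N) g -> (size g <= size (flatten g))%N.
Proof.
elim: g => //= b g IH /andP [hb /IH h]; rewrite size_cat -add1n leq_add //.
by move: hb; rewrite !inE => /orP [] /eqP ->.
Qed.

(** This is exactly the nonrecursive work of a step divided by [w ^+ k]. A step then costs 2 + 1
    times [cfind * w ^+ k], which [w] at least 4 absorbs. *)
Definition cfind : R := cnopiv w cmm + cpair w cmm + (cnopiv w cmm + 4 * (cmm + 1)) * w.

Lemma cnopiv_ge0 : 0 <= cnopiv w cmm.
Proof.
have c0 : 0 <= cmm by apply: (mm_cost_ge0 (theta := theta) (mm := mm) (w := w)).
have w0 : 0 <= w by apply: le_trans w_ge4.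
by rewrite /cnopiv addr_ge0 // !mulr_ge0 // addr_ge0.
Qed.

Lemma cfind_ge0 : 0 <= cfind.
Proof.
have c0 : 0 <= cmm by apply: (mm_cost_ge0 (theta := theta) (mm := mm) (w := w)).
have w0 : 0 <= w by apply: le_trans w_ge4.
have p0 : 0 <= cpair w cmm.
  rewrite /cpair addr_ge0 // divr_ge0 ?subr_ge0 // addr_ge0 ?mulr_ge0 ?addr_ge0 //.
have n0 := cnopiv_ge0.
by rewrite /cfind addr_ge0 // ?mulr_ge0 // addr_ge0 // ?mulr_ge0 // addr_ge0.
Qed.

Lemma mask_schur (M N : 'M[F]_n) (E : seq 'I_n) :
  dg E *m (M - dg E *m (M *m N *m M) *m dg E) *m dg E = dg E *m schur M N *m dg E.
Proof.
rewrite /schur !mulmxBr !mulmxBl; congr (_ - _).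
by rewrite !mulmxA dgK -!mulmxA dgK.
Qed.

Lemma mask_herm (M N : 'M[F]_n) (E : seq 'I_n) :
  conjtr M = M -> conjtr N = N ->
  conjtr (M - dg E *m (M *m N *m M) *m dg E) = M - dg E *m (M *m N *m M) *m dg E.
Proof.
by move=> h1 h2; rewrite conjtrB !conjtrM !conjtr_dg h1 h2 !mulmxA.
Qed.

(* [g1]: pivots inside [E1]; [rI], [rJ]: pairs joining [E1] to [E2]; [g3]: pivots
   inside [E2].  [M1] and [M2] only agree with the Schur complements on [E]. *)
Lemma find_post_step (M M1 M2 : 'M[F]_n) E1 E2 g1 N1 rI rJ H N2 g3 :
  let E := E1 ++ E2 in let g2 := pair_blocks rI rJ in
  conjtr M = M -> uniq E ->
  find_post M E1 g1 -> inv_on (flatten g1) (flatten g1) M N1 ->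
  conjtr M1 = M1 -> dg E *m M1 *m dg E = dg E *m schur M N1 *m dg E ->
  size rI = size rJ -> uniq rI -> uniq rJ ->
  {subset rI <= E1} -> {subset rJ <= E2} ->
  inv_on rI rJ M1 H ->
  reg M1 (map (fun i => [:: i]) rI) (map (fun i => [:: i]) rJ) ->
  dg E1 *m schur M1 H *m dg E2 = 0 ->
  [/\ uniq (flatten (g1 ++ g2)), all (fun b => size b \in [:: 1; 2]%N) (g1 ++ g2),
     reg M (g1 ++ g2) (g1 ++ g2), {subset flatten (g1 ++ g2) <= E} &
   inv_on (flatten (g1 ++ g2)) (flatten (g1 ++ g2)) M N2 ->
   dg E *m M2 *m dg E = dg E *m schur M N2 *m dg E ->
   find_post M2 E2 g3 -> find_post M E ((g1 ++ g2) ++ g3)].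
Proof.
move=> E g2 hM uE f1 i1 hM1 M1E sz uI uJ sI sJ iH rH zH.
have [uE1 dE uE2] : [/\ uniq E1, {in E1, forall i, i \notin E2} & uniq E2].
  move: uE; rewrite cat_uniq => /and3P [-> /hasPn h ->]; split=> // i hi.
  by apply/negP => /h; rewrite /= hi.
have sE1 : {subset E1 <= E} by move=> i hi; rewrite mem_cat hi.
have sE2 : {subset E2 <= E} by move=> i hi; rewrite mem_cat hi orbT.
have z1 : dg E1 *m schur M N1 *m dg E1 = 0 by apply: (find_zero f1).
have zM1 : dg E1 *m M1 *m dg E1 = 0.
  by rewrite (mask_sub sE1 sE1 M1E).
have dIJ : {in rI, forall i, i \notin rJ}.
  by move=> i /sI /dE; apply: contra => /sJ.
have [iX0 zX] := lu_sym hM1 zM1 sI dIJ iH.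
set X := H + _ in iX0 zX; have {}zX := zX _ zH dE; rewrite -/E in zX.
have p2 := flatten_pair_blocks sz; rewrite -/g2 in p2.
have iX : inv_on (flatten g2) (flatten g2) M1 X.
  by apply: inv_on_eq iX0 => v; rewrite (perm_mem p2).
have sg2 : {subset flatten g2 <= E}.
  by move=> i; rewrite (perm_mem p2) mem_cat => /orP [/sI/sE1|/sJ/sE2].
have rg2 : reg (schur M N1) g2 g2.
  exact: (reg_congr sg2 sg2 M1E (reg_pair_blocks hM1 zM1 sI dIJ sz rH)).
have {}zX : dg E1 *m schur (schur M N1) X *m dg E = 0.
  have e := schur_congr sg2 sg2 (let: And3 _ _ e := iX in e) M1E.
  by rewrite -(mask_sub sE1 (fun _ h => h) e).
have {iX0}iX : inv_on (flatten g2) (flatten g2) (schur M N1) X.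
  apply: inv_on_congr iX.
  exact: (mask_sub sg2 sg2 M1E).
have i12 := inv_comp i1 iX; rewrite -flatten_cat in i12.
have d12 := inv_on_rows (schur_row0 i1) iX.
have u2 : uniq (flatten g2).
  rewrite (perm_uniq p2) cat_uniq uI uJ andbT.
  by apply/hasPn => i hi; apply/negP => /dIJ; rewrite hi.
have a2 : all (fun b => size b \in [:: 1; 2]%N) g2.
  by apply/allP => b /mapP [p _ ->].
have u12 : uniq (flatten (g1 ++ g2)).
  rewrite flatten_cat cat_uniq (find_uniq f1) u2 andbT.
  by apply/hasPn => i hi; apply/negP => /d12; rewrite hi.
have a12 : all (fun b => size b \in [:: 1; 2]%N) (g1 ++ g2).
  by rewrite all_cat (find_size f1).
have r12 : reg M (g1 ++ g2) (g1 ++ g2) by apply: reg_cat (find_reg f1) i1 rg2.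
have s12 : {subset flatten (g1 ++ g2) <= E}.
  by move=> i; rewrite flatten_cat mem_cat => /orP [/(find_sub f1)/sE1|/sg2].
split=> // iN2 M2E f3.
(* The second pass computes [N2] afresh; uniqueness identifies it with the two-step inverse. *)
have N2E : N2 = comp_inv M N1 X by exact: (inv_on_uniq iN2 i12).
have {}zX : dg E1 *m schur M N2 *m dg E = 0 by rewrite N2E schur_comp.
have uP3 := find_uniq f3; have [N3 i3] := reg_inv (erefl (size g3)) (find_reg f3).
have s3 : {subset flatten g3 <= E} by move=> i /(find_sub f3)/sE2.
have {}i3 : inv_on (flatten g3) (flatten g3) (schur M N2) N3.
  exact: inv_on_congr (mask_sub s3 s3 M2E) i3.
have d3 := inv_on_rows (schur_row0 iN2) i3.
have z3 : dg E2 *m schur (schur M N2) N3 *m dg E2 = 0.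
  have i3' := inv_on_congr (esym (mask_sub s3 s3 M2E)) i3.
  have := schur_congr s3 s3 (let: And3 _ _ e := i3 in e) M2E.
  by move/(mask_sub sE2 sE2) => <-; apply: (find_zero f3).
split.
- rewrite flatten_cat cat_uniq u12 uP3 andbT.
  by apply/hasPn => i hi; apply/negP => /d3; rewrite hi.
- by rewrite all_cat a12 (find_size f3).
- by apply: reg_cat r12 iN2 _ => //; apply: reg_congr M2E (find_reg f3).
- by move=> i; rewrite flatten_cat mem_cat => /orP [/s12|/s3].
move=> N iN; have {iN N} -> : N = comp_inv M N2 N3.
  by apply: inv_on_uniq iN _; rewrite flatten_cat; apply: inv_comp.
have N2h := inv_herm thetaK hM iN2.
have S2h := schur_herm hM N2h.
have S3h := schur_herm S2h (inv_herm thetaK S2h i3).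
rewrite schur_comp; set S3 := schur _ _ in z3 S3h *.
(* Rows [E1] are already zero and stay so, the [E2] block vanishes by recursion, and Hermitian
   symmetry settles rows [E2] against columns [E1]. *)
have zE1 : dg E1 *m S3 *m dg E = 0.
  rewrite /S3 {1}/schur mulmxBr mulmxBl zX sub0r -(inv_onl i3).
  by rewrite -(dg_subr _ s3) !mulmxA zX !mul0mx oppr0.
have zE2 : dg E2 *m S3 *m dg E1 = 0.
  apply: (conjtr_dg0 thetaK S3h).
  by rewrite -(dg_subr _ sE2) mulmxA zE1 mul0mx.
have dE12 : dg E = dg E1 + dg E2 by apply: dg_cat.
rewrite {1}dE12 !mulmxDl zE1 add0r dE12 mulmxDr zE2 z3.
by rewrite addr0.
Qed.

Lemma find_pivotsP k E mem M (Mv : 'M[F]_n) :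
  conjtr Mv = Mv -> repM mem M Mv -> (size E <= 2 ^ k)%N -> uniq E ->
  runsb mem (find_pivots mm k E M) (cfind * w ^+ k) (fun g m => find_post Mv E g).
Proof.
have c0 : 0 <= cmm by apply: (mm_cost_ge0 (theta := theta) (mm := mm) (w := w)).
have w0 : 0 <= w by apply: le_trans w_ge4.
have n0 := cnopiv_ge0; have f0 := cfind_ge0.
elim: k E mem M Mv => [|k IH] E mem M Mv hMh hM sE uE.
  have h0 : 0 <= cfind * w ^+ 0 by rewrite expr0 mulr1.
  case: E sE uE => [|v [|? ?]] //= _ _.
    apply: runsb_ret => //; split=> //; first exact: reg_nil.
    by move=> N _; rewrite dg_nil !mul0mx.
  apply: (runsb_if (hM v v)) => hv; apply: runsb_ret => //.
    split=> //; first exact: reg_nil.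
    move=> N /(inv_on_uniq (inv_on_nil Mv)) <-.
    by rewrite /schur mulmx0 mul0mx subr0 dg1_mul hv scale0r.
  split=> //; first exact: reg_one (inv_on1 hv).
  by move=> N /schur_row0 /= ->; rewrite mul0mx.
have EE := cat_take_drop (2 ^ k) E.
rewrite /=; set E1 := take _ E in EE *; set E2 := drop _ E in EE *.
have s1 : (size E1 <= 2 ^ k)%N by rewrite size_take_min geq_minl.
have s2 : (size E2 <= 2 ^ k)%N by rewrite size_drop leq_subLR addnn -mul2n -expnS.
have [u1 u2] : uniq E1 /\ uniq E2 by rewrite take_uniq ?drop_uniq.
pose T := cfind * w ^+ k; pose a := cnopiv w cmm * w ^+ k; pose b := cnopiv w cmm * w ^+ k.+1.
pose g := gcost k.+1 0; pose p := cpair w cmm * 2 ^+ 0 * w ^+ k.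
apply: (runsb_bind (b2 := a + (2 * g + (p + (b + (2 * g + T))))) (IH _ _ _ _ hMh hM s1 u1)); last first.
  suff : T + (a + (2 * g + (p + (b + (2 * g + T))))) <= cfind * w ^+ k.+1 by [].
  have -> : T + (a + (2 * g + (p + (b + (2 * g + T))))) = (2 * cfind + cfind) * w ^+ k.
    by rewrite /T /a /b /g /p /gcost /cfind !exprS !expr0; ring.
  rewrite exprS mulrA ler_wpM2r ?exprn_ge0 //.
  by have : 0 <= cfind * (w - 4) by [rewrite mulr_ge0 // subr_ge0]; nra.
move=> g1 e1 f1; have {}hM := repM_ext e1 hM.
have sg1 : (size g1 <= 2 ^ k)%N.
  rewrite (leq_trans (size_le_flatten (find_size f1))) // (leq_trans _ s1) //.
  exact: uniq_leq_size (find_uniq f1) (find_sub f1).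
apply: (runsb_bind (b2 := 2 * g + (p + (b + (2 * g + T))))
  (nopivP thetaK mmP mm_cost w_ge4 hMh hM (find_reg f1) (find_uniq f1) (find_size f1) sg1)) => //.
move=> d1 e2 [[Z1 [D1 [N1 [_ _ hN1 fa1]]]] p1]; have {}hM := repM_ext e2 hM.
have i1 := fact_inv fa1; have uP1 := fact_uniq fa1.
have sP1 : (size (flatten (pd_s d1)) <= 2 ^ k.+1)%N.
  rewrite (perm_size p1) (leq_trans _ sE) // uniq_leq_size ?(find_uniq f1) //.
  by move=> i /(find_sub f1); apply: mem_take.
have sE' : (size E <= 2 ^ (k.+1 + 0))%N by rewrite addn0.
have N1h := inv_herm thetaK hMh i1.
apply: (runsb_bind (b2 := p + (b + (2 * g + T)))
  (schurcP mmP mm_cost w_ge4 sP1 sP1 sE sE' uP1 uP1 uE hN1 hM i1)) => //.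
move=> M1 e3 hM1; have {}hM := repM_ext e3 hM.
have M1E := mask_schur Mv N1 E; have M1h := mask_herm E hMh N1h.
set M1v := Mv - _ in hM1 M1E M1h.
have s2' : (size E2 <= 2 ^ (k + 0))%N by rewrite addn0.
apply: (runsb_bind (b2 := b + (2 * g + T)) (pair_luP mmP mm_cost w_gt4 s1 s2' u1 u2 hM1)) => //.
move=> u e4 [H [_ iH rH zH [uI uJ sIJ subI subJ]]]; have {}hM := repM_ext e4 hM.
have {}i1 : inv_on (flatten g1) (flatten g1) Mv N1.
  by apply: inv_on_eq i1; apply: perm_mem.
have uE' : uniq (E1 ++ E2) by rewrite EE.
have M1E' : dg (E1 ++ E2) *m M1v *m dg (E1 ++ E2) =
    dg (E1 ++ E2) *m schur Mv N1 *m dg (E1 ++ E2) by rewrite EE.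
have step M2 N2 g3 := find_post_step M2 N2 g3 hMh uE' f1 i1 M1h M1E' sIJ uI uJ subI subJ iH rH zH.
(* The arguments are dummies: the four conclusions extracted here do not mention them. *)
have [u12 a12 r12 s12 _] := step 0 0 [::].
have sg12 : (size (g1 ++ pair_blocks (lu_I u) (lu_J u)) <= 2 ^ k.+1)%N.
  rewrite (leq_trans (size_le_flatten a12)) // (leq_trans _ sE) //.
  by rewrite -EE; apply: uniq_leq_size u12 s12.
apply: (runsb_bind (b2 := 2 * g + T)
  (nopivP thetaK mmP mm_cost w_ge4 hMh hM r12 u12 a12 sg12)) => //.
move=> d2 e5 [[Z2 [D2 [N2 [_ _ hN2 fa2]]]] p2]; have {}hM := repM_ext e5 hM.
have i2 := fact_inv fa2; have uP2 := fact_uniq fa2.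
have sP2 : (size (flatten (pd_s d2)) <= 2 ^ k.+1)%N.
  rewrite (perm_size p2) (leq_trans _ sE) // -EE; exact: uniq_leq_size u12 s12.
have N2h := inv_herm thetaK hMh i2.
apply: (runsb_bind (b2 := T)
  (schurcP mmP mm_cost w_ge4 sP2 sP2 sE sE' uP2 uP2 uE hN2 hM i2)) => //.
move=> M2 e6 hM2; have {}hM := repM_ext e6 hM.
have M2E := mask_schur Mv N2 E; have M2h := mask_herm E hMh N2h.
set M2v := Mv - _ in hM2 M2E M2h.
apply: (runsb_bind (b2 := 0) (IH _ _ _ _ M2h hM2 s2 u2)); last by rewrite addr0.
move=> g3 e7 f3; apply: runsb_ret => //.
have [_ _ _ _ h] := step M2v N2 g3; rewrite -EE; apply: h; rewrite ?EE //.
by apply: inv_on_eq i2; apply: perm_mem.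
Qed.

Definition cfront : R := cfind + cnopiv w cmm + 3 * (cmm + 1).

(** As the rows [E] are supported on [V], so are the new columns of L and the update M N M. The
    masked products therefore give the full columns and the full Schur complement. *)
Lemma frontP k E V mem M (Mv : 'M[F]_n) :
  conjtr Mv = Mv -> repM mem M Mv -> uniq E -> uniq V -> {subset E <= V} ->
  (size V <= 2 ^ k)%N -> dg E *m Mv *m dg V = dg E *m Mv ->
  runsb mem (front mm k E V M) (cfront * w ^+ k) (fun d m =>
    exists Z D N, [/\ fact Mv (fr_s d) Z D N, {subset flatten (fr_s d) <= E},
      dg E *m schur Mv N *m dg E = 0 &
      [/\ repM m (fr_L d) (Mv *m Z), repM m (fr_D d) D, repM m (fr_M d) (schur Mv N),
         dg V *m (Mv *m Z) = Mv *m Z & dg V *m (Mv *m N *m Mv) *m dg V = Mv *m N *m Mv]]).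
Proof.
move=> hMh hM uE uV sEV sV hEV.
have sE : (size E <= 2 ^ k)%N by rewrite (leq_trans _ sV) // uniq_leq_size.
pose a := cnopiv w cmm * w ^+ k; pose g := gcost k 0.
apply: (runsb_bind (b2 := a + (g + 2 * g)) (find_pivotsP hMh hM sE uE)); last first.
  suff : cfind * w ^+ k + (a + (g + 2 * g)) <= cfront * w ^+ k by [].
  by rewrite /a /g /cfront /gcost expr0 [leLHS](_ : _ = cfront * w ^+ k) // /cfront; ring.
move=> p e1 f1; have {}hM := repM_ext e1 hM.
have sg : (size p <= 2 ^ k)%N.
  rewrite (leq_trans (size_le_flatten (find_size f1))) // (leq_trans _ sE) //.
  exact: uniq_leq_size (find_uniq f1) (find_sub f1).
apply: (runsb_bind (b2 := g + 2 * g)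
  (nopivP thetaK mmP mm_cost w_ge4 hMh hM (find_reg f1) (find_uniq f1) (find_size f1) sg)) => //.
move=> d e2 [[Z [D [N [hZ hD hN fa]]]] p1]; have {}hM := repM_ext e2 hM.
have iN := fact_inv fa; have uP := fact_uniq fa.
have subP : {subset flatten (pd_s d) <= E}.
  by move=> i; rewrite (perm_mem p1); apply: (find_sub f1).
have sP : (size (flatten (pd_s d)) <= 2 ^ k)%N.
  by rewrite (leq_trans _ sE) // uniq_leq_size.
have sP' : (size (flatten (pd_s d)) <= 2 ^ (k + 0))%N by rewrite addn0.
have sV' : (size V <= 2 ^ (k + 0))%N by rewrite addn0.
have hVE : dg V *m Mv *m dg E = Mv *m dg E.
  have := congr1 (@Defs.conjtr F theta n n) hEV.
  by rewrite !conjtrM !conjtr_dg hMh mulmxA.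
have PV : dg (flatten (pd_s d)) *m Mv *m dg V = dg (flatten (pd_s d)) *m Mv.
  by rewrite -(dg_subl _ subP) -!mulmxA (mulmxA (dg E)) hEV.
have VP : dg V *m Mv *m dg (flatten (pd_s d)) = Mv *m dg (flatten (pd_s d)).
  by rewrite -(dg_subr _ subP) !mulmxA hVE.
have LE : dg V *m (Mv *m Z) = Mv *m Z by rewrite -(fact_Zl fa) !mulmxA VP.
have NE : dg V *m (Mv *m N *m Mv) *m dg V = Mv *m N *m Mv.
  rewrite -{1}(inv_onl iN) !mulmxA VP -(mulmxA Mv) (inv_onl iN).
  rewrite -{1}(inv_onr iN) -!mulmxA (mulmxA (dg _)) PV !mulmxA.
  by rewrite -(mulmxA Mv N) (inv_onr iN).
apply: (runsb_bind (b2 := 2 * g)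
  (gemmP mmP mm_cost w_ge4 false sV sP sP' uP uP (repM0 _ _) hM hZ)) => //.
move=> L e3 hL; have {}hM := repM_ext e3 hM; have {}hN := repM_ext e3 hN.
have {}hD := repM_ext e3 hD.
have {}hL : repM (((mem ++ e1) ++ e2) ++ e3) L (Mv *m Z).
  move: hL; rewrite /gemm_val add0r VP -!mulmxA (mulmxA (dg _)) (fact_Z fa).
  by [].
apply: (runsb_bind (b2 := 0) (schurcP mmP mm_cost w_ge4 sP sP sV sV' uP uP uV hN hM iN));
  last by rewrite addr0.
move=> M' e4 hM'; apply: runsb_ret => //; exists Z, D, N.
split=> //=.
  by apply: (find_zero f1); apply: inv_on_eq iN; apply: perm_mem.
split=> //; try exact: repM_ext.
by rewrite NE in hM'.
Qed.


End FrontSpec.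

(** * From tree decompositions to separator trees *)

Section SepDecomposition.
Variables (V : finType) (e : rel V) (k : nat).
Implicit Types S Y : {set V}.

Definition nbr_closed Y S := forall u v, u \in Y -> e u v -> v \in Y :|: S.

(* [sdec S Y]: the vertices [Y] can be eliminated bottom-up along a tree of
   separators of size at most [k], the last one being [S], which separates [Y]
   from the rest of the graph. *)
Inductive sdec : {set V} -> {set V} -> Prop :=
  | sdec_nil S : (#|S| <= k)%N -> sdec S set0
  | sdec_join S Y1 Y2 : sdec S Y1 -> sdec S Y2 -> [disjoint Y1 & Y2] ->
      sdec S (Y1 :|: Y2)
  | sdec_move S S' Y : sdec S Y -> (#|S'| <= k)%N -> [disjoint Y & S'] ->
      nbr_closed (Y :|: (S :\: S')) S' -> sdec S' (Y :|: (S :\: S')).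

Lemma sdecP S Y : sdec S Y ->
  [/\ (#|S| <= k)%N, [disjoint Y & S] & nbr_closed Y S].
Proof.
elim=> {S Y} [S hS|S Y1 Y2 _ [h1 d1 c1] _ [_ d2 c2] _|S S' Y _ [h1 d1 c1] h2 d2 c2].
- by split=> //; [rewrite disjoints_subset sub0set|move=> u v; rewrite inE].
- split=> //; first by rewrite -setI_eq0 setIUl setU_eq0 !setI_eq0 d1 d2.
  move=> u v; rewrite inE => /orP [/c1 h /h|/c2 h /h]; rewrite !inE.
    by case/orP=> ->; rewrite ?orbT.
  by case/orP=> ->; rewrite ?orbT.
split=> //; rewrite -setI_eq0 setIUl setU_eq0 !setI_eq0 d2 disjoints_subset.
by apply/subsetP => v; rewrite !inE => /andP [].
Qed.

End SepDecomposition.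

(** * Cutting a tree decomposition branch by branch *)

Section TreeToSeparators.
Variables (V : finType) (e : rel V) (T : finType) (t : rel T) (B : T -> {set V}).
Hypothesis tdB : tree_decomposition e t B.
Variable k : nat.
Hypothesis kB : forall a, (#|B a| <= k)%N.

Let t_sym : symmetric t. Proof. by case: tdB => -[]. Qed.

(** The bags containing [v] form a connected subtree; if no edge leaving [U] has [v] in both end
    bags, this subtree cannot leave [U]. *)
Lemma bag_closed (U : {set T}) v x y :
  (forall c d, c \in U -> d \notin U -> t c d -> v \in B c -> v \in B d -> False) ->
  x \in U -> v \in B x -> v \in B y -> y \in U.
Proof.
move=> h xU vx vy; case: tdB => _ _ _ /(_ v x y vx vy).
move/(closed_connect (a := mem U)) => <- // c d /= /and3P [tcd vc vd].
apply/idP/idP => hU; apply: contraT => nU; exfalso; first exact: (h c d).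
by apply: (h d c) => //; rewrite t_sym.
Qed.

(** These are the unions of branches at [a] that the induction cuts up: only the root [a] may have
    links to the outside. *)
Definition pendant (a : T) (U : {set T}) :=
  forall x y, x \in U -> x != a -> t x y -> y \in U.

(** Induction on the size of [U]: a neighbour [c] of [a] splits off the branch [U1] behind it, which
    is treated with separator [B c], moved to [B a] and joined with the rest. *)
Lemma sdec_pendant (a : T) (U : {set T}) : a \in U -> pendant a U ->
  sdec e k (B a) ((\bigcup_(x in U) B x) :\: B a).
Proof.
have [m] := ubnP #|U|; elim: m a U => // m IH a U; rewrite ltnS => Um aU pU.
have [[_ _ _ conn acyc] _ cov _] := tdB.
have [c0 /andP [c0U c0a]|U1] := pickP [pred c | (c \in U) && (c != a)]; last first.
  have -> : U = [set a].
    apply/setP=> x; rewrite inE; have := U1 x; rewrite /=.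
    by case: eqVneq => [->|]; rewrite ?andbT.
  by rewrite big_set1 setDv; apply: sdec_nil.
have [c /and3P [cU ca tca]|noc] := pickP [pred c | [&& c \in U, c != a & t c a]]; last first.
  (* Without a neighbour of [a] in [U], the rest of [U] would be closed under tree edges, against
     connectedness. *)
  have cl : closed t (mem (U :\ a)).
    move=> x y /= txy; apply/idP/idP; rewrite !inE => /andP [xa xU].
      rewrite (pU x y) // andbT; apply: contraT => /negPn /eqP ya.
      by have := noc x; rewrite /= xU xa -ya txy.
    rewrite t_sym in txy; rewrite (pU y x) // andbT; apply: contraT => /negPn /eqP ya.
    by have := noc y; rewrite /= xU xa -ya txy.
  by have := closed_connect cl (conn c0 a); rewrite !inE eqxx c0U c0a.
pose r := [rel x y | [&& t x y, x != a & y != a]].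
have r_sym : symmetric r by move=> x y /=; rewrite t_sym [(y != a) && _]andbC.
pose U1 := [set x | connect r c x].
have cU1 : c \in U1 by rewrite inE.
have U1a x : x \in U1 -> x != a.
  rewrite inE => /(closed_connect (a := mem [set~ a])); rewrite !inE ca => <- // y z.
  by rewrite /= !inE => /and3P [_ -> ->].
have U1r x y : x \in U1 -> t x y -> y != a -> y \in U1.
  move=> x1 txy ya; move: (x1); rewrite !inE => h; apply: connect_trans h (connect1 _).
  by rewrite /= txy U1a.
have U1U x : x \in U1 -> x \in U.
  rewrite inE => /(closed_connect (a := mem U)); rewrite cU => <- // y z.
  by case/and3P=> tyz ya za; apply/idP/idP => h; [apply: pU tyz|apply: (pU z)];
    rewrite // t_sym.
have aU1 : a \notin U1 by apply/negP => /U1a; rewrite eqxx.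
(* A second edge from [U1] back to [a] would close a cycle through [a], [c] and [x]. *)
have U1x x : x \in U1 -> t x a -> x = c.
  move=> x1 txa; apply/eqP; apply: contraT => xc; exfalso.
  move: (x1); rewrite inE => /connectP [p0 hp0 hx].
  case: (shortenP hp0) hx => p hp up _ hx.
  have pt : path t c p by apply: sub_path hp => u v /and3P [].
  have pn : p != [::] by apply: contraNneq xc => p0'; rewrite hx p0'.
  have := acyc (a :: c :: p); rewrite /= !ltnS lt0n size_eq0 pn => /(_ isT)/negP; apply.
  rewrite /ucycleb /= t_sym tca rcons_path pt -hx txa /=.
  apply/andP; split; last exact: up.
  apply/negP => ap.
  suff /allP /(_ a ap) : all [pred z | z != a] (c :: p) by rewrite /= eqxx.
  rewrite /= ca /=; apply/allP => z zp /=.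
  apply: U1a; rewrite inE; apply: (path_connect hp); by rewrite inE zp orbT.
have exitU1 x y : x \in U1 -> y \notin U1 -> t x y -> x = c /\ y = a.
  move=> x1 y1 txy; have ya : y = a.
    by apply/eqP; apply: contraT => /(U1r _ _ x1 txy); rewrite (negbTE y1).
  by split=> //; apply: U1x => //; rewrite -ya.
pose U2 := U :\: U1.
have p1 : pendant c U1.
  move=> x y x1 xc txy; apply: contraT => y1.
  by have [xc' _] := exitU1 _ _ x1 y1 txy; rewrite xc' eqxx in xc.
have p2 : pendant a U2.
  move=> x y; rewrite !inE => /andP [x1 xU] xa txy.
  rewrite (pU x y) // andbT; apply: contra x1 => y1.
  have := U1r y x; rewrite !inE; apply=> //; by rewrite t_sym.
have d1 := IH c U1 _ cU1 p1; have d2 := IH a U2 _ _ p2.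
have {}d1 : sdec e k (B c) (\bigcup_(x in U1) B x :\: B c).
  apply: d1; apply: leq_trans Um; apply: proper_card; apply/properP.
  by split; [apply/subsetP|exists a].
have {}d2 : sdec e k (B a) (\bigcup_(x in U2) B x :\: B a).
  apply: d2; last by rewrite inE aU1.
  apply: leq_trans Um; apply: proper_card; apply/properP.
  by split; [apply/subsetP=> x; rewrite inE => /andP []|exists c; rewrite // inE cU1].
(* The edge between [c] and [a] is the only exit from [U1], so a vertex with bags on both sides lies
   in both end bags. *)
have sep v x y : x \in U1 -> y \notin U1 -> v \in B x -> v \in B y ->
    (v \in B c) && (v \in B a).
  move=> x1 y1 vx vy; apply: contraT => nv.
  suff : y \in U1 by rewrite (negbTE y1).
  apply: (bag_closed _ x1 vx vy) => u z u1 z1 tuz vu vz.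
  by have [E1 E2] := exitU1 _ _ u1 z1 tuz; rewrite -E1 -E2 vu vz in nv.
have E1 : \bigcup_(x in U1) B x :\: B a =
    (\bigcup_(x in U1) B x :\: B c) :|: (B c :\: B a).
  apply/setP=> v; rewrite !inE; have [va|va] := boolP (v \in B a); rewrite /= ?andbF ?orbF.
    apply/esym/negP => /andP [vc /bigcupP [x x1 vx]].
    by have := sep v x a x1 aU1 vx va; rewrite (negbTE vc).
  have [vc|vc] := boolP (v \in B c); rewrite /= ?orbF //.
  by apply/bigcupP; exists c.
have -> : \bigcup_(x in U) B x :\: B a =
    (\bigcup_(x in U1) B x :\: B a) :|: (\bigcup_(x in U2) B x :\: B a).
  have -> : U = U1 :|: U2.
    by apply/setP=> x; rewrite !inE; case: (boolP (connect r c x)) => //= h; apply: U1U; rewrite inE.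
  by rewrite bigcup_setU setDUl.
apply: sdec_join => //.
  rewrite E1; apply: sdec_move => //.
    rewrite disjoints_subset; apply/subsetP=> v; rewrite !inE => /andP [vc /bigcupP [x x1 vx]].
    by apply: contra vc => va; case/andP: (sep v x a x1 aU1 vx va).
  rewrite -E1 => u v; rewrite !inE => /andP [ua /bigcupP [x x1 ux]] /cov [b /andP [ub vb]].
  have b1 : b \in U1.
    by apply: contraT => b1; have := sep u x b x1 b1 ux ub; rewrite (negbTE ua) andbF.
  by have [|_] := boolP (v \in B a); rewrite ?orbT // orbF /=; apply/bigcupP; exists b.
rewrite disjoints_subset; apply/subsetP=> v; rewrite !inE => /andP [va /bigcupP [x x1 vx]].
rewrite va /=; apply/negP => /bigcupP [y]; rewrite inE => /andP [y1 _] vy.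
by have := sep v x y x1 y1 vx vy; rewrite (negbTE va) andbF.
Qed.

Lemma sdec_of_tree_decomposition : sdec e k set0 setT.
Proof.
have [[/card_gt0P [a _] _ _ _ _] cov _ _] := tdB.
have h : sdec e k (B a) ((\bigcup_(x in [set: T]) B x) :\: B a).
  by apply: sdec_pendant; rewrite ?inE // => x y; rewrite !inE.
(* Moving to the empty separator puts the root bag itself among the eliminated vertices. *)
have E : (\bigcup_(x in [set: T]) B x :\: B a) :|: (B a :\: set0) = setT.
  apply/setP=> v; rewrite !inE; case: (v \in B a) => //=; rewrite orbF.
  by have [b vb] := cov v; apply/bigcupP; exists b; rewrite ?inE.
rewrite -E; apply: sdec_move h _ _ _; rewrite ?cards0 //.
  by rewrite disjoints_subset setC0 subsetT.
by rewrite E => u v; rewrite !inE.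
Qed.

End TreeToSeparators.

(** * Elimination along a separator tree *)

Section StageProgram.
Variables (F : fieldType) (I : Type) (n : nat) (mm : forall q, mm_program F q).
Local Notation opmx := (opmx F I n).
Local Notation state := (front_data F I n).

Definition stage (st : state) (E S : {set 'I_n}) : builder F I state :=
  let! d := front mm (up_log 2 #|E :|: S|) (enum E) (enum (E :|: S)) (fr_M st) in
  let P := flatten (fr_s d) in
  cret (FrontData (fr_s st ++ fr_s d) (bycol P (fr_L d) (fr_L st))
          (bycol P (fr_D d) (fr_D st)) (fr_M d)).

Definition pset (st : state) : {set 'I_n} := [set v in flatten (fr_s st)].

(* [sp_pend]: vertices waiting for the next stage; [sp_delay]: vertices left
   over from the last stage; [sp_open]: number of stages whose left-over
   vertices are still waiting. *)
Record sparse_out := SparseOut {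
  sp_st : state;
  sp_pend : {set 'I_n};
  sp_delay : {set 'I_n};
  sp_open : nat
}.

Definition settle (tau : nat) (S : {set 'I_n}) (o : sparse_out) : builder F I sparse_out :=
  if (1 < sp_open o)%N || (tau <= #|sp_pend o|)%N then
    let E := sp_pend o :|: sp_delay o in
    let! st := stage (sp_st o) E S in
    cret (SparseOut st set0 (E :\: pset st) 1)
  else cret o.

End StageProgram.

Section StageSpec.
Variables (F : fieldType) (theta : {rmorphism F -> F}).
Hypothesis thetaK : involutive theta.
Variables (I : Type) (n : nat).
Variables (mm : forall q, mm_program F q) (R : realType) (w cmm : R).
Hypothesis mmP : forall q (X Y : 'M[F]_q),
  mx_result theta (mm_input X Y) (mm q) (leaf theta (mm_input X Y) (mm q)) = X *m Y.
Hypothesis mm_cost : forall j (X Y : 'M[F]_(2 ^ j)),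
  (cost theta (mm_input X Y) (mm (2 ^ j)))%:R <= cmm * w ^+ j.
Hypothesis w_gt4 : 4 < w.

Local Notation opmx := (opmx F I n).
Local Notation dg := (@dg F n).
Local Notation runs := (runs theta).
Local Notation runsb := (runsb theta).
Local Notation conjtr := (conjtr theta).
Local Notation fact := (fact theta).
Local Notation state := (front_data F I n).
Local Notation sparse_out := (sparse_out F I n).
Implicit Types (A Mv : 'M[F]_n) (st : state) (Y S Q : {set 'I_n}).

Definition stinv x A mem st Mv := exists Z D N,
  [/\ fact A (fr_s st) Z D N, repM x mem (fr_L st) (A *m Z),
      repM x mem (fr_D st) D, repM x mem (fr_M st) Mv & Mv = schur A N].

Lemma cfront_ge0 : 0 <= cfront w cmm.
Proof.
have c0 : 0 <= cmm by apply: (mm_cost_ge0 (theta := theta) (mm := mm) (w := w)).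
apply: addr_ge0; last by rewrite mulr_ge0 ?addr_ge0.
by apply: addr_ge0; [exact: (cfind_ge0 mm_cost w_gt4)|exact: (cnopiv_ge0 mm_cost w_gt4)].
Qed.

Lemma stinv_herm x A mem st Mv : conjtr A = A -> stinv x A mem st Mv -> conjtr Mv = Mv.
Proof.
move=> hA [Z [D [N [h1 _ _ _ ->]]]]; apply: schur_herm => //.
exact: inv_herm (fact_inv h1).
Qed.

Lemma stinv_row0 x A mem st Mv i j : stinv x A mem st Mv -> i \in pset st -> Mv i j = 0.
Proof.
move=> [Z [D [N [h1 _ _ _ ->]]]]; rewrite inE => hi.
exact: dg_row0 (schur_row0 (fact_inv h1)) hi.
Qed.

Lemma stinv_col0 x A mem st Mv i j : stinv x A mem st Mv -> j \in pset st -> Mv i j = 0.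
Proof.
move=> [Z [D [N [h1 _ _ _ ->]]]]; rewrite inE => hj.
have /matrixP/(_ i j) := schur_col0 (fact_inv h1).
by rewrite mul_rdgE hj => ->; rewrite mxE.
Qed.

Section Core.
Variables (e : rel 'I_n) (x : I -> F) (A : 'M[F]_n) (hA : conjtr A = A).
Variables (st0 : state) (Mv0 : 'M[F]_n) (Y S : {set 'I_n}).

(** Everything is relative to the state [st0] in which the subtree [Y] was entered: [Q] is pending,
    [D] delayed, the rest of [Y] eliminated. Rows outside [Y] and [S] are untouched, which keeps
    sibling subtrees independent. *)
Record core mem st Q (D : {set 'I_n}) Mv : Prop := Core {
  core_inv : stinv x A mem st Mv;
  core_pset : pset st = pset st0 :|: (Y :\: (Q :|: D));
  core_sub : Q :|: D \subset Y;
  core_dis : [disjoint Q & D];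
  core_out : forall i j, i \notin Y :|: S -> Mv i j = Mv0 i j
}.

Record ready : Prop := Ready {
  ready_dis : [disjoint Y & pset st0];
  ready_herm : conjtr Mv0 = Mv0;
  ready_pat : forall i j, i \in Y -> i != j -> Mv0 i j != 0 -> e i j;
  ready_nbr : nbr_closed e Y S;
  ready_sep : [disjoint Y & S]
}.

(** Fill-in is confined: eliminated columns vanish, and outside [Y] and [S] the entry is still the
    initial one, where a nonzero would be an edge leaving [Y] past its separator. *)
Lemma core_rows mem st Q D Mv i j : ready -> core mem st Q D Mv ->
  i \in Q :|: D -> j \notin (Q :|: D) :|: S -> Mv i j = 0.
Proof.
move=> r c hi; rewrite inE negb_or => /andP [hj hjS].
have iY : i \in Y := subsetP (core_sub c) _ hi.
have Mh := stinv_herm hA (core_inv c).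
have [jY|jY] := boolP (j \in Y).
  apply: (stinv_col0 i (core_inv c)); rewrite (core_pset c) inE; apply/orP; right.
  by rewrite inE hj.
rewrite -(herm_entry i j Mh) (core_out c); last by rewrite inE negb_or jY.
rewrite (herm_entry i j (ready_herm r)); apply/eqP; apply: contraT => h.
have ij : i != j by apply: contraNneq jY => <-.
have := ready_nbr r iY (ready_pat r iY ij h); rewrite inE (negbTE jY) (negbTE hjS) //.
Qed.

Definition stage_cost (b : nat) : R := cfront w cmm * w ^+ up_log 2 b.

(** The dense stage leaves a zero block on the left-over vertices, and [core_rows] excludes all
    columns outside the stage and [S]. Their rows are thus supported on [S] alone, as [delay_bound]
    requires. *)
Lemma stageP mem st Q D Mv b : ready -> core mem st Q D Mv ->
  (#|(Q :|: D) :|: S| <= b)%N ->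
  runsb x mem (stage mm st (Q :|: D) S) (stage_cost b) (fun st' m' => exists M',
    let D' := (Q :|: D) :\: pset st' in
    [/\ core m' st' set0 D' M', forall i j, i \in D' -> j \in D' -> M' i j = 0 &
        forall i j, i \in D' -> j \notin S -> M' i j = 0]).
Proof.
move=> r c; have [E EE] : {E | E = Q :|: D} by exists (Q :|: D).
have cr i j := core_rows (i := i) (j := j) r c; have cs := core_sub c.
have cp := core_pset c; rewrite -EE in cs cp *; rewrite -{}EE in cr => hb.
have w_ge4 := ltW w_gt4.
have w0 : 0 <= w by apply: le_trans w_ge4.
have [Z [Dv [N [f1 hL hD hM Me]]]] := core_inv c.
have Mh := stinv_herm hA (core_inv c).
have sEV : {subset enum E <= enum (E :|: S)}.
  by move=> i; rewrite !mem_enum => h; apply/setUP; left.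
have sV : (size (enum (E :|: S)) <= 2 ^ up_log 2 #|E :|: S|)%N.
  by rewrite -cardE up_logP.
have hEV : dg (enum E) *m Mv *m dg (enum (E :|: S)) = dg (enum E) *m Mv.
  apply/matrixP=> i j; rewrite mul_rdgE mem_enum mul_dgE mem_enum.
  case: ifP => // /negbT hj; case: ifP => // hi.
  by rewrite cr.
apply: (runsb_bind (b2 := 0) (frontP thetaK mmP mm_cost w_gt4 Mh hM (enum_uniq _) (enum_uniq _) sEV sV hEV));
  last first.
  rewrite addr0 /stage_cost ler_wpM2l ?cfront_ge0 //.
  apply: ler_weXn2l; first by apply: le_trans w_ge4; rewrite ler1n.
  exact: leq_up_log.
move=> d m1 [Z2 [D2 [N2 [f2 sP z2 [hL2 hD2 hM2 hLV hMV]]]]].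
apply: runsb_ret => //; exists (schur Mv N2).
have i2 := fact_inv f2.
rewrite {1}Me in f2.
have fc := fact_comp thetaK hA f1 f2.
set st' := FrontData _ _ _ _.
have sPE v : v \in flatten (fr_s d) -> v \in E by move/sP; rewrite mem_enum.
have psE : pset st' = pset st :|: [set v in flatten (fr_s d)].
  by apply/setP=> v; rewrite !inE /= flatten_cat mem_cat.
have dj : {in flatten (fr_s st), forall i, i \notin flatten (fr_s d)}.
  exact: inv_on_rows (schur_row0 (fact_inv f1)) (fact_inv f2).
have hst : stinv x A (mem ++ m1) st' (schur Mv N2).
  exists (Z + (Z2 - N *m A *m Z2)), (Dv + D2), (comp_inv A N N2); split=> //=.
  - have -> : A *m (Z + (Z2 - N *m A *m Z2)) = Mv *m Z2 + A *m Z.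
      by rewrite Me mulmxDr mulmxBr /schur mulmxBl !mulmxA addrC.
    apply: repM_bycol hL2 (repM_ext _ hL); first by rewrite -mulmxA (fact_Zr f2).
    by rewrite -(fact_Zr f1) -!mulmxA (dg_disj _ dj) !mulmx0.
  - rewrite addrC; apply: repM_bycol hD2 (repM_ext _ hD).
      apply: (can_inj (@conjtrK _ _ thetaK n n)).
      by rewrite conjtrM conjtr_dg (fact_Dh f2) (fact_D0l f2).
    apply: (can_inj (@conjtrK _ _ thetaK n n)).
    rewrite conjtrM conjtr_dg (fact_Dh f1) conjtr0 -(fact_D0l f1) mulmxA.
    by rewrite (dg_disjC _ dj) mul0mx.
  - by rewrite schur_comp Me.
have c' : core (mem ++ m1) st' set0 (E :\: pset st') (schur Mv N2).
  split=> //.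
  - rewrite psE cp set0U; apply/setP=> v; rewrite !inE.
    have hv := subsetP cs v.
    have := @sPE v; case: (v \in flatten (fr_s d)) => // [/(_ isT) vE|_].
      by rewrite vE hv // !orbT.
    rewrite !orbF; have [vY|] := boolP (v \in Y); rewrite ?andbF ?orbF // !andbT.
    have v0 : (v \in flatten (fr_s st0)) = false.
      have := ready_dis r; rewrite disjoints_subset => /subsetP/(_ v vY).
      by rewrite !inE => /negbTE.
    by rewrite v0 /=; case: (v \in E).
  - by rewrite set0U (subset_trans _ cs) // subsetDl.
  - by rewrite disjoints_subset sub0set.
  move=> i j hi; rewrite -(core_out c j hi) /schur mxE.
  have -> : (- (Mv *m N2 *m Mv)) i j = 0; last by rewrite addr0.
  rewrite mxE -hMV -mulmxA mul_dgE mem_enum ifF ?oppr0 //.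
  apply: contraNF hi; rewrite !inE => /orP [h|->]; last by rewrite orbT.
  by rewrite (subsetP cs i h).
have z i j : i \in E :\: pset st' -> j \in E :\: pset st' -> schur Mv N2 i j = 0.
  rewrite !inE => /andP [_ hi] /andP [_ hj].
  have /matrixP/(_ i j) := z2; rewrite mul_rdgE mul_dgE !mem_enum hi hj.
  by move=> ->; rewrite mxE.
split=> // i j hi hj.
have [hj'|hj'] := boolP (j \in E :\: pset st'); first exact: z.
by apply: core_rows r c' _ _; rewrite set0U // inE negb_or hj'.
Qed.

End Core.

End StageSpec.

(** * Counting left-over vertices and stages *)

Section Sparse.
Variables (F : fieldType) (theta : {rmorphism F -> F}).
Hypothesis thetaK : involutive theta.
Variables (I : Type) (n : nat).
Variables (mm : forall q, mm_program F q) (R : realType) (w cmm : R).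
Hypothesis mmP : forall q (X Y : 'M[F]_q),
  mx_result theta (mm_input X Y) (mm q) (leaf theta (mm_input X Y) (mm q)) = X *m Y.
Hypothesis mm_cost : forall j (X Y : 'M[F]_(2 ^ j)),
  (cost theta (mm_input X Y) (mm (2 ^ j)))%:R <= cmm * w ^+ j.
Hypothesis w_gt4 : 4 < w.

Local Notation opmx := (opmx F I n).
Local Notation dg := (@dg F n).
Local Notation runs := (runs theta).
Local Notation runsb := (runsb theta).
Local Notation conjtr := (conjtr theta).
Local Notation fact := (fact theta).
Local Notation state := (front_data F I n).
Local Notation sparse_out := (sparse_out F I n).
Implicit Types (A Mv : 'M[F]_n) (st : state) (Y S Q : {set 'I_n}).

Local Notation stinv := (stinv theta).
Local Notation core := (core theta).
Local Notation ready := (ready theta).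
Local Notation stage_cost := (stage_cost w cmm).

Lemma card_seqset (s : seq 'I_n) : uniq s -> #|[set v in s]| = size s.
Proof. by move=> us; rewrite cardsE; apply/card_uniqP. Qed.

(* The rows [D] of the Schur complement have rank at most [#|So|], so all but
   [#|So|] of them contribute to the corank of [A]. *)
Lemma delay_bound x A mem st Mv (D So : {set 'I_n}) delta :
  stinv x A mem st Mv -> [disjoint D & pset st] ->
  (forall i j, i \in D -> j \notin So -> Mv i j = 0) ->
  (n <= \rank A + delta)%N -> (#|D| <= #|So| + delta)%N.
Proof.
move=> [Z [Dv [N [f _ _ _ Me]]]] dD z hn.
have rA := rank_schur (fact_inv f); rewrite -Me in rA.
have rM : (\rank Mv <= #|So| + #|~: (D :|: pset st)|)%N.
  (* Rows in [D] live on the columns [So] and pivot rows vanish; the remaining rows are counted one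
     by one. *)
  have E : Mv = dg (enum D) *m Mv *m dg (enum So) + dg (enum (~: (D :|: pset st))) *m Mv.
    apply/matrixP=> i j; rewrite mxE mul_rdgE !mul_dgE !mem_enum !in_setC !in_setU.
    have [hD|hD] := boolP (i \in D); rewrite /= ?addr0.
      by case: ifP => // /negbT; apply: z.
    rewrite if_same add0r; have [hp|//] := boolP (i \in pset st).
    rewrite Me (dg_row0 j (schur_row0 (fact_inv f))) //.
    by move: hp; rewrite inE.
  rewrite {1}E (leq_trans (mxrank_add _ _)) // leq_add //.
    by rewrite (leq_trans (mxrankM_maxr _ _)) // (leq_trans (mxrank_dg _ _)) // -cardE.
  by rewrite (leq_trans (mxrankM_maxl _ _)) // (leq_trans (mxrank_dg _ _)) // -cardE.
have cP : #|pset st| = size (flatten (fr_s st)) by apply: card_seqset (fact_uniq f).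
have cC := cardsC (D :|: pset st); rewrite card_ord in cC.
have cU : #|D :|: pset st| = (#|D| + #|pset st|)%N.
  by rewrite cardsU; move: dD; rewrite -setI_eq0 => /eqP ->; rewrite cards0 subn0.
move: rA rM hn cC; rewrite -cP cU; clear; lia.
Qed.

Section Recursion.
Variables (e : rel 'I_n) (tau : nat) (tau_gt0 : (0 < tau)%N).

(** [So] is the separator of the stage that left [D] over, in general no longer the current one. *)
Definition delayed (D : {set 'I_n}) Mv :=
  exists2 So : {set 'I_n}, (#|So| <= tau.+1)%N &
    forall i j, i \in D -> j \notin So -> Mv i j = 0.

(* Potential argument: a stage is paid either by [tau] pending vertices or by
   closing one of two open stages. *)
Definition sparse_post x A st0 Mv0 Y S (K : R) (o : sparse_out) mem (t : nat) : Prop :=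
  exists Mv, [/\ core x A st0 Mv0 Y S mem (sp_st o) (sp_pend o) (sp_delay o) Mv,
    (#|sp_pend o| < tau)%N, (sp_open o <= 1)%N,
    delayed (sp_delay o) Mv /\ (sp_open o = 0%N -> sp_delay o = set0) &
    t%:R + K * (sp_open o)%:R <= 2 * K / tau%:R * (#|Y|%:R - #|sp_pend o|%:R)].

Lemma settleP x A st0 Mv0 Y S mem o Mv b t0 :
  let K := stage_cost b in
  conjtr A = A -> ready e st0 Mv0 Y S ->
  core x A st0 Mv0 Y S mem (sp_st o) (sp_pend o) (sp_delay o) Mv ->
  ((sp_open o <= 1)%N -> delayed (sp_delay o) Mv) -> 
  (sp_open o = 0%N -> sp_delay o = set0) ->
  (#|(sp_pend o :|: sp_delay o) :|: S| <= b)%N -> (#|S| <= tau.+1)%N ->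
  t0%:R + K * (sp_open o)%:R <= 2 * K / tau%:R * (#|Y|%:R - #|sp_pend o|%:R) ->
  runs x mem (settle mm tau S o) (fun o' m t =>
    sparse_post x A st0 Mv0 Y S K o' m (t0 + t)).
Proof.
move=> K hA r c hdel hD0 hb hS ht.
have w_ge4 := ltW w_gt4; have w0 : 0 <= w by apply: le_trans w_ge4.
have K0 : 0 <= K by rewrite mulr_ge0 ?exprn_ge0 ?(cfront_ge0 mm_cost).
have T0 : 0 < tau%:R :> R by rewrite ltr0n.
have phi0 : 0 <= 2 * K / tau%:R.
  by apply: divr_ge0; [apply: mulr_ge0|apply: ltW].
rewrite /settle; case: ifPn => [hc|].
  apply: (runs_bind (stageP thetaK mmP mm_cost w_gt4 hA r c hb)).
  move=> st1 m1 t1 [ht1 [M1 [c1 _ z1]]]; apply: runs_ret; exists M1.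
  have {}ht1 : t1%:R <= K by [].
  split=> //; first by rewrite cards0.
    by split=> //; exists S.
  rewrite addn0 natrD /= cards0 subr0 mulr1.
  have phiQ : 2 * K / tau%:R * tau%:R = 2 * K by rewrite divfK // gt_eqF.
  case/orP: hc => hc.
    (* Two open stages hold [2 * K] in reserve: one [K] pays this stage, the other becomes its own
       reserve. *)
    have h2 : K * 2 <= K * (sp_open o)%:R by rewrite ler_wpM2l // ler_nat.
    have : 0 <= 2 * K / tau%:R * #|sp_pend o|%:R by rewrite mulr_ge0.
    move: ht; rewrite mulrBr; move: (2 * K / tau%:R * _) => u.
    move: (2 * K / tau%:R * _) => v; lra.
  (* Here [tau] pending vertices release [2 * K], for the stage and its reserve. *)
  have : 2 * K <= 2 * K / tau%:R * #|sp_pend o|%:R.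
    by rewrite -{1}phiQ ler_wpM2l // ler_nat.
  have : 0 <= K * (sp_open o)%:R by rewrite mulr_ge0.
  move: ht; rewrite mulrBr; move: (2 * K / tau%:R * _) => u.
  move: (2 * K / tau%:R * _) => v; move: (K * _) => y; lra.
rewrite negb_or -leqNgt -ltnNge => /andP [h1 h2].
apply: runs_ret; exists Mv; rewrite addn0; split=> //; split=> //.
exact: hdel.
Qed.

(** The builder is fixed before [A] and [delta]: it depends on the separator tree, the entries of
    [A] acting only through zero tests, and [delta] occurs only in the cost. *)
Lemma sparse_elim S Y : sdec e tau.+1 S Y -> exists p : state -> builder F I sparse_out,
  forall x A delta mem st Mv, conjtr A = A -> (n <= \rank A + delta)%N ->
    stinv x A mem st Mv -> ready e st Mv Y S ->
    runs x mem (p st) (sparse_post x A st Mv Y S (stage_cost (8 * tau + 2 * delta))).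
Proof.
elim=> {S Y} [S hS|S Y1 Y2 s1 [p1 IH1] s2 [p2 IH2] d12|S S' Y s1 [p1 IH1] hS' dS nbr].
- exists (fun st => cret (SparseOut st set0 set0 0)) => x A delta mem st Mv hA hn hi r.
  apply: runs_ret; exists Mv; split=> //=.
  + split=> //; rewrite ?set0U ?sub0set ?disjoints_subset ?sub0set //.
    by rewrite setD0 setU0.
  + by rewrite cards0.
  + split=> //; exists set0; first by rewrite cards0.
    by move=> i j; rewrite inE.
  by rewrite cards0 subrr !mulr0 addr0.
- exists (fun st => let! o1 := p1 st in let! o2 := p2 (sp_st o1) in
    settle mm tau S (SparseOut (sp_st o2) (sp_pend o1 :|: sp_pend o2)
      (sp_delay o1 :|: sp_delay o2) (sp_open o1 + sp_open o2))).
  move=> x A delta mem st Mv hA hn hi r.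
  have [hS dS1 n1] := sdecP s1; have [_ dS2 n2] := sdecP s2.
  have r1 : ready e st Mv Y1 S.
    split=> //; last by move=> i j iY; apply: (ready_pat r); rewrite inE iY.
      by apply: disjointWl (ready_dis r); apply: subsetUl.
    exact: ready_herm r.
  apply: (runs_bind (IH1 _ _ _ _ _ _ hA hn hi r1)).
  move=> o1 m1 t1 [M1 [c1 q1 op1 [[So1 hSo1 z1] D01] t1P]].
  (* The first subtree alters only rows of [Y1] and [S], so the second one starts from the original
     rows of [Y2]. *)
  have out1 i j : i \in Y2 -> M1 i j = Mv i j.
    move=> iY; apply: (core_out c1); rewrite inE negb_or.
    by rewrite (disjointFl d12 iY) (disjointFr dS2 iY).
  have r2 : ready e (sp_st o1) M1 Y2 S.
    split=> //.
    - rewrite (core_pset c1) disjoints_subset; apply/subsetP=> v vY.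
      rewrite !inE (disjointFl d12 vY) andbF orbF.
      have := disjointFr (ready_dis r) (x := v); rewrite !inE => -> //.
      by rewrite vY orbT.
    - exact: stinv_herm hA (core_inv c1).
    move=> i j iY ij; rewrite out1 //; apply: (ready_pat r) => //.
    by rewrite inE iY orbT.
  apply: (runs_bind (IH2 _ _ _ _ _ _ hA hn (core_inv c1) r2)).
  move=> o2 m2 t2 [M2 [c2 q2 op2 [[So2 hSo2 z2] D02] t2P]].
  have out2 i j : i \in Y1 -> M2 i j = M1 i j.
    move=> iY; apply: (core_out c2); rewrite inE negb_or.
    by rewrite (disjointFr d12 iY) (disjointFr dS1 iY).
  have E1 := core_sub c1; have E2 := core_sub c2.
  have sD1 i : i \in sp_delay o1 -> i \in Y1.
    by move=> h; apply: (subsetP E1); rewrite inE h orbT.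
  have sD2 i : i \in sp_delay o2 -> i \in Y2.
    by move=> h; apply: (subsetP E2); rewrite inE h orbT.
  have dd (st1 : state) (Mv1 M : 'M[F]_n) Y o m (ri : ready e st1 Mv1 Y S)
      (ci : core x A st1 Mv1 Y S m (sp_st o) (sp_pend o) (sp_delay o) M) :
      [disjoint sp_delay o & pset (sp_st o)].
    rewrite (core_pset ci) disjoints_subset; apply/subsetP=> v vD.
    have vY : v \in Y by apply: (subsetP (core_sub ci)); rewrite inE vD orbT.
    rewrite !inE vD orbT /= orbF.
    by have := disjointFr (ready_dis ri) vY; rewrite inE => ->.
  have b1 := delay_bound (core_inv c1) (dd _ _ _ _ _ _ r1 c1) z1 hn.
  have b2 := delay_bound (core_inv c2) (dd _ _ _ _ _ _ r2 c2) z2 hn.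
  apply: runs_weaken (settleP (o := SparseOut _ _ _ _) (t0 := (t1 + t2)%N) (Mv := M2)
    (b := 8 * tau + 2 * delta) hA r _ _ _ _ hS _) _ => /=.
  + split=> //=.
    * exact: core_inv c2.
    * rewrite (core_pset c2) (core_pset c1); apply/setP=> v.
      have := subsetP E1 v; have := subsetP E2 v; rewrite !inE.
      have := disjointFr d12 (x := v).
      case: (v \in Y1); case: (v \in Y2) => //= h; rewrite ?(h isT) //;
      case: (v \in sp_pend o1); case: (v \in sp_pend o2);
      case: (v \in sp_delay o1); case: (v \in sp_delay o2) => //= h1 h2;
      rewrite ?orbT ?orbF //; by [have := h1 isT|have := h2 isT|have := h isT].
    * apply/subsetP=> v; have := subsetP E1 v; have := subsetP E2 v; rewrite !inE.
      by case: (v \in Y1); case: (v \in Y2) => //=;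
      case: (v \in sp_pend o1); case: (v \in sp_pend o2);
      case: (v \in sp_delay o1); case: (v \in sp_delay o2) => //= h1 h2; 
      by [have := h1 isT|have := h2 isT].
    * rewrite disjoints_subset; apply/subsetP=> v.
      have := subsetP E1 v; have := subsetP E2 v; rewrite !inE.
      have := disjointFr d12 (x := v).
      have := disjointFr (core_dis c1) (x := v); have := disjointFr (core_dis c2) (x := v).
      case: (v \in Y1); case: (v \in Y2);
      case: (v \in sp_pend o1); case: (v \in sp_pend o2);
      case: (v \in sp_delay o1); case: (v \in sp_delay o2) => //= h1 h2 h3 h4 h5 _;
      by [have := h1 isT|have := h2 isT|have := h3 isT|have := h4 isT|have := h5 isT].
    move=> i j; rewrite !inE !negb_or => /andP [/andP [i1 i2] i3].
    rewrite (core_out c2) ?inE ?negb_or ?i2 //.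
    by rewrite (core_out c1) // inE negb_or i1.
  (* With at most one open stage in total, one delayed set is empty and the support of the other
     serves. *)
  + move=> h; case E : (sp_open o1) => [|k].
      exists So2 => // i j; rewrite (D01 E) inE in_set0 /=; exact: z2.
    have E0 : sp_open o2 = 0%N by move: h; rewrite E addSn ltnS leqn0 addn_eq0 => /andP [_ /eqP].
    exists So1 => // i j; rewrite (D02 E0) inE in_set0 orbF => hi1 hj.
    by rewrite out2 ?z1 // sD1.
  + by move=> /eqP; rewrite addn_eq0 => /andP [/eqP /D01 -> /eqP /D02 ->]; rewrite setU0.
  (* Each side has fewer than [tau] pending and at most [tau + 1 + delta] delayed vertices, and [S]
     has at most [tau + 1]: together at most [5 * tau + 1 + 2 * delta], covered by
     [8 * tau + 2 * delta] as [tau] is positive. *)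
  + have := (leq_card_setU (sp_pend o1 :|: sp_pend o2 :|: (sp_delay o1 :|: sp_delay o2)) S).1.
    have := (leq_card_setU (sp_pend o1 :|: sp_pend o2) (sp_delay o1 :|: sp_delay o2)).1.
    have := (leq_card_setU (sp_pend o1) (sp_pend o2)).1.
    have := (leq_card_setU (sp_delay o1) (sp_delay o2)).1.
    have arith (t d a1 a2 d1 d2 l1 l2 l u v y z : nat) : (0 < t -> a1 < t -> a2 < t ->
      l1 <= t.+1 -> l2 <= t.+1 -> d1 <= l1 + d -> d2 <= l2 + d -> l <= t.+1 ->
      u <= d1 + d2 -> v <= a1 + a2 -> y <= v + u -> z <= y + l -> z <= 8 * t + 2 * d)%N.
      by lia.
    exact: (arith _ _ _ _ _ _ _ _ _ _ _ _ _ tau_gt0 q1 q2 hSo1 hSo2 b1 b2 hS).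
  + have -> : #|Y1 :|: Y2| = (#|Y1| + #|Y2|)%N.
      by rewrite cardsU; move: d12; rewrite -setI_eq0 => /eqP ->; rewrite cards0 subn0.
    have -> : #|sp_pend o1 :|: sp_pend o2| = (#|sp_pend o1| + #|sp_pend o2|)%N.
      rewrite cardsU; suff -> : sp_pend o1 :&: sp_pend o2 = set0 by rewrite cards0 subn0.
      apply/setP=> v; rewrite !inE; apply/negP => /andP [h1 h2].
      have v1 : v \in Y1 by apply: (subsetP E1); rewrite inE h1.
      have v2 : v \in Y2 by apply: (subsetP E2); rewrite inE h2.
      by have := disjointFr d12 v1; rewrite v2.
    rewrite !natrD mulrDr; set phi := 2 * _ / _ in t1P t2P *.
    have -> : phi * (#|Y1|%:R + #|Y2|%:R - (#|sp_pend o1|%:R + #|sp_pend o2|%:R)) =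
      phi * (#|Y1|%:R - #|sp_pend o1|%:R) + phi * (#|Y2|%:R - #|sp_pend o2|%:R) by ring.
    by move: (lerD t1P t2P); lra.
  by move=> o m t; rewrite addnA.
exists (fun st => let! o := p1 st in
  settle mm tau S' (SparseOut (sp_st o) (sp_pend o :|: (S :\: S')) (sp_delay o) (sp_open o))).
move=> x A delta mem st Mv hA hn hi r.
have [hS dS1 n1] := sdecP s1.
have r1 : ready e st Mv Y S.
  split=> //; last by move=> i j iY; apply: (ready_pat r); rewrite inE iY.
    by apply: disjointWl (ready_dis r); apply: subsetUl.
  exact: ready_herm r.
apply: (runs_bind (IH1 _ _ _ _ _ _ hA hn hi r1)).
move=> o m1 t1 [M1 [c1 q1 op1 [[So1 hSo1 z1] D01] t1P]].
have E1 := core_sub c1.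
have dd : [disjoint sp_delay o & pset (sp_st o)].
  rewrite (core_pset c1) disjoints_subset; apply/subsetP=> v vD.
  have vY : v \in Y by apply: (subsetP E1); rewrite inE vD orbT.
  rewrite !inE vD orbT /= orbF.
  by have := disjointFr (ready_dis r1) vY; rewrite inE => ->.
have b1 := delay_bound (core_inv c1) dd z1 hn.
apply: (settleP (o := SparseOut _ _ _ _) (Mv := M1)
  (b := 8 * tau + 2 * delta) hA r _ _ _ _ hS' _) => /=.
- split=> //=.
  + exact: core_inv c1.
  + rewrite (core_pset c1); apply/setP=> v; rewrite !inE.
    have := disjointFr dS1 (x := v).
    case: (v \in Y) => [/(_ isT) ->|_]; rewrite ?andbF ?orbF //=;
    by case: (v \in flatten _) => //; do !case: (v \in _) => //=.
  + apply/subsetP=> v; have := subsetP E1 v; rewrite !inE.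
    by case: (v \in sp_pend o); case: (v \in sp_delay o); case: (v \in S');
      case: (v \in S); case: (v \in Y) => //= h; have := h isT.
  + rewrite disjoints_subset; apply/subsetP=> v; have := subsetP E1 v; rewrite !inE.
    have := disjointFr dS1 (x := v); have := disjointFr (core_dis c1) (x := v).
    case: (v \in sp_pend o); case: (v \in sp_delay o); case: (v \in S');
      case: (v \in S); case: (v \in Y) => //= h1 h2 h3 _;
      by [have := h1 isT|have := h2 isT|have := h3 isT].
  move=> i j hi'; apply: (core_out c1); move: hi'; rewrite !inE.
  by case: (i \in S'); case: (i \in S); case: (i \in Y).
- by move=> _; exists So1.
- exact: D01.
- have := (leq_card_setU (sp_pend o :|: (S :\: S') :|: sp_delay o) S').1.
  have := (leq_card_setU (sp_pend o :|: (S :\: S')) (sp_delay o)).1.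
  have := (leq_card_setU (sp_pend o) (S :\: S')).1.
  have := subset_leq_card (subsetDl S S').
  have arith (t d a d1 l1 l l' u v y z : nat) : (0 < t -> a < t -> l1 <= t.+1 ->
    d1 <= l1 + d -> l <= t.+1 -> l' <= t.+1 ->
    u <= l -> v <= a + u -> y <= v + d1 -> z <= y + l' -> z <= 8 * t + 2 * d)%N.
    by lia.
  exact: (arith _ _ _ _ _ _ _ _ _ _ _ tau_gt0 q1 hSo1 b1 hS hS').
(* Vertices leaving the separator enter [Y] and the pending set together, so the potential does not
   change. *)
have dSS : [disjoint Y & S :\: S'] by apply: disjointWr dS1; apply: subsetDl.
have -> : #|Y :|: S :\: S'| = (#|Y| + #|S :\: S'|)%N.
  by rewrite cardsU; move: dSS; rewrite -setI_eq0 => /eqP ->; rewrite cards0 subn0.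
have -> : #|sp_pend o :|: S :\: S'| = (#|sp_pend o| + #|S :\: S'|)%N.
  rewrite cardsU; suff -> : sp_pend o :&: (S :\: S') = set0 by rewrite cards0 subn0.
  apply/setP=> v; rewrite in_set0; apply/negP => /setIP [h1 h2].
  have v1 : v \in Y by apply: (subsetP E1); rewrite inE h1.
  by have := disjointFr dSS v1; rewrite h2.
by rewrite !natrD opprD addrACA subrr addr0.
Qed.

End Recursion.

End Sparse.

(** * From complete eliminations to LDL factorizations *)

Section FullFactorization.
Variables (F : fieldType) (theta : {rmorphism F -> F}).
Hypothesis thetaK : involutive theta.
Variable n : nat.
Local Notation conjtr := (conjtr theta).
Local Notation dg := (@dg F n).
Local Notation fact := (fact theta).

Lemma block_unique (s : seq (seq 'I_n)) c c' v : uniq (flatten s) ->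
  v \in nth [::] s c -> v \in nth [::] s c' -> c = c'.
Proof.
elim: s c c' => [|b s IH] [|c] [|c'] //=; rewrite cat_uniq => /and3P [_ /hasPn h u].
- move=> vb vc; have /h : v \in flatten s; last by rewrite /= vb.
  apply/flattenP; exists (nth [::] s c') => //; apply: mem_nth.
  by rewrite ltnNge; apply: contraL vc => hc; rewrite nth_default.
- move=> vc vb; have /h : v \in flatten s; last by rewrite /= vb.
  apply/flattenP; exists (nth [::] s c) => //; apply: mem_nth.
  by rewrite ltnNge; apply: contraL vc => hc; rewrite nth_default.
by move=> h1 h2; rewrite (IH c c').
Qed.

(** [s'] lays out the positions while [s] carries the nonzeros. The full form takes for [s'] the
    pivots followed by singletons, the reduced form [s] itself. *)
Lemma ldl_blocks m (s s' : seq (seq 'I_n)) (D : 'M[F]_n) (f : 'I_m -> 'I_n) :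
  uniq (flatten s') -> size (flatten s') = m ->
  all (fun b => size b \in [:: 1; 2]%N) s' -> {subset s <= s'} ->
  (forall i, f i = nth (f i) (flatten s') i) ->
  (forall u v, D u v != 0 ->
    exists b, [/\ b \in s, u \in b, v \in b & size b = 2%N -> u != v]) ->
  ldl_block_diagonal (mxsub f f D).
Proof.
move=> us sz as' ss hf hD; exists (shape s').
have hin i : f i \in nth [::] s' (reshape_index (shape s') i).
  rewrite {1}hf nth_flatten; apply: mem_nth.
  by rewrite -nth_shape reshape_offsetP // -size_flatten sz.
split.
- by apply/allP => b /mapP [q /(allP as')] h ->.
- by rewrite -size_flatten.
- move=> i j hij; rewrite mxE; apply/eqP; apply: contraT => /hD [b [/ss bs ib jb _]].
  move: bs => /(nthP [::]) [c _ bE]; rewrite -bE in ib jb.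
  by rewrite (block_unique us (hin i) ib) (block_unique us (hin j) jb) eqxx in hij.
move=> i h2; rewrite mxE; apply/eqP; apply: contraT => /hD [b [/ss bs ib _ h]].
move: bs => /(nthP [::]) [c hc bE]; rewrite -bE in ib h.
have e := block_unique us (hin i) ib; rewrite e in h2.
have : f i != f i by apply: h; rewrite -h2 (nth_map [::]).
by rewrite eqxx.
Qed.

Definition full_order (s : seq (seq 'I_n)) : seq 'I_n :=
  flatten s ++ [seq i <- enum 'I_n | i \notin flatten s].

(** The identity is a dummy value: a permutation is found whenever the pivots are distinct. *)
Definition order_perm (s : seq (seq 'I_n)) : 'S_n :=
  odflt 1%g [pick g : 'S_n | [forall k, g k == nth k (full_order s) k]].

Lemma full_order_uniq s : uniq (flatten s) -> uniq (full_order s).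
Proof.
move=> us; rewrite cat_uniq us filter_uniq ?enum_uniq // andbT.
by apply/hasPn => i; rewrite mem_filter => /andP [].
Qed.

Lemma size_full_order s : uniq (flatten s) -> size (full_order s) = n.
Proof.
move=> us; rewrite -[RHS](card_ord n) cardE; apply/perm_size/uniq_perm.
- exact: full_order_uniq.
- exact: enum_uniq.
by move=> i; rewrite mem_cat mem_filter mem_enum andbT orbN.
Qed.

Lemma order_permE s k : uniq (flatten s) -> order_perm s k = nth k (full_order s) k.
Proof.
move=> us; rewrite /order_perm; case: pickP => [g /forallP/(_ k)/eqP //|h].
have inj : injective (fun k : 'I_n => nth k (full_order s) k).
  move=> i j /= e; apply: val_inj; apply/eqP.
  rewrite -(nth_uniq i _ _ (full_order_uniq us)) ?size_full_order ?ltn_ord //.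
  by apply/eqP; rewrite e; apply: set_nth_default; rewrite size_full_order.
have := h (perm inj); move/negP; case; apply/forallP => i.
by rewrite permE.
Qed.

(** Nonpivot columns become unit vectors, which makes the matrix unit triangular; the product is
    unaffected since D vanishes there. *)
Definition full_L (P : seq 'I_n) (L : 'M[F]_n) : 'M[F]_n :=
  \matrix_(i, j) if j \in P then L i j else (i == j)%:R.

Lemma mul_sub1 m p (f : 'I_m -> 'I_n) (M : 'M[F]_(p, n)) :
  M *m colsub f 1%:M = colsub f M.
Proof.
apply/matrixP=> i j; rewrite !mxE (bigD1 (f j)) //= big1 => [|k kf].
  by rewrite !mxE eqxx mulr1 addr0.
by rewrite !mxE (negbTE kf) mulr0.
Qed.

Lemma fact_LDL A s Z D N (g := order_perm s) : conjtr A = A ->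
  fact A s Z D N -> schur A N = 0 ->
  is_LDL_factorization theta A g^-1%g
    (mxsub g g (full_L (flatten s) (A *m Z))) (mxsub g g D).
Proof.
move=> hA f S0; have us := fact_uniq f; set P := flatten s in us *.
have gE k : g k = nth k (full_order s) k by apply: order_permE.
(* This makes the leading columns of the reduced form exactly the pivot columns. *)
have rA : \rank A = size P.
  apply/eqP; rewrite eqn_leq; apply/andP; split.
    by have := rank_schur (fact_inv f); rewrite S0 mxrank0 addn0.
  exact: rank_inv (fact_inv f) us.
set L := A *m Z; set Lf := full_L P L.
have Lr : L *m dg P = L by rewrite -mulmxA (fact_Zr f).
have AE : A = L *m D *m conjtr L.
  move/eqP: S0; rewrite /schur subr_eq0 => /eqP {1}->.
  rewrite (fact_N f) /L conjtrM hA !mulmxA //.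
have LfE : Lf *m dg P = L.
  by rewrite -[RHS]Lr; apply/matrixP=> i j; rewrite !mul_rdgE; case: ifP => // h; rewrite mxE h.
have Dl := fact_D0l f.
have Dr : D *m dg P = D.
  apply: (can_inj (@conjtrK _ _ thetaK n n)).
  by rewrite conjtrM conjtr_dg (fact_Dh f) Dl.
have AE2 : A = Lf *m D *m conjtr Lf.
  by rewrite AE -LfE conjtrM conjtr_dg -!mulmxA (mulmxA (dg P)) Dl (mulmxA D) Dr.
have gP (k : 'I_n) : (g k \in P) = (k < size P)%N.
  rewrite gE /full_order nth_cat; case: ltnP => hk; first by rewrite mem_nth.
  apply/negP => h; have : nth k [seq i <- enum 'I_n | i \notin P] (k - size P) \in
     [seq i <- enum 'I_n | i \notin P].
    apply: mem_nth; rewrite -(ltn_add2l (size P)) subnKC // -size_cat.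
    by rewrite size_full_order.
  by rewrite mem_filter h.
have gI (k : 'I_n) : (k < size P)%N -> index (g k) P = k.
  by move=> hk; rewrite gE /full_order nth_cat hk index_uniq.
have ginj : injective g by apply: perm_inj.
have Ltri (i j : 'I_n) : (i <= j)%N -> Lf (g i) (g j) = (i == j)%:R.
  move=> ij; rewrite mxE (inj_eq ginj); case: ifP => //; rewrite gP => hj.
  have hi : (i < size P)%N by apply: leq_ltn_trans hj.
  by rewrite (fact_L f) ?gP ?gI // (inj_eq ginj).
(* [g] sends positions to vertices, so the matrix P with P^T A P listed in the order [g] is that of
   [g^-1]. *)
have cj (X : 'M[F]_n) : mxsub g g X = perm_mx g *m X *m perm_mx g^-1.
  by rewrite -col_permE -row_permE; apply/matrixP=> i j; rewrite !mxE.
have pp : perm_mx g^-1%g *m perm_mx g = 1%:M :> 'M[F]_n.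
  by rewrite -perm_mxM mulVg perm_mx1.
have pc : conjtr (perm_mx g : 'M[F]_n) = perm_mx g^-1%g.
  by rewrite /Defs.conjtr tr_perm_mx map_perm_mx.
have pc' : conjtr (perm_mx g^-1%g : 'M[F]_n) = perm_mx g.
  by rewrite -pc conjtrK.
have EQ : (perm_mx g^-1%g)^T *m A *m perm_mx g^-1%g =
    mxsub g g Lf *m mxsub g g D *m conjtr (mxsub g g Lf).
  rewrite tr_perm_mx invgK !cj !conjtrM pc pc' !mulmxA.
  rewrite -(mulmxA _ (perm_mx g^-1%g) (perm_mx g)) pp mulmx1.
  rewrite -(mulmxA _ (perm_mx g^-1%g) (perm_mx g)) pp mulmx1.
  by rewrite {1}AE2 !mulmxA.
have Dh : conjtr (mxsub g g D) = mxsub g g D.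
  by apply/matrixP=> i j; rewrite !mxE (herm_entry _ _ (fact_Dh f)).
split.
  split=> //.
    move=> i j; rewrite mxE; split=> [h|/val_inj ->]; rewrite Ltri ?(ltnW h) //.
      by rewrite -val_eqE /= ltn_eqF.
    by rewrite eqxx.
  pose s' := s ++ [seq [:: v] | v <- enum 'I_n & v \notin P].
  have fs' : flatten s' = full_order s.
    by rewrite /s' flatten_cat flatten_seq1.
  apply: (@ldl_blocks n s s') (fact_D f).
  - by rewrite fs' full_order_uniq.
  - by rewrite fs' size_full_order.
  - rewrite all_cat (fact_size f) /=; apply/allP => b /mapP [v _ ->].
    by rewrite inE.
  - by move=> b hb; rewrite mem_cat hb.
  move=> i; rewrite fs' {1}gE; apply: set_nth_default.
  by rewrite size_full_order.
set lead := widen_ord _.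
have lE : colsub lead (mxsub g g Lf) = mxsub g g Lf *m colsub lead 1%:M.
  by rewrite mul_sub1.
set E := colsub lead 1%:M in lE.
have ET : E^T *m mxsub g g D *m E = mxsub lead lead (mxsub g g D).
  rewrite {2}/E mul_sub1; apply/matrixP=> i j; rewrite !mxE (bigD1 (lead i)) //= big1.
    by rewrite !mxE eqxx mul1r addr0.
  by move=> k kl; rewrite !mxE (negbTE kl) mul0r.
have Ec : conjtr E = E^T.
  by apply/matrixP=> i j; rewrite !mxE rmorph_nat.
(* [E *m E^T] projects onto the leading positions, where D lives, so truncation loses nothing. *)
have EE : E *m E^T *m mxsub g g D = mxsub g g D.
  apply/matrixP=> i j; rewrite mxE (bigD1 i) //= big1 => [|k ki].
    rewrite addr0 !mxE.
    have [ip|ip] := boolP (g i \in P); last first.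
      have -> : D (g i) (g j) = 0 by rewrite -Dl mul_dgE (negbTE ip).
      by rewrite mulr0.
    rewrite gP -rA in ip.
    rewrite (bigD1 (Ordinal ip)) //= big1 => [|k kn].
      by rewrite !mxE -val_eqE /= eqxx mulr1 addr0 mul1r.
    rewrite !mxE; case: eqP => [e|]; last by rewrite mul0r.
    by case/eqP: kn; apply: val_inj; rewrite /= e.
  rewrite mxE big1 ?mul0r // => l _; rewrite !mxE.
  case: eqP => [<-|]; last by rewrite mul0r.
  by rewrite eq_sym in ki; case: eqP => [e|]; rewrite ?mulr0 // -e eqxx in ki *.
split.
- rewrite EQ lE -ET conjtrM Ec; move: (mxsub g g Lf) => L1.
  have EE2 : mxsub g g D *m (E *m E^T) = mxsub g g D.
    apply: (can_inj (@conjtrK _ _ thetaK n n)).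
    by rewrite !conjtrM Dh Ec -{1}Ec conjtrK.
  have -> : L1 *m E *m (E^T *m mxsub g g D *m E) *m (E^T *m conjtr L1) =
      L1 *m (E *m E^T *m mxsub g g D *m (E *m E^T)) *m conjtr L1.
    by rewrite !mulmxA.
  by rewrite EE EE2.
- move=> i j; rewrite mxE; split=> [h|h].
    rewrite mxE Ltri ?(ltnW h) // -val_eqE /= ltn_eqF //.
  by rewrite mxE Ltri ?h // -val_eqE /= h eqxx.
- by apply/matrixP=> i j; rewrite !mxE (herm_entry _ _ (fact_Dh f)).
have -> : mxsub lead lead (mxsub g g D) = mxsub (g \o lead) (g \o lead) D.
  by apply/matrixP=> i j; rewrite !mxE.
apply: (@ldl_blocks _ s s) (fact_D f) => //; first exact: fact_size f.
move=> i; have hi : (i < size P)%N by rewrite -rA.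
by rewrite /= {1}gE /full_order nth_cat /= hi; apply: set_nth_default.
Qed.

(** Serves treewidth 0: D = A and L = 1 can be output without any operation, the inverse [Z]
    existing only in the proof. *)
Lemma diag_fact (A : 'M[F]_n) : conjtr A = A ->
  (forall i j, i != j -> A i j = 0) -> \rank A = n ->
  let s := [seq [:: v] | v <- enum 'I_n] in
  exists Z D N, [/\ fact A s Z D N, schur A N = 0, D = A & A *m Z = 1%:M].
Proof.
move=> hA dA rA s.
have uA : A \in unitmx by rewrite -row_full_unit /row_full rA.
pose Z := invmx A.
have fs : flatten s = enum 'I_n by rewrite flatten_seq1.
have d1 : dg (enum 'I_n) = 1%:M.
  by apply/matrixP=> i j; rewrite !mxE mem_enum andbT.
have i1 : inv_on (enum 'I_n) (enum 'I_n) A Z.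
  by split; rewrite d1 ?mul1mx ?mulmx1 ?mulmxV ?mulVmx.
have Zh : conjtr Z = Z by apply: inv_herm i1.
exists Z, A, Z; split=> //; last by rewrite mulmxV.
  split; rewrite ?fs //.
  - exact: enum_uniq.
  - by apply/allP => b /mapP [v _ ->]; rewrite inE.
  - by rewrite d1 mul1mx mulmx1.
  - move=> u v huv; have <- : u = v by apply/eqP; apply: contraNT huv => /dA ->.
    exists [:: u]; split; rewrite ?inE //; apply/mapP; exists u => //.
    by rewrite mem_enum.
  - by rewrite mulVmx // mul1mx Zh.
  by move=> u v _ _ _; rewrite mulmxV // mxE.
by rewrite /schur mulmxV // mul1mx subrr.
Qed.

End FullFactorization.

(** * The algorithm *)

Section PatternTest.
Variables (F : fieldType) (I : eqType) (O : Type).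

(** [acc] collects the positions of nonzero inputs. Tests being free, a separate builder for each
    pattern costs nothing. *)
Fixpoint branch (ps acc : seq I) (k : seq I -> builder F I O) : builder F I O :=
  match ps with
  | [::] => k acc
  | p :: ps => cif (Input p) (branch ps acc k) (branch ps (p :: acc) k)
  end.

Lemma branchP (theta : F -> F) (x : I -> F) mem ps acc k Q :
  (forall l, l =i [seq p <- ps | x p != 0] ++ acc -> runs theta x mem (k l) Q) ->
  runs theta x mem (branch ps acc k) Q.
Proof.
elim: ps acc => [|p ps IH] acc h /=; first exact: h.
apply: (runs_if (v := x p)) => // hp; apply: IH => l hl; apply: h => i.
  by rewrite hl /= hp eqxx.
by rewrite hl /= hp /= !inE !mem_cat !inE; case: (i == p); rewrite ?orbT.
Qed.

End PatternTest.

(** * Elementary facts on treewidth *)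

Section Widths.
Variables (V : finType) (e : rel V).

Lemma has_treewidth_uniq t1 t2 : has_treewidth e t1 -> has_treewidth e t2 -> t1 = t2.
Proof.
move=> [[T1 [r1 [B1 [d1 w1]]]] m1] [[T2 [r2 [B2 [d2 w2]]]] m2].
by apply/eqP; rewrite eqn_leq -{2}w1 -{1}w2 (m1 _ _ _ d2) (m2 _ _ _ d1).
Qed.

(** Comparison with the one-bag decomposition. It serves to absorb the cost of the last stage into
    that of about n / tau stages. *)
Lemma has_treewidth_le_card t : has_treewidth e t -> (t <= #|V|)%N.
Proof.
move=> [_ m]; pose B (_ : unit) := [set: V].
have d : tree_decomposition e (fun _ _ : unit => false) B.
  split.
  - split=> //; first by rewrite card_unit.
      by move=> [] []; apply: connect0.
    by move=> [|[] [|[] c]] //=; rewrite /ucycleb.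
  - by move=> v; exists tt; rewrite inE.
  - by move=> u v _; exists tt; rewrite !inE.
  by move=> v [] [] _ _; apply: connect0.
apply: leq_trans (m _ _ _ d) _; rewrite /td_width.
apply: leq_trans (leq_pred _) _; apply/bigmax_leqP => a _.
by rewrite cardsT.
Qed.

Lemma has_treewidth0 u v : has_treewidth e 0 -> e u v -> u = v.
Proof.
move=> [[T [r [B [[_ _ cov _] w0]]]] _] /cov [a /andP [ua va]].
apply/eqP; apply: contraT => uv.
have h : (#|[set u; v]| <= #|B a|)%N.
  by apply/subset_leq_card/subsetP => z; rewrite !inE => /orP [] /eqP ->.
have h2 : (#|B a| <= \max_(b : T) #|B b|)%N by apply: leq_bigmax.
by move: w0 (leq_trans h h2); rewrite /td_width cards2 uv; case: (\max_(b : T) _) => [|[]].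
Qed.

Lemma has_treewidth_sdec t : has_treewidth e t -> sdec e t.+1 set0 setT.
Proof.
move=> [[T [r [B [d w]]]] _]; apply: sdec_of_tree_decomposition d _ _ => a.
by rewrite -w; apply: leq_trans (leqSpred _); apply: leq_bigmax.
Qed.

End Widths.

Section Output.
Variables (F : fieldType) (n : nat) (mm : forall q, mm_program F q).
Local Notation I := ('I_n * 'I_n)%type.
Local Notation state := (front_data F I n).

Definition init_state : state :=
  FrontData [::] op0 op0 (fun i j => Input (i, j)).

Definition output_of (st : state) : ldl_output (operand F I) n :=
  let g := order_perm (fr_s st) in
  LDLOutput g^-1%g
    (\matrix_(i, j) if g j \in flatten (fr_s st) then fr_L st (g i) (g j)
                    else Const (g i == g j)%:R)
    (\matrix_(i, j) fr_D st (g i) (g j)).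

Definition diag_state : state :=
  FrontData [seq [:: v] | v <- enum 'I_n] (fun i j => Const (i == j)%:R)
    (fun i j => if i == j then Input (i, j) else Const 0) op0.

Definition ldl_comp (p : state -> builder F I (sparse_out F I n)) :
    builder F I (ldl_output (operand F I) n) :=
  let! o := p init_state in
  let! st := stage mm (sp_st o) (sp_pend o :|: sp_delay o) set0 in
  cret (output_of st).

End Output.

Section Final.
Variables (F : fieldType) (theta : {rmorphism F -> F}).
Hypothesis thetaK : involutive theta.
Variables (n : nat).
Variables (mm : forall q, mm_program F q) (R : realType) (w cmm : R).
Hypothesis mmP : forall q (X Y : 'M[F]_q),
  mx_result theta (mm_input X Y) (mm q) (leaf theta (mm_input X Y) (mm q)) = X *m Y.
Hypothesis mm_cost : forall j (X Y : 'M[F]_(2 ^ j)),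
  (cost theta (mm_input X Y) (mm (2 ^ j)))%:R <= cmm * w ^+ j.
Hypothesis w_gt4 : 4 < w.
Local Notation I := ('I_n * 'I_n)%type.
Local Notation state := (front_data F I n).
Local Notation dg := (@dg F n).
Local Notation conjtr := (conjtr theta).
Local Notation fact := (fact theta).

Definition good_output (A : 'M[F]_n) (o : ldl_output (operand F I) n) (m : seq F) :=
  is_LDL_factorization theta A (Defs.out_perm o)
    (map_mx (operand_val (mx_input A) m) (out_L o))
    (map_mx (operand_val (mx_input A) m) (out_D o)).

Lemma good_output_of A m st Z D N : conjtr A = A -> fact A (fr_s st) Z D N ->
  schur A N = 0 -> repM (mx_input A) m (fr_L st) (A *m Z) ->
  repM (mx_input A) m (fr_D st) D -> good_output A (output_of st) m.
Proof.
move=> hA f S0 hL hD; have h := fact_LDL thetaK hA f S0.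
rewrite /good_output /=; set g := order_perm _ in h *.
move: (A *m Z) hL h => L hL h.
congr (is_LDL_factorization _ _ _ _ _): h.
  apply/matrixP=> i j; rewrite !mxE; case: ifP => _ //=.
  by rewrite (rep_val (hL _ _)).
by apply/matrixP=> i j; rewrite !mxE (rep_val (hD _ _)).
Qed.

Lemma ldl_comp_diag A : conjtr A = A -> (forall i j, i != j -> A i j = 0) ->
  \rank A = n ->
  runs theta (mx_input A) [::] (cret (output_of (diag_state F n)))
    (fun o m t => good_output A o m /\ t = 0%N).
Proof.
move=> hA dA rA; apply: runs_ret; split=> //.
have [Z [D [N [f S0 DA AZ]]]] := diag_fact thetaK hA dA rA.
apply: (good_output_of hA (st := diag_state F n) f S0) => i j e /=.
  by rewrite AZ mxE.
by rewrite DA; case: eqVneq => [->|ij] //=; rewrite dA.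
Qed.

Lemma ldl_comp_sparse (e : rel 'I_n) tau : (0 < tau)%N -> sdec e tau.+1 set0 setT ->
  exists p : builder F I (ldl_output (operand F I) n), forall A delta,
    conjtr A = A -> (forall i j, i != j -> A i j != 0 -> e i j) ->
    (n <= \rank A + delta)%N ->
    runs theta (mx_input A) [::] p (fun o m t => good_output A o m /\
      let K := stage_cost w cmm (8 * tau + 2 * delta) in
      t%:R <= 2 * K / tau%:R * n%:R + K).
Proof.
move=> t0 sd; have [p hp] := sparse_elim thetaK I mmP mm_cost w_gt4 t0 sd.
exists (ldl_comp mm p) => A delta hA hpat hn; set K := stage_cost _ _ _.
pose st0 := init_state F n.
have hM : repM (mx_input A) [::] (fr_M st0) A by move=> i j.
have hi : stinv theta (mx_input A) A [::] st0 A.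
  exists 0, 0, 0; split=> //; try (rewrite ?mulmx0; exact: repM0).
    exact: fact_nil.
  by rewrite /schur mulmx0 mul0mx subr0.
have [_ dsep nbr] := sdecP sd.
have r : ready theta e st0 A setT set0.
  by split=> // i j _; apply: hpat.
apply: (runs_bind (hp _ _ _ _ _ _ hA hn hi r)).
move=> o m t [M1 [c1 q1 op1 [[So hSo z1] D0] tP]].
have E1 : #|[set: 'I_n]| = n by rewrite cardsT card_ord.
have dd : [disjoint sp_delay o & pset (sp_st o)].
  rewrite (core_pset c1) disjoints_subset; apply/subsetP=> v vD.
  by rewrite !inE vD orbT.
have b1 := delay_bound (core_inv c1) dd z1 hn.
have hb : (#|(sp_pend o :|: sp_delay o) :|: set0| <= 8 * tau + 2 * delta)%N.
  rewrite setU0; have := (leq_card_setU (sp_pend o) (sp_delay o)).1.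
  have arith (a b c d z : nat) : (a < tau -> b <= c + d -> c <= tau.+1 ->
    z <= a + b -> 0 < tau -> z <= 8 * tau + 2 * d)%N by lia.
  by move=> h; apply: arith q1 b1 hSo h t0.
apply: (runs_bind (stageP thetaK mmP mm_cost w_gt4 hA r c1 hb)).
move=> st1 m1 t1 [ht1 [M2 [c2 z2 _]]]; apply: runs_ret.
have [Z [D [N [f hL hD _ M2E]]]] := core_inv c2.
(* Every vertex is either a pivot, with zero row and column, or left over by the last stage, whose
   left-over block is zero. *)
have M20 : M2 = 0.
  apply/matrixP=> i j; rewrite mxE.
  have [hi1|hi1] := boolP (i \in pset st1); first exact: stinv_row0 (core_inv c2) hi1.
  have [hj|hj] := boolP (j \in pset st1); first exact: stinv_col0 (core_inv c2) hj.
  have inD k : k \notin pset st1 -> k \in (sp_pend o :|: sp_delay o) :\: pset st1.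
    move=> hk; apply: contraT => hk'; case/negP: hk.
    by rewrite (core_pset c2) inE; apply/orP; right; rewrite set0U inE hk' inE.
  by apply: z2; apply: inD.
split; first by apply: good_output_of hA f _ hL hD; rewrite -M2E.
have w_ge4 := ltW w_gt4; have w0 : 0 <= w by apply: le_trans w_ge4.
have K0 : 0 <= K.
  by apply: mulr_ge0; [apply: (cfront_ge0 mm_cost)|apply: exprn_ge0].
have phi0 : 0 <= 2 * K / tau%:R by apply: divr_ge0 => //; apply: mulr_ge0.
rewrite /= addn0 natrD; apply: lerD; last exact: ht1.
have h1 : t%:R <= t%:R + K * (sp_open o)%:R by rewrite lerDl mulr_ge0.
apply: le_trans h1 (le_trans tP _); rewrite ler_wpM2l //.
by rewrite E1 gerBl.
Qed.

End Final.

(** The factor 3 is 2 for the amortized stages and 1 for the last one. The base [2 * (8 + 2 * c)] is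
    the stage size divided by [tau], doubled by rounding up to a power of two. *)
Lemma stage_cost_le (R : realType) (omega cmm : R) (c n tau : nat) :
  2 < omega -> 0 <= cfront (2 `^ omega) cmm -> (0 < tau)%N -> (tau <= n)%N ->
  forall K, K = stage_cost (2 `^ omega) cmm (8 * tau + 2 * (c * tau)) ->
  2 * K / tau%:R * n%:R + K <=
  3 * cfront (2 `^ omega) cmm * (2 * (8 + 2 * c))%:R `^ omega *
    (n%:R * tau%:R `^ (omega - 1)).
Proof.
move=> h2 cf0 t0 tn K; set b := (8 * tau + 2 * (c * tau))%N => KE.
have T0 : 0 < tau%:R :> R by rewrite ltr0n.
have o0 : 0 <= omega by apply: ltW; apply: lt_trans h2; rewrite ltr0n.
have b1 : (1 < b)%N by rewrite /b; clear -t0; lia.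
have hk : (2 ^ up_log 2 b <= 2 * b)%N.
  have := up_log_gtn (isT : (1 < 2)%N) b1.
  have : (0 < up_log 2 b)%N by rewrite up_log_gt0.
  case: (up_log 2 b) => // k _ /= h; rewrite expnS leq_mul2l /=.
  exact: ltnW.
have wk : (2 `^ omega) ^+ up_log 2 b <= (2 * (8 + 2 * c))%:R `^ omega * tau%:R `^ omega.
  rewrite -powR_mulrn ?powR_ge0 // -powRrM mulrC powRrM powR_mulrn //.
  rewrite -powRM ?ler0n // -natrX -natrM; apply: ge0_ler_powR => //; rewrite ?nnegrE ?ler0n //.
  by rewrite ler_nat (leq_trans hk) // /b; clear; lia.
have tw : tau%:R `^ omega = tau%:R `^ (omega - 1) * tau%:R :> R.
  rewrite -{3}(powRr1 (ltW T0)) -powRD ?subrK //.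
  by rewrite (gt_eqF T0) implybT.
set u := tau%:R `^ (omega - 1) in tw *; set v := (2 * (8 + 2 * c))%:R `^ omega in wk *.
have KT : K / tau%:R <= cfront (2 `^ omega) cmm * v * u.
  rewrite KE.
  rewrite ler_pdivrMr // -!mulrA -tw; by rewrite /stage_cost ler_wpM2l.
have K0 : 0 <= K by rewrite KE mulr_ge0 // exprn_ge0 // powR_ge0.
have KK : K <= K / tau%:R * n%:R.
  rewrite mulrAC -mulrA ler_peMr // ler_pdivlMr // mul1r.
  by rewrite ler_nat.
apply: le_trans (lerD (lexx _) KK) _.
rewrite [leLHS](_ : _ = 3 * n%:R * (K / tau%:R)); last by ring.
rewrite [leRHS](_ : _ = 3 * n%:R * (cfront (2 `^ omega) cmm * v * u)); last by ring.
by rewrite ler_wpM2l // mulr_ge0.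
Qed.

Theorem corollary5p11 (F : fieldType) (theta : {rmorphism F -> F})
    (thetaK : involutive theta) (R : realType) (omega : R)
    (omega_gt2 : 2 < omega) (mm_omega : matmul_exponent theta omega) :
  exists alg : forall n : nat, ldl_program F n,
    forall c : nat, exists C : R,
      forall (n tau : nat) (A : 'M[F]_n),
        conjtr theta A = A ->
        has_treewidth (mx_graph A) tau ->
        (n - \rank A <= c * tau)%N ->
        computes_LDL theta (alg n) A /\
        (cost theta (mx_input A) (alg n))%:R
          <= C * (n%:R * tau%:R `^ (omega - 1)).
Proof.
have [mm [cmm mmE]] := mm_omega.
have mmP q X Y := proj1 (mmE q X Y).
pose w : R := 2 `^ omega.
have mm_cost j (X Y : 'M[F]_(2 ^ j)) :
    (cost theta (mm_input X Y) (mm (2 ^ j)%N))%:R <= cmm * w ^+ j.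
  have <- : (2 ^ j)%:R `^ omega = w ^+ j.
    by rewrite /w -powR_mulrn ?powR_ge0 // -powRrM mulrC powRrM powR_mulrn // natrX.
  exact: (proj2 (mmE _ X Y)).
have w_gt4 : 4 < w.
  have -> : 4 = 2 `^ 2%:R :> R by rewrite powR_mulrn // -natrX.
  by rewrite /w /powR pnatr_eq0 ltr_expR ltr_pM2r // ln_gt0 // ltr1n.
have cf0 := cfront_ge0 mm_cost w_gt4.
(* [c] enters only through this constant; the program below is chosen before it. *)
pose Cf (c : nat) : R := 3 * cfront w cmm * (2 * (8 + 2 * c))%:R `^ omega.
have H n : exists q : ldl_program F n, forall c tau (A : 'M[F]_n),
    conjtr theta A = A -> has_treewidth (mx_graph A) tau ->
    (n - \rank A <= c * tau)%N ->
    computes_LDL theta q A /\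
    (cost theta (mx_input A) q)%:R <= Cf c * (n%:R * tau%:R `^ (omega - 1)).
  have Hl (l : seq ('I_n * 'I_n)) :
      exists p : builder F _ (ldl_output (operand F ('I_n * 'I_n)) n),
      forall c tau (A : 'M[F]_n), conjtr theta A = A ->
      (forall i j, ((i, j) \in l) = (A i j != 0)) ->
      has_treewidth (mx_graph A) tau -> (n - \rank A <= c * tau)%N ->
      runs theta (mx_input A) [::] p (fun o m t => good_output theta A o m /\
        t%:R <= Cf c * (n%:R * tau%:R `^ (omega - 1))).
    pose e : rel 'I_n := [rel i j | (i != j) && (((i, j) \in l) || ((j, i) \in l))].
    have eE (A : 'M[F]_n) : (forall i j, ((i, j) \in l) = (A i j != 0)) -> mx_graph A = e.
      by move=> h; apply/funext => i; apply/funext => j; rewrite /e /= !h.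
    (* The treewidth depends on the pattern alone and can be fixed before [A]. If the pattern had
       none, the premise would be contradictory and any program would do. *)
    have [[tau0 ht0]|no] := pselect (exists tau, has_treewidth e tau); last first.
      exists (cret (output_of (diag_state F n))) => c tau A _ /eE -> ht.
      by case: no; exists tau.
    have pat (A : 'M[F]_n) : (forall i j, ((i, j) \in l) = (A i j != 0)) ->
        forall i j, i != j -> A i j != 0 -> e i j.
      by move=> h i j ij; rewrite /e /= ij h => ->.
    (* At treewidth 0 the cost bound is 0; the graph has no edge and the corank bound [c * 0] forces
       [A] to be nonsingular, so the diagonal output applies. *)
    case: tau0 ht0 => [|tau0] ht0.
      exists (cret (output_of (diag_state F n))) => c tau A hA hl.
      rewrite (eE _ hl) => ht; rewrite -(has_treewidth_uniq ht0 ht) muln0 leqn0 subn_eq0 => hr.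
      apply: runs_weaken (ldl_comp_diag thetaK hA _ _) _.
      - move=> i j ij; apply/eqP; apply: contraT => aij.
        have E := has_treewidth0 ht0 (pat _ hl _ _ ij aij).
        by rewrite E eqxx in ij.
      - by apply/eqP; rewrite eqn_leq rank_leq_row.
      move=> o m t [h ->]; split=> //.
      by rewrite mulr_ge0 ?mulr_ge0 ?powR_ge0.
    have [p hp] := ldl_comp_sparse thetaK mmP mm_cost w_gt4 (ltn0Sn tau0)
      (has_treewidth_sdec ht0).
    exists p => c tau A hA hl; rewrite (eE _ hl) => ht.
    rewrite -(has_treewidth_uniq ht0 ht) leq_subLR addnC => hr.
    apply: runs_weaken (hp A (c * tau0.+1)%N hA (pat _ hl) _) _.
      by rewrite addnC.
    move=> o m t [h1 h2]; split=> //; apply: le_trans h2 _.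
    apply: stage_cost_le => //.
    by have := has_treewidth_le_card ht0; rewrite card_ord.
  (* Choice fixes one program per list of positions. The list delivered by [branch] is known only up
     to membership, which is why [Hl] speaks of membership. *)
  pose P l := projT1 (cid (Hl l)).
  exists (branch (enum {: 'I_n * 'I_n}) [::] P 0%N) => c tau A hA ht hr.
  have : runs theta (mx_input A) [::] (branch (enum {: 'I_n * 'I_n}) [::] P)
      (fun o m t => good_output theta A o m /\
        t%:R <= Cf c * (n%:R * tau%:R `^ (omega - 1))).
    apply: branchP => l hl; apply: (projT2 (cid (Hl l))) => // i j.
    by rewrite hl cats0 mem_filter mem_enum andbT.
  move=> [m [mE [h1 h2]]]; split; last exact: h2.
  by move: h1; rewrite /good_output -mE.
exists (fun n => projT1 (cid (H n))) => c; exists (Cf c) => n tau A.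
exact: (projT2 (cid (H n))).
Qed.
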